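(* Let $F$ be a non-archimedean local field with ring of integers $\mathcal{O}_F$, uniformizer $\varpi$, and let $\psi$ be a nontrivial additive character of $F$. Let $\mathcal{J}$ be one of the four split cubic Jordan algebras listed in the context, with cubic norm $N_{\mathcal{J}}$, trace $\mathrm{tr}$, identity $I$, and $n=\dim_F\mathcal{J}$. Put $Y=F\oplus\mathcal{J}$ and, for $\varphi\in C_c^\infty(Y(F))$ and $a\in F^\times$, define $$I(a,\varphi)=\int_{\mathcal{J}(F)}\varphi(a,A)\,\psi\Big(\frac{\mathrm{tr}(A)-N_{\mathcal{J}}(A)}{a}\Big)\,dA,\qquad I^{+}(\varphi)=\varphi(0,I),\quad I^{-}(\varphi)=\varphi(0,-I).$$ Then: (1) For every $\Phi\in C_c^\infty(F^\times)$ there exists $\varphi\in C_c^\infty(Y(F))$ with $I(a,\varphi)=\Phi(a)$ for all $a\in F^\times$. (2) If $\psi$ is unramified and $\varphi$ is the characteristic function of $Y(\mathcal{O}_F)=\mathcal{O}_F\oplus\mathcal{J}(\mathcal{O}_F)$, then $I^+(\varphi)=I^-(\varphi)=1$ and $$I(a,\varphi)=\begin{cases}0,&|a|>1,\\ 1,&|a|=1,\\ |a|^{(n-1)/2}\displaystyle\int_{\mathcal{O}_F^\times}\psi\Big(\frac{x+x^{-1}}{a}\Big)dx,&|a|<1.\end{cases}$$ (3) For every $\varphi\in C_c^\infty(Y(F))$, the function $a\mapsto |a|^{(1-n)/2}I(a,\varphi)$ on $F^\times$ belongs to $C^\infty_{OI}(F^\times,c_+,c_-)$ with $c_+=I^+(\varphi)$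 and $c_-=I^-(\varphi)$.
   Context: $q=|\varpi|^{-1}$. $\psi$ is called unramified if it is trivial on $\mathcal{O}_F$ but not on $\varpi^{-1}\mathcal{O}_F$. $dx$ is the $\psi$-self-dual Haar measure on $F$ (so $\mathrm{vol}(\mathcal{O}_F)=1$ when $\psi$ is unramified), and $dA$ is the product measure in the standard linear coordinates of $\mathcal{J}$; $\mathcal{J}(\mathcal{O}_F)$ denotes the points with all coordinates in $\mathcal{O}_F$. The four Jordan algebras are: (1) $\mathcal{J}=\mathrm{Mat}_{3\times3}(F)$ with $N_{\mathcal J}=\det$, usual trace, $n=9$; (2) $\mathcal{J}=\mathrm{Mat}_{1\times1}(F)\oplus \mathrm{Asym}_{4\times4}(F)$ (a cubic Jordan algebra of dimension $n=7$, identified with the unipotent radical of the parabolic of $S(\mathrm{GSpin}_8\times\mathrm{GL}_2)$ given by the Borel of $\mathrm{GL}_2$ times the maximal parabolic of $\mathrm{GSO}_8$ whose Levi omits $\alpha_4$); (3) $\mathcal{J}=\mathrm{Asym}_{6\times6}(F)$, the split cubic Jordan algebra of dimension $n=15$ (3×3 hermitian matrices over the split quaternions, with Pfaffian-type norm); (4) the split Albert algebra of $3\times3$ self-adjoint matrices over the split octonions, $n=27$. In each case $N_{\mathcal J}$, $\mathrm{tr}$, $I$ are the standard cubic norm, trace and identity. For $c_+,c_-\in\mathbb{C}$, $C^\infty_{OI}(F^\times,c_+,c_-)$ is the space of locally constant functions $f:F^\times\to\mathbb{C}$ whose support is bounded in $F$ and for which there is a neighborhood $\omega$ of $0$ in $F$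 with $$f(a)=c_+\int_{1+\varpi^m\mathcal{O}_F}\psi\Big(\frac{x+x^{-1}}{a}\Big)dx+c_-\int_{-1+\varpi^m\mathcal{O}_F}\psi\Big(\frac{x+x^{-1}}{a}\Big)dx\quad\text{for all }a\in\omega\setminus\{0\},$$ where $m>0$ is chosen with $|2|>|\varpi^m|$ (for $a$ near $0$ the integrals do not depend on such $m$). *)

(* Defs.v *)
From HB Require Import structures.
From mathcomp Require Import all_boot all_order all_algebra.
From mathcomp Require Import all_classical all_reals all_analysis.
From mathcomp Require Import complex.

Set Implicit Arguments.
Unset Strict Implicit.
Unset Printing Implicit Defensive.

Import Order.TTheory GRing.Theory Num.Theory.
Import numFieldNormedType.Exports.

Local Open Scope classical_set_scope.
Local Open Scope ring_scope.

(* A field complete for a discrete non-archimedean absolute value, with finite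
   residue field O/m, where O = {|x| <= 1} and m = {|x| < 1}.  In
   [lfabs_residue], p generates m, s is a system of representatives of O/m, and
   |p| = q^-1 with q = #(O/m) normalizes the absolute value.  [lfabs] cannot be
   a library norm, since those satisfy `|x *+ n| = `|x| *+ n. *)
HB.mixin Record isNonArchLocalField (R : realType) F
    of GRing.Field F & Uniform F := {
  lfabs : F -> R;
  lfabs_ge0 : forall x : F, 0 <= lfabs x;
  lfabs_eq0 : forall x : F, lfabs x = 0 <-> x = 0;
  lfabsM : forall x y : F, lfabs (x * y) = lfabs x * lfabs y;
  lfabs_ultra : forall x y : F,
    lfabs (x + y) <= Num.max (lfabs x) (lfabs y);
  lfentourage : forall E : set (F * F), entourage E <->
    exists2 e : R, 0 < e & forall x y : F, lfabs (x - y) < e -> E (x, y);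
  lfcomplete : forall U : set_system F, ProperFilter U -> cauchy U ->
    exists l : F, U --> l;
  lfabs_residue : exists (p : F) (s : seq F),
    [/\ 0 < lfabs p < 1,
        forall x : F, lfabs x < 1 -> lfabs x <= lfabs p,
        lfabs p = (size s)%:R^-1 &
        [/\ uniq s,
            {in s, forall x, lfabs x <= 1},
            {in s &, forall x y, lfabs (x - y) < 1 -> x = y} &
            forall x : F, lfabs x <= 1 ->
              exists2 y, y \in s & lfabs (x - y) < 1]]
}.

#[short(type="nonArchLocalFieldType")]
HB.structure Definition NonArchLocalField (R : realType) :=
  { F of isNonArchLocalField R F & GRing.Field F & Uniform F }.

Section CubicForms.
Variable F : fieldType.

(* A cubic Jordan algebra in linear coordinates: norm, trace and identity. *)
Record cubicJordan := CubicJordan {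
  jdim : nat;
  jnorm : 'rV[F]_jdim -> F;
  jtrace : 'rV[F]_jdim -> F;
  jone : 'rV[F]_jdim }.

Definition jordan_mat3 : cubicJordan := {|
  jdim := (3 * 3)%N;
  jnorm := fun v => \det (vec_mx v : 'M[F]_3);
  jtrace := fun v => \tr (vec_mx v : 'M[F]_3);
  jone := mxvec (1%:M : 'M[F]_3) |}.

(* Alternating n x n matrices, with the entries above the diagonal as
   coordinates: entry (i, j), i < j, is coordinate 'C(j, 2) + i. *)
Definition alt_mx n (v : 'rV[F]_('C(n, 2))) : 'M[F]_n :=
  \matrix_(i, j)
    (\sum_(k < 'C(n, 2) | (i < j)%N && (k == 'C(j, 2) + i :> nat)%N) v 0 k
     - \sum_(k < 'C(n, 2) | (j < i)%N && (k == 'C(i, 2) + j :> nat)%N) v 0 k).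

Definition alt_coord n (A : 'M[F]_n) : 'rV[F]_('C(n, 2)) :=
  \row_k \sum_(i < n) \sum_(j < n | (i < j)%N && (k == 'C(j, 2) + i :> nat)%N)
    A i j.

(* Expansion of the Pfaffian along the first row. *)
Fixpoint pfaffian k : 'M[F]_(k.*2) -> F :=
  match k return 'M[F]_(k.*2) -> F with
  | 0 => fun=> 1
  | k'.+1 => fun A : 'M[F]_(k'.*2.+2) =>
      \sum_(j < k'.*2.+1) (-1) ^+ j * A ord0 (lift ord0 j) *
        pfaffian (row' j (col' j (row' ord0 (col' ord0 A))))
  end.

(* Identity of Asym: the block diagonal matrix with blocks (0, 1; -1, 0), of
   Pfaffian 1. *)
Definition symp k : 'M[F]_(k.*2) :=
  \matrix_(i, j) ((~~ odd i && (j == i.+1 :> nat))%:R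
                  - (~~ odd j && (i == j.+1 :> nat))%:R).

(* The linear term in t of pfaffian (symp + t A). *)
Definition alt_trace k (A : 'M[F]_(k.*2)) : F :=
  \sum_(i < k.*2) \sum_(j < k.*2 | ~~ odd i && (j == i.+1 :> nat)) A i j.

Definition jordan_F_asym4 : cubicJordan := {|
  jdim := (1 + 'C(4, 2))%N;
  jnorm := fun v : 'rV[F]_(1 + 'C(4, 2)) =>
    lsubmx v 0 0 * @pfaffian 2 (@alt_mx 4 (rsubmx v));
  jtrace := fun v : 'rV[F]_(1 + 'C(4, 2)) =>
    lsubmx v 0 0 + @alt_trace 2 (@alt_mx 4 (rsubmx v));
  jone := row_mx 1%:M (@alt_coord 4 (symp 2)) |}.

Definition jordan_asym6 : cubicJordan := {|
  jdim := 'C(6, 2);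
  jnorm := fun v => @pfaffian 3 (@alt_mx 6 v);
  jtrace := fun v => @alt_trace 3 (@alt_mx 6 v);
  jone := @alt_coord 6 (symp 3) |}.

(* Split octonions as Zorn vector matrices (a, u; v, b). *)
Record zorn := Zorn { za : F; zu : 'rV[F]_3; zv : 'rV[F]_3; zb : F }.

Definition dot3 (u v : 'rV[F]_3) : F := \sum_i u 0 i * v 0 i.

(* Indices are taken modulo 3. *)
Definition cross3 (u v : 'rV[F]_3) : 'rV[F]_3 :=
  \row_i (u 0 (i + 1) * v 0 (i + 2) - u 0 (i + 2) * v 0 (i + 1)).

Definition zorn_mul (x y : zorn) : zorn := {|
  za := za x * za y + dot3 (zu x) (zv y);
  zu := za x *: zu y + zb y *: zu x - cross3 (zv x) (zv y);
  zv := za y *: zv x + zb x *: zv y + cross3 (zu x) (zu y);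
  zb := zb x * zb y + dot3 (zv x) (zu y) |}.

Definition zorn_norm (x : zorn) : F := za x * zb x - dot3 (zu x) (zv x).

Definition zorn_trace (x : zorn) : F := za x + zb x.

Definition zorn_of_coord (x : 'rV[F]_((1 + 3) + (3 + 1))) : zorn := {|
  za := lsubmx (lsubmx x) 0 0;
  zu := rsubmx (lsubmx x);
  zv := lsubmx (rsubmx x);
  zb := rsubmx (rsubmx x) 0 0 |}.

(* The self-adjoint octonion matrix with diagonal (c 0, c 1, c 2) and entries
   x i in position (i + 1, i + 2), indices modulo 3. *)
Definition albert_norm (c : 'rV[F]_3) (x : 'I_3 -> zorn) : F :=
  \prod_i c 0 i - \sum_i c 0 i * zorn_norm (x i)
  + zorn_trace (zorn_mul (zorn_mul (x 0) (x 1)) (x 2)).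

Definition albert_diag (v : 'rV[F]_(3 + 3 * 8)) : 'rV[F]_3 := lsubmx v.

Definition albert_offdiag (v : 'rV[F]_(3 + 3 * 8)) (i : 'I_3) : zorn :=
  zorn_of_coord (row i (vec_mx (rsubmx v))).

Definition jordan_albert : cubicJordan := {|
  jdim := (3 + 3 * 8)%N;
  jnorm := fun v => albert_norm (albert_diag v) (albert_offdiag v);
  jtrace := fun v => \sum_i albert_diag v 0 i;
  jone := row_mx (const_mx 1) 0 |}.

Inductive split_cubicJordan : cubicJordan -> Prop :=
| SplitMat3 : split_cubicJordan jordan_mat3
| SplitFAsym4 : split_cubicJordan jordan_F_asym4
| SplitAsym6 : split_cubicJordan jordan_asym6
| SplitAlbert : split_cubicJordan jordan_albert.

End CubicForms.

(* T with its Borel sigma-algebra.  Measurable types are pointed, and T is not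
   canonically so; hence the point [t], which is otherwise irrelevant. *)
Definition borel (T : topologicalType) (t : T) : Type := T.

Section Borel.
Variables (T : topologicalType) (t : T).

HB.instance Definition _ := Choice.copy (borel t) T.
HB.instance Definition _ := isPointed.Build (borel t) t.

Lemma borelC (A : set T) : <<s @open T >> A -> <<s @open T >> (~` A).
Proof. by move=> sA; rewrite -setTD; exact: sigma_algebraCD. Qed.

HB.instance Definition _ := @isMeasurable.Build (sigma_display (@open T))
  (borel t) <<s @open T >> (@sigma_algebra0 _ setT open) borelC
  (@sigma_algebra_bigcup _ setT open).

End Borel.

Section LocalFieldAnalysis.
Variables (R : realType) (F : nonArchLocalFieldType R).

Local Notation C := R[i].
Local Notation "`| x |_F" := (@lfabs R F x) (format "`| x |_F").

Definition cintegral d (T : measurableType d) (mu : {measure set T -> \bar R})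
    (D : set T) (f : T -> C) : C :=
  Complex (\int[mu]_(x in D) complex.Re (f x))
          (\int[mu]_(x in D) complex.Im (f x)).

Definition locally_constant (T : topologicalType) (f : T -> C) :=
  forall x : T, \forall y \near x, f y = f x.

(* C_c^oo(T) for a totally disconnected locally compact T *)
Definition test_function (T : topologicalType) (f : T -> C) :=
  locally_constant f /\ compact (closure [set x : T | f x != 0]).

Definition units : set F := [set a : F | a != 0].

Definition integers : set F := [set x : F | `|x|_F <= 1].

Definition uniformizer (p : F) :=
  0 < `|p|_F < 1 /\ forall x : F, `|x|_F < 1 -> `|x|_F <= `|p|_F.

Definition additive_character (psi : F -> C) :=
  [/\ forall x y, psi (x + y) = psi x * psi y,
      forall x, `|psi x| = 1
    & continuous (psi : F -> C^o)].

Definition nontrivial_character (psi : F -> C) := exists x, psi x != 1.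

Definition unramified (p : F) (psi : F -> C) :=
  (forall x, integers x -> psi x = 1) /\
  (exists2 x, integers x & psi (p^-1 * x) != 1).

Definition haar_measure (mu : {measure set (borel (0 : F)) -> \bar R}) :=
  [/\ forall (a : F) (A : set (borel (0 : F))), measurable A ->
        mu [set a + x | x in A] = mu A,
      forall A : set F, compact A -> (mu A < +oo)%E
    & forall A : set F, open A -> A !=set0 -> (0 < mu A)%E].

Definition fourier (mu : {measure set (borel (0 : F)) -> \bar R}) (psi : F -> C)
    (f : F -> C) (y : F) : C :=
  cintegral mu setT (fun x : F => f x * psi (x * y)).

Definition self_dual (psi : F -> C) (mu : {measure set (borel (0 : F)) -> \bar R}) :=
  haar_measure mu /\
  forall f : F -> C, test_function f ->
    forall x, fourier mu psi (fourier mu psi f) x = f (- x).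

Definition product_measure_of n (mu : {measure set (borel (0 : F)) -> \bar R})
    (nu : {measure set (borel (0 : 'rV[F]_n)) -> \bar R}) :=
  forall B : 'I_n -> set (borel (0 : F)), (forall i, measurable (B i)) ->
    nu [set v : 'rV[F]_n | forall i, B i (v 0 i)] = (\prod_i mu (B i))%E.

Variables (psi : F -> C) (p : F).

Section OrbitalIntegral.
Variables (J : cubicJordan F)
  (dA : {measure set (borel (0 : 'rV[F]_(jdim J))) -> \bar R}).

Definition orbI (phi : F * 'rV[F]_(jdim J) -> C) (a : F) : C :=
  cintegral dA setT (fun A : 'rV[F]_(jdim J) =>
    phi (a, A) * psi ((jtrace A - jnorm A) / a)).

Definition orbIplus (phi : F * 'rV[F]_(jdim J) -> C) : C := phi (0, jone J).

Definition orbIminus (phi : F * 'rV[F]_(jdim J) -> C) : C := phi (0, - jone J).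

Definition Yintegers : set (F * 'rV[F]_(jdim J)) :=
  [set y : F * 'rV[F]_(jdim J) | integers y.1 /\ forall i, integers (y.2 0 i)].

End OrbitalIntegral.

Variable mu : {measure set (borel (0 : F)) -> \bar R}.

Definition kloosterman (D : set F) (a : F) : C :=
  cintegral mu D (fun x : F => psi ((x + x^-1) / a)).

(* c + p^m O *)
Definition congr_ball (c : F) (m : nat) : set F :=
  [set c + p ^+ m * y | y in integers].

(* The germ at 0 does not depend on m, but the neighborhood of 0 on which the
   equality holds does; so it is required for every admissible m. *)
Definition C_OI (cp cm : C) (f : units -> C) :=
  [/\ locally_constant f,
      exists B : R, forall a : units, f a != 0 -> `|\val a|_F <= B
    & forall m : nat, (0 < m)%N -> `|p ^+ m|_F < `|2|_F ->
        exists2 omega : set F, nbhs (0 : F) omega &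
          forall a : units, omega (\val a) ->
            f a = cp * kloosterman (congr_ball 1 m) (\val a)
                  + cm * kloosterman (congr_ball (-1) m) (\val a)].

End LocalFieldAnalysis.

Arguments units {R} F.
Arguments integers {R} F.
Arguments Yintegers {R F} J.

(* Main.v *)
Require Import Defs.
From HB Require Import structures.
From mathcomp Require Import all_boot all_order all_algebra.
From mathcomp Require Import all_classical all_reals all_analysis.
From mathcomp Require Import measurable_realfun complex ring zify.

Set Implicit Arguments.
Unset Strict Implicit.
Unset Printing Implicit Defensive.

Import Order.TTheory GRing.Theory Num.Theory.
Import numFieldNormedType.Exports.

Local Open Scope classical_set_scope.
Local Open Scope ring_scope.

(** Up to signs and a permutation of the coordinates, every one of the four
    algebras is the space of (x, y, u, v) in F x F^(2k) x F^l x F^l with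
    [tr - N = x (1 + u.v) - u.tau(y) - v.sigma(y)], where the quadratic maps
    sigma, tau satisfy [1 + sigma.tau + y1.y2 = 0] (y = (y1, y2)) and
    [sigma_0 - tau_0 + sigma.tau = 1]; the identity is (1, 0, sigma(0), tau(0)).
    By the second identity some coordinate of sigma(y) or tau(y) has absolute
    value at least 1, so for small |x| the phase has no critical point in (u, v)
    and the integral over (u, v) vanishes.  When |x| is bounded below, completing
    the square, [x (1 + u.v) - u.tau - v.sigma =
    x - sigma.tau/x + x (u - sigma/x).(v - tau/x)], and the first identity leave
    the phase [x + 1/x + y1.y2/x].  Two Gaussian integrations, over (u, v) and
    over y, produce |a/x|^l |a x|^k and localize at u = sigma(0)/x, v = tau(0)/x,
    y = 0.  The remaining integral over x has phase [(x + 1/x)/a], with critical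
    points 1 and -1, which correspond to the points I and -I of the algebra.
    For locally constant functions of compact support every integral is a finite
    sum over cosets of a small ball. *)

(** Both identities say that a norm is multiplicative. In the Albert case y is a pair of octonions
    x_1, x_2 with y1.y2 = N(x_1) + N(x_2); the leading coordinates of sigma and tau are 1 + N(x_2)
    and -(1 + N(x_1)), and the others pair to N(x_1 x_2) = N(x_1) N(x_2). So sigma.tau = -1 - y1.y2,
    and adding sigma_0 - tau_0 = 2 + y1.y2 gives the second identity. The residue characteristic may
    be 2, so no quadratic form is diagonalized. The forms u.v and y1.y2 are linear in each half of
    the variables, and integrals are shown to vanish by a translation that multiplies the integrand
    by a value of psi other than 1. The contributions of x = 1 and x = -1 are not evaluated:
    subtracting Kloosterman integrals over balls around these points leaves an amplitude supported
    where x + 1/x has no critical point, and the condition on |2| keeps the balls apart. The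
    conductor of psi is recorded by one element e, with psi trivial on e O but not on the next
    larger ball; self-duality gives |e| vol(O)^2 = 1, which makes the constants of the Gaussian
    integrals exact. *)

(** * The absolute value and the topology it defines *)

Section AbsoluteValue.
Variables (R : realType) (F : nonArchLocalFieldType R).
Local Notation "`| x |_F" := (@lfabs R F x) (format "`| x |_F").
Implicit Types (x y : F) (r : R).

Lemma lfabs0 : `|0|_F = 0.
Proof. exact/lfabs_eq0. Qed.

Lemma lfabs_neq0 x : (`|x|_F != 0) = (x != 0).
Proof.
by congr (~~ _); apply/eqP/eqP => /lfabs_eq0.
Qed.

Lemma lfabs_gt0 x : (0 < `|x|_F) = (x != 0).
Proof. by rewrite lt_neqAle lfabs_ge0 andbT eq_sym lfabs_neq0. Qed.

Lemma lfabs1 : `|1|_F = 1.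
Proof.
have := lfabsM (1 : F) 1; rewrite mulr1 => h.
by apply: (mulIf (x := `|1|_F)); rewrite ?lfabs_neq0 ?oner_eq0 // mul1r -h.
Qed.

Lemma lfabsN x : `|- x|_F = `|x|_F.
Proof.
rewrite -mulN1r lfabsM; suff -> : `|-1|_F = 1 by rewrite mul1r.
have := lfabsM (-1 : F) (-1); rewrite mulrNN mulr1 lfabs1 => /esym/eqP.
rewrite -expr2 sqrf_eq1 => /orP[/eqP//|/eqP h].
by have := lfabs_ge0 (-1 : F); rewrite h ler0N1.
Qed.

Lemma lfabsBC x y : `|x - y|_F = `|y - x|_F.
Proof. by rewrite -lfabsN opprB. Qed.

Lemma lfabsV x : `|x^-1|_F = `|x|_F^-1.
Proof.
have [->|x0] := eqVneq x 0; first by rewrite invr0 lfabs0 invr0.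
apply: (mulIf (x := `|x|_F)); first by rewrite lfabs_neq0.
by rewrite -lfabsM !mulVf ?lfabs_neq0 // lfabs1.
Qed.

Lemma lfabsX x n : `|x ^+ n|_F = `|x|_F ^+ n.
Proof. by elim: n => [|n ih]; rewrite ?expr0 ?lfabs1 // !exprS lfabsM ih. Qed.

Lemma lfabs_sign (b : bool) : `|(-1) ^+ b|_F = 1.
Proof. by case: b; rewrite ?expr1 ?lfabsN lfabs1. Qed.

Lemma lfabsD_le x y r : `|x|_F <= r -> `|y|_F <= r -> `|x + y|_F <= r.
Proof. by move=> hx hy; rewrite (le_trans (lfabs_ultra _ _)) // ge_max hx. Qed.

Lemma lfabsB_le x y r : `|x|_F <= r -> `|y|_F <= r -> `|x - y|_F <= r.
Proof. by move=> hx hy; apply: lfabsD_le; rewrite ?lfabsN. Qed.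

Lemma lfabsD_lt x y r : `|x|_F < r -> `|y|_F < r -> `|x + y|_F < r.
Proof. by move=> hx hy; rewrite (le_lt_trans (lfabs_ultra _ _)) // gt_max hx. Qed.

Lemma lfabs_sum_le (I : Type) (s : seq I) (P : pred I) (f : I -> F) r :
  0 <= r -> (forall i, P i -> `|f i|_F <= r) -> `|\sum_(i <- s | P i) f i|_F <= r.
Proof.
move=> r0 h; elim/big_rec: _ => [|i x Pi hx]; first by rewrite lfabs0.
by apply: lfabsD_le => //; exact: h.
Qed.

Lemma lfabs_sum_lt (I : Type) (s : seq I) (P : pred I) (f : I -> F) r :
  0 < r -> (forall i, P i -> `|f i|_F < r) -> `|\sum_(i <- s | P i) f i|_F < r.
Proof.
move=> r0 h; elim/big_rec: _ => [|i x Pi hx]; first by rewrite lfabs0.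
by apply: lfabsD_lt => //; exact: h.
Qed.

Lemma lfabs_add_eq x y : `|y|_F < `|x|_F -> `|x + y|_F = `|x|_F.
Proof.
move=> yx; apply/eqP; rewrite eq_le (lfabsD_le (lexx _) (ltW yx)) /=.
rewrite leNgt; apply/negP => h.
by have := lfabsD_lt h (eq_ind_r (fun z => z < _) yx (lfabsN y)); rewrite addrK ltxx.
Qed.

Lemma nbhs_lfabsP x (A : set F) :
  nbhs x A <-> exists2 e : R, 0 < e & forall y, `|y - x|_F < e -> A y.
Proof.
rewrite -nbhs_entourageE; split.
  move=> [E /lfentourage[e e0 he] EA]; exists e => // y yx; apply: EA.
  by apply/xsectionP; apply: he; rewrite lfabsBC.
move=> [e e0 he]; exists [set z : F * F | `|z.1 - z.2|_F < e].
  by apply/lfentourage; exists e.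
by move=> y /xsectionP /= h; apply: he; rewrite lfabsBC.
Qed.

Lemma nbhs_lfabs_rV n (v : 'rV[F]_n) (A : set 'rV[F]_n) :
  nbhs v A <->
  exists2 e : R, 0 < e & forall w : 'rV[F]_n, (forall i, `|w 0 i - v 0 i|_F < e) -> A w.
Proof.
split=> [[P hP PA]|[e e0 he]].
  have /choice[e he] : forall i : 'I_n, exists e : R,
      0 < e /\ forall y, `|y - v 0 i|_F < e -> P 0 i y.
    by move=> i; have /nbhs_lfabsP[e e0 he] := hP 0 i; exists e.
  exists (\big[Order.min/1]_i e i).
    by apply: lt_bigmin => // i _; have [] := he i.
  move=> w hw; apply: PA => i j; rewrite (ord1 i); apply: (he j).2.
  by apply: lt_le_trans (hw j) _; exact: bigmin_le_cond.
exists (fun i j => [set y | `|y - v i j|_F < e]).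
  by move=> i j; apply/nbhs_lfabsP; exists e.
by move=> w hw; apply: he => i; exact: hw.
Qed.

Lemma open_lfabs_ball c r : 0 < r -> open [set x : F | `|x - c|_F <= r].
Proof.
move=> r0; rewrite openE => x /= hx; apply/nbhs_lfabsP; exists r => // y /= hy.
by rewrite -(subrK x y) -addrA lfabsD_le // ltW.
Qed.

Lemma closed_lfabs_ball c r : 0 < r -> closed [set x : F | `|x - c|_F <= r].
Proof.
move=> r0 x hx /=.
have /hx[y [/= hy yx]] : nbhs x [set y | `|y - x|_F < r].
  by apply/nbhs_lfabsP; exists r.
by rewrite -(subrK y x) -addrA lfabsD_le // lfabsBC ltW.
Qed.

End AbsoluteValue.

(** * Discreteness, residue systems and compactness of balls *)

Section Uniformizer.
Variables (R : realType) (F : nonArchLocalFieldType R) (p : F).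
Hypothesis punif : uniformizer p.
Local Notation "`| x |_F" := (@lfabs R F x) (format "`| x |_F").
Local Notation pi := (`|p|_F).
Implicit Types (x y : F) (r : R).

Lemma unif_gt0 : 0 < pi. Proof. by case: punif => /andP[]. Qed.
Lemma unif_lt1 : pi < 1. Proof. by case: punif => /andP[]. Qed.
Lemma unif_neq0 : p != 0. Proof. by rewrite -lfabs_gt0 unif_gt0. Qed.
Local Hint Resolve unif_gt0 unif_lt1 unif_neq0 : core.

Lemma unifX_gt0 n : 0 < pi ^+ n. Proof. exact: exprn_gt0. Qed.
Lemma unifX_ge0 n : 0 <= pi ^+ n. Proof. exact/ltW/unifX_gt0. Qed.
Lemma unifVX_gt0 n : 0 < pi ^- n. Proof. by rewrite invr_gt0 unifX_gt0. Qed.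
Lemma unifVX_ge1 n : 1 <= pi ^- n.
Proof. by rewrite invf_ge1 ?unifX_gt0// exprn_ile1 // ltW. Qed.

Lemma unifX_le i j : (i <= j)%N -> pi ^+ j <= pi ^+ i.
Proof. by move=> ij; apply: ler_wiXn2l => //; exact: ltW. Qed.

Lemma unifVX_le i j : (i <= j)%N -> pi ^- i <= pi ^- j.
Proof. by move=> ij; rewrite lef_pV2 ?posrE ?unifX_gt0 // unifX_le. Qed.

Lemma unifX_small e : 0 < e -> exists n, pi ^+ n < e.
Proof.
move=> e0; have := @cvg_expr R pi; rewrite ger0_norm ?lfabs_ge0 // => /(_ unif_lt1).
move=> /cvgrPdist_lt /(_ _ e0)[N _ /(_ N (leqnn N))].
by rewrite sub0r normrN normrX ger0_norm ?lfabs_ge0 // => h; exists N.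
Qed.

Lemma unifVX_large r : exists n, r <= pi ^- n.
Proof.
have [r0|r0] := leP r 0; first by exists 0%N; rewrite expr0 invr1 (le_trans r0).
have [n hn] := @unifX_small r^-1 (eq_ind_r is_true r0 (invr_gt0 r)); exists n.
by rewrite -(invrK r) lef_pV2 ?posrE ?unifX_gt0 ?invr_gt0 // ltW.
Qed.

(** The value group is discrete: x / y lies in the maximal ideal, which p generates. Strict
    inequalities thus gain a factor pi. *)
Lemma lfabs_gap x y : `|x|_F < `|y|_F -> `|x|_F <= pi * `|y|_F.
Proof.
move=> h; have y0 : 0 < `|y|_F by apply: le_lt_trans h; exact: lfabs_ge0.
rewrite -ler_pdivrMr // -lfabsV -lfabsM; apply: punif.2.
by rewrite lfabsM lfabsV ltr_pdivrMr // mul1r.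
Qed.

(* The least n with |x| > pi^(n+1) satisfies |x| = pi^n. *)
Lemma lfabs_le1_expn x : x != 0 -> `|x|_F <= 1 -> exists n, `|x|_F = pi ^+ n.
Proof.
rewrite -lfabs_gt0 => x0 x1.
have ex : exists n, pi ^+ n.+1 < `|x|_F.
  have [n hn] := unifX_small x0; exists n; apply: le_lt_trans hn.
  by apply: unifX_le; exact: leqW.
case: (ex_minnP ex) => n hn hmin; exists n; apply/eqP; rewrite eq_le.
apply/andP; split.
  case: n hn hmin => [|n] hn hmin; first by rewrite expr0.
  by rewrite leNgt; apply/negP => /hmin; rewrite ltnn.
rewrite leNgt; apply/negP; rewrite -lfabsX => /lfabs_gap.
by rewrite lfabsX -exprS leNgt hn.
Qed.

Lemma uniformizer_eq_residue : exists s : seq F,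
  [/\ pi = (size s)%:R^-1,
      {in s, forall x, `|x|_F <= 1} &
      forall z, `|z|_F <= 1 -> count (fun c => `|c - z|_F < 1) s = 1%N].
Proof.
have [p' [s [/andP[p'0 p'1] p'max p's [us s1 sinj scov]]]] := @lfabs_residue R F.
have e : pi = `|p'|_F.
  by apply/eqP; rewrite eq_le p'max // punif.2.
exists s; split=> //; first by rewrite e.
move=> z z1; have [y ys yz] := scov z z1.
rewrite (@eq_in_count _ _ (pred1 y)); first by rewrite count_uniq_mem // ys.
move=> c cs /=; apply/idP/eqP => [cz|->]; last by rewrite lfabsBC.
by apply: sinj => //; rewrite -(subrK z c) -addrA lfabsD_lt.
Qed.

(** Representatives of O modulo p^k, built digit by digit as c + p d: the residue class of z fixes
    c, and (z - c) / p then fixes d at the previous level. *)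
Lemma residue_net k : exists s : seq F,
  [/\ pi ^+ k = (size s)%:R^-1,
      {in s, forall x, `|x|_F <= 1} &
      forall z, `|z|_F <= 1 -> count (fun c => `|c - z|_F <= pi ^+ k) s = 1%N].
Proof.
have [s0 [s0size s01 s0c]] := uniformizer_eq_residue.
elim: k => [|k [s [ssize s1 sc]]].
  exists [:: 0]; split=> [|x|z z1]; first by rewrite expr0 /= invr1.
    by rewrite inE => /eqP ->; rewrite lfabs0.
  by rewrite /= sub0r lfabsN expr0 z1.
exists [seq c + p * d | c <- s0, d <- s]; split.
- by rewrite size_allpairs natrM invfM -s0size -ssize exprS.
- move=> x /allpairsP[[c d] /= [cs ds ->]]; apply: lfabsD_le; first exact: s01.
  by rewrite lfabsM mulr_ile1 ?lfabs_ge0 //; [exact: ltW|exact: s1].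
move=> z z1; rewrite -sum1_count big_mkcond big_allpairs_dep /=.
transitivity (\sum_(c <- s0 | (`|c - z|_F < 1)%R) 1)%N; last by rewrite sum1_count s0c.
rewrite [RHS]big_mkcond /= big_seq [RHS]big_seq; apply: eq_bigr => c cs.
rewrite -big_mkcond /=; case: ifPn => hcz.
  rewrite sum1_count -(sc ((z - c) / p)).
    apply: eq_count => d; rewrite -[RHS](@ler_pM2l _ pi) // -exprS -lfabsM.
    rewrite mulrBr mulrCA divff // mulr1; congr (lfabs _ <= _); ring.
  rewrite lfabsM lfabsV ler_pdivrMr // mul1r lfabsBC.
  by apply: punif.2.
rewrite big_seq_cond big1 // => d /andP[ds].
have hc : `|p * d|_F < 1.
  rewrite lfabsM; apply: le_lt_trans unif_lt1.
  by rewrite ler_piMr ?lfabs_ge0 //; exact: s1.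
move=> hle; exfalso; move/negP: hcz; apply.
rewrite (_ : c - z = (c + p * d - z) - p * d); last by ring.
rewrite lfabsD_lt ?lfabsN // (le_lt_trans hle) //.
by rewrite exprn_ilt1 // ltW.
Qed.

(** Representatives of O modulo p^(2j), rescaled by p^-j, represent p^-j O modulo p^j O. One index
    serves for both radii because each condition weakens as j grows. *)
Lemma field_net j : exists s : seq F,
  [/\ pi ^+ (j + j) = (size s)%:R^-1,
      {in s, forall x, `|x|_F <= pi ^- j} &
      forall z, `|z|_F <= pi ^- j ->
        count (fun c => `|c - z|_F <= pi ^+ j) s = 1%N].
Proof.
have [s [ss s1 sc]] := residue_net (j + j); exists [seq p ^- j * c | c <- s].
have pj : 0 < pi ^+ j by exact: unifX_gt0.
split.
- by rewrite size_map.
- move=> _ /mapP[c cs ->]; rewrite lfabsM lfabsV lfabsX ler_piMr ?s1 //.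
  by rewrite ltW // invr_gt0.
move=> z hz; rewrite count_map -(sc (p ^+ j * z)).
  apply: eq_count => c /=; rewrite exprD -[RHS](@ler_pM2l _ (pi ^- j)).
    rewrite mulrA mulVf ?gt_eqF // mul1r -lfabsX -lfabsV -lfabsM.
    by rewrite mulrBr mulrA mulVf ?mul1r // expf_neq0.
  by rewrite invr_gt0.
by rewrite lfabsM lfabsX -ler_pdivlMl // mulr1.
Qed.

(** Total boundedness and completeness: for every radius an ultrafilter on the ball contains one of
    the finitely many small balls that cover it, hence is Cauchy. *)
Lemma compact_lfabs_ball j : compact [set x : F | `|x|_F <= pi ^- j].
Proof.
rewrite compact_ultra => U UU UB.
have PU : ProperFilter U by exact: ultra_proper.
suff [l hl] : exists l : F, U --> l.
  exists l; split => //; have := @closed_lfabs_ball R F 0 _ (unifVX_gt0 j).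
  have -> : [set x : F | `|x - 0|_F <= pi ^- j] = [set x : F | `|x|_F <= pi ^- j].
    by apply/funext => x; rewrite /= subr0.
  move=> /(_ l); apply => A /hl UA; near U => x; exists x; split; near: x => //.
apply: lfcomplete => // E /lfentourage[e e0 he].
have [k hk] := unifX_small e0.
have [s [_ _ sc]] := residue_net (j + k).
have cover : [set x : F | `|x|_F <= pi ^- j] `<=`
    \bigcup_(c in [set` s]) [set x | `|p ^- j * c - x|_F <= pi ^+ k].
  move=> x /= hx; have h1 : `|p ^+ j * x|_F <= 1.
    by rewrite lfabsM lfabsX -ler_pdivlMl ?unifX_gt0 // mulr1.
  have : has (fun c => `|c - p ^+ j * x|_F <= pi ^+ (j + k)) s.
    by rewrite has_count sc.
  move=> /hasP[c cs hc]; exists c => //=.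
  rewrite -(@ler_pM2l _ (pi ^+ j)) ?unifX_gt0 // -exprD -lfabsX -lfabsM.
  by rewrite mulrBr mulrA divff ?mul1r // expf_neq0.
have [c cs Uc] : exists2 c, c \in s & U [set x | `|p ^- j * c - x|_F <= pi ^+ k].
  apply: contrapT => hn; suff : U set0 by exact: filter_not_empty.
  have hall : forall c, c \in s -> U (~` [set x | `|p ^- j * c - x|_F <= pi ^+ k]).
    move=> c cs; have [h|//] := in_ultra_setVsetC [set x | `|p ^- j * c - x|_F <= pi ^+ k] UU.
    by exfalso; apply: hn; exists c.
  have h : U [set x | all (fun c => ~~ (`|p ^- j * c - x|_F <= pi ^+ k)) s].
    elim: (s) hall => [|c t ih] hall; first by apply: filterS filterT.
    have h1 := hall c (mem_head _ _).
    have h2 := ih (fun c' hc' => hall c' (@mem_behead _ (c :: t) c' hc')).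
    by apply: filterS (filterI h1 h2) => x [/= /negP -> ->].
  near U => x.
  have /cover[c cs hc] : [set x : F | `|x|_F <= pi ^- j] x by near: x.
  have /allP/(_ c cs) : all (fun c => ~~ (`|p ^- j * c - x|_F <= pi ^+ k)) s by near: x.
  by rewrite hc.
exists ([set x | `|p ^- j * c - x|_F <= pi ^+ k], [set x | `|p ^- j * c - x|_F <= pi ^+ k]) => //.
move=> [x y] [/= hx hy]; apply: he; apply: le_lt_trans hk.
by rewrite -(subrK (p ^- j * c) x) -addrA lfabsD_le // lfabsBC.
Unshelve. all: by end_near. Qed.

End Uniformizer.

(** * Coset representatives and Schwartz functions in several variables *)

Section Nets.
Variables (R : realType) (F : nonArchLocalFieldType R) (p : F).
Hypothesis punif : uniformizer p.
Local Notation "`| x |_F" := (@lfabs R F x) (format "`| x |_F").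
Local Notation pi := (`|p|_F).
Local Notation C := R[i].

(** The ball of radius r for the sup norm, boolean so that it can serve as a cutoff in
    integrands. *)
Definition vle m (r : R) (v : 'rV[F]_m) : bool := [forall i, `|v 0 i|_F <= r].

Lemma vleP m r (v : 'rV[F]_m) : reflect (forall i, `|v 0 i|_F <= r) (vle r v).
Proof. exact: forallP. Qed.

Lemma vle0 m r : 0 <= r -> vle r (0 : 'rV[F]_m).
Proof. by move=> r0; apply/vleP => i; rewrite mxE lfabs0. Qed.

Lemma vleD m r (v w : 'rV[F]_m) : vle r v -> vle r w -> vle r (v + w).
Proof. by move=> /vleP hv /vleP hw; apply/vleP => i; rewrite mxE lfabsD_le. Qed.

Lemma vleN m r (v : 'rV[F]_m) : vle r (- v) = vle r v.
Proof. by apply: eq_forallb => i; rewrite mxE lfabsN. Qed.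

Lemma vleB m r (v w : 'rV[F]_m) : vle r v -> vle r w -> vle r (v - w).
Proof. by move=> hv hw; apply: vleD; rewrite ?vleN. Qed.

Lemma vleBC m r (v w : 'rV[F]_m) : vle r (v - w) = vle r (w - v).
Proof. by rewrite -vleN opprB. Qed.

Lemma vle_addr m r (v w : 'rV[F]_m) : vle r w -> vle r (v + w) = vle r v.
Proof.
by move=> hw; apply/idP/idP => h; [rewrite -(addrK w v) vleB | rewrite vleD].
Qed.

Lemma vle_trans m r s (v : 'rV[F]_m) : r <= s -> vle r v -> vle s v.
Proof. by move=> rs /vleP h; apply/vleP => i; exact: le_trans (h i) rs. Qed.

Lemma vleZ m r a (v : 'rV[F]_m) : vle r v -> vle (`|a|_F * r) (a *: v).
Proof.
by move=> /vleP h; apply/vleP => i; rewrite mxE lfabsM ler_wpM2l ?lfabs_ge0.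
Qed.

Lemma vle_row_mx m n r (u : 'rV[F]_m) (v : 'rV[F]_n) :
  vle r (row_mx u v) = vle r u && vle r v.
Proof.
apply/vleP/andP => [h|[/vleP hu /vleP hv] i].
  by split; apply/vleP => i; [have := h (lshift _ i)|have := h (rshift _ i)];
    rewrite ?row_mxEl ?row_mxEr.
by rewrite mxE; case: fintype.splitP.
Qed.

Lemma vle_const1 r x : vle r (const_mx x : 'rV[F]_1) = (`|x|_F <= r).
Proof. by apply/vleP/idP => [/(_ 0)|h i]; rewrite mxE. Qed.

Lemma vle_ord0 r (v : 'rV[F]_0) : vle r v.
Proof. by apply/vleP => -[]. Qed.

Lemma vleE1 r (v : 'rV[F]_1) : vle r v = (`|v 0 0|_F <= r).
Proof. by apply/vleP/idP => [/(_ 0)|h i]; rewrite ?(ord1 i). Qed.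

(** A system of representatives of p^-j O^m modulo p^j O^m. *)
Definition is_net m j (X : seq 'rV[F]_m) :=
  {in X, forall c, vle (pi ^- j) c} /\
  forall z, vle (pi ^- j) z -> count (fun c => vle (pi ^+ j) (c - z)) X = 1%N.

Definition scaleinv m (j : nat) (f : 'rV[F]_m -> C) :=
  forall x t, vle (pi ^+ j) t -> f (x + t) = f x.

(** Schwartz-Bruhat functions of level j, that is, functions on the finite group p^-j O^m / p^j
    O^m. *)
Definition sch m (j : nat) (f : 'rV[F]_m -> C) :=
  (forall x, f x != 0 -> vle (pi ^- j) x) /\ scaleinv j f.

Lemma scaleinv_eq m j (f : 'rV[F]_m -> C) x y :
  scaleinv j f -> vle (pi ^+ j) (y - x) -> f y = f x.
Proof. by move=> hf h; rewrite -(hf x (y - x)) // addrC subrK. Qed.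

Lemma sum_count_mul (T : Type) (P : pred T) (X : seq T) (c : C) :
  \sum_(d <- X) (if P d then c else 0) = c *+ count P X.
Proof. by rewrite -big_mkcond big_const_seq iter_addr_0. Qed.

(* Double counting of the pairs (d, c) with d close to T c. *)
Lemma net_change m m' j (f : 'rV[F]_m -> C) (X : seq 'rV[F]_m)
    (Y : seq 'rV[F]_m') (T : 'rV[F]_m' -> 'rV[F]_m) :
  is_net j X -> scaleinv j f ->
  {in Y, forall c, vle (pi ^- j) (T c)} ->
  (forall d, vle (pi ^- j) d -> count (fun c => vle (pi ^+ j) (d - T c)) Y = 1%N) ->
  \sum_(c <- Y) f (T c) = \sum_(d <- X) f d.
Proof.
move=> [X1 X2] hf hT hY.
transitivity (\sum_(c <- Y) \sum_(d <- X)
    (if vle (pi ^+ j) (d - T c) then f d else 0)).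
  rewrite big_seq [RHS]big_seq; apply: eq_bigr => c cY.
  have -> : f (T c) = f (T c) *+ count (fun d => vle (pi ^+ j) (d - T c)) X.
    by rewrite X2 ?mulr1n //; exact: hT.
  rewrite -sum_count_mul; apply: eq_bigr => d _; case: ifPn => // h.
  exact: esym (scaleinv_eq hf h).
rewrite exchange_big /= big_seq [RHS]big_seq; apply: eq_bigr => d dX.
by rewrite sum_count_mul hY ?mulr1n //; exact: X1.
Qed.

Lemma net_eq m j (f : 'rV[F]_m -> C) (X Y : seq 'rV[F]_m) :
  is_net j X -> is_net j Y -> scaleinv j f ->
  \sum_(c <- Y) f c = \sum_(d <- X) f d.
Proof.
move=> hX [Y1 Y2] hf; apply: (net_change (T := id) hX hf) => // d hd.
by apply: etrans (Y2 d hd); apply: eq_count => c; rewrite vleBC.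
Qed.

Lemma net_shift m j (f : 'rV[F]_m -> C) (X : seq 'rV[F]_m) t :
  is_net j X -> scaleinv j f -> vle (pi ^- j) t ->
  \sum_(c <- X) f (c + t) = \sum_(d <- X) f d.
Proof.
move=> hX hf ht; apply: (net_change (T := fun c => c + t) hX hf) => // [c cX|d hd].
  by rewrite vleD //; exact: hX.1.
apply: etrans (hX.2 (d - t) _); last by rewrite vleB.
by apply: eq_count => c; rewrite vleBC opprB addrA.
Qed.

Lemma net_row_mx m n j (X : seq 'rV[F]_m) (Y : seq 'rV[F]_n) :
  is_net j X -> is_net j Y -> is_net j [seq row_mx u v | u <- X, v <- Y].
Proof.
move=> [X1 X2] [Y1 Y2]; split=> [_ /allpairsP[[u v] /= [uX vY ->]]|z].
  by rewrite vle_row_mx X1 ?Y1.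
rewrite -(hsubmxK z) vle_row_mx => /andP[hu hv].
rewrite -sum1_count big_mkcond big_allpairs_dep /=; apply: etrans (X2 _ hu).
rewrite -sum1_count [RHS]big_mkcond; apply: eq_bigr => u _; rewrite -big_mkcond /=.
case: ifPn => h.
  rewrite sum1_count; apply: etrans (Y2 _ hv); apply: eq_count => v.
  by rewrite opp_row_mx add_row_mx vle_row_mx h.
by rewrite big1 // => v; rewrite opp_row_mx add_row_mx vle_row_mx (negPf h).
Qed.

Definition fnet_spec j (s : seq F) :=
  [/\ pi ^+ (j + j) = (size s)%:R^-1,
      {in s, forall x, `|x|_F <= pi ^- j} &
      forall z, `|z|_F <= pi ^- j ->
        count (fun c => `|c - z|_F <= pi ^+ j) s = 1%N].

Definition fnet j : seq F := xget [::] [set s | fnet_spec j s].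

Lemma fnetP j : fnet_spec j (fnet j).
Proof. exact: (@xgetPex _ [::] [set s | fnet_spec j s] (field_net punif j)). Qed.

Fixpoint net m j : seq 'rV[F]_m :=
  match m return seq 'rV[F]_m with
  | 0%N => [:: 0]
  | m'.+1 => [seq row_mx u v | u <- [seq (const_mx x : 'rV[F]_1) | x <- fnet j], v <- net m' j]
               : seq 'rV[F]_(1 + m')
  end.

Lemma net1_is_net j : is_net j [seq (const_mx x : 'rV[F]_1) | x <- fnet j].
Proof.
have [_ h1 h2] := fnetP j; split=> [_ /mapP[x xs ->]|z].
  by rewrite vle_const1; exact: h1.
rewrite vleE1 => hz; rewrite count_map; apply: etrans (h2 _ hz); apply: eq_count => c /=.
by rewrite vleE1 !mxE.
Qed.

Lemma netP m j : is_net j (net m j).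
Proof.
elim: m => [|m ih]; last exact: net_row_mx (net1_is_net j) ih.
split=> [c _|z _]; first exact: vle_ord0.
by rewrite /= vle_ord0.
Qed.

Lemma sch_leq m i j (f : 'rV[F]_m -> C) : (i <= j)%N -> sch i f -> sch j f.
Proof.
move=> ij [h1 h2]; split=> [x /h1|x t ht].
  by apply: vle_trans; exact: unifVX_le.
by apply: h2; apply: vle_trans ht; exact: unifX_le.
Qed.

Lemma sch_shift m j (f : 'rV[F]_m -> C) t : vle (pi ^- j) t ->
  sch j f -> sch j (fun x => f (x + t)).
Proof.
move=> ht [h1 h2]; split=> [x /h1|x t' ht']; first by rewrite vle_addr.
by have := h2 (x + t) t' ht'; rewrite addrAC.
Qed.

Lemma sch_slicer m n j (f : 'rV[F]_(m + n) -> C) u :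
  sch j f -> sch j (fun v => f (row_mx u v)).
Proof.
move=> [h1 h2]; split=> [v /h1|v t ht]; first by rewrite vle_row_mx => /andP[].
rewrite -(h2 (row_mx u v) (row_mx 0 t)) ?add_row_mx ?addr0 //.
by rewrite vle_row_mx vle0 // unifX_ge0.
Qed.

Lemma sch_slicel m n j (f : 'rV[F]_(m + n) -> C) v :
  sch j f -> sch j (fun u => f (row_mx u v)).
Proof.
move=> [h1 h2]; split=> [u /h1|u t ht]; first by rewrite vle_row_mx => /andP[].
rewrite -(h2 (row_mx u v) (row_mx t 0)) ?add_row_mx ?addr0 //.
by rewrite vle_row_mx vle0 ?ht // unifX_ge0.
Qed.

Definition schwartz m (f : 'rV[F]_m -> C) := exists j, sch j f.

Lemma sch2 m n (f : 'rV[F]_m -> C) (g : 'rV[F]_n -> C) :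
  schwartz f -> schwartz g -> exists j, sch j f /\ sch j g.
Proof.
move=> [i hf] [j hg]; exists (maxn i j).
by split; [apply: sch_leq hf|apply: sch_leq hg]; rewrite ?leq_maxl ?leq_maxr.
Qed.

Lemma vle_ex m (v : 'rV[F]_m) : exists j, vle (pi ^- j) v.
Proof.
have [j hj] := unifVX_large punif (\big[Order.max/0]_i `|v 0 i|_F).
exists j; apply/vleP => i; apply: le_trans hj; exact: le_bigmax_cond.
Qed.

End Nets.

(** * Integrals of step functions *)

Section StepFunctions.
Variable R : realType.
Local Notation C := R[i].

Lemma Rintegral_step d (T : measurableType d) (mu : {measure set T -> \bar R})
    (I : Type) (X : seq I) (B : I -> T -> bool) (v : I -> R) (m : R) :
  (forall i, measurable [set x | B i x]) ->
  (forall i, mu [set x | B i x] = m%:E) ->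
  (\int[mu]_x (\sum_(i <- X) v i * (B i x)%:R))%R = m * \sum_(i <- X) v i.
Proof.
move=> mB muB; rewrite /Rintegral.
have hB i x : (B i x)%:R = \1_[set x | B i x] x :> R.
  by rewrite indicE; congr (_%:R); congr nat_of_bool; apply/idP/idP; rewrite inE.
have intB i : mu.-integrable setT (fun x => (\1_[set x | B i x] x)%:E).
  apply/integrableP; split.
    by apply/measurable_EFinP; exact: measurable_indic.
  under eq_integral do rewrite gee0_abs ?lee_fin //.
  by rewrite integral_indic // setIT muB ltry.
under eq_integral => x _.
  rewrite -sumEFin; under eq_bigr do rewrite EFinM hB.
  over.
rewrite integral_sum //=; last by move=> i; exact: integrableZl.
under eq_bigr => i _ do rewrite integralZl // integral_indic // setIT muB -EFinM.
by rewrite sumEFin /= mulr_sumr; apply: eq_bigr => i _; rewrite mulrC.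
Qed.

Lemma cintegral_step d (T : measurableType d) (mu : {measure set T -> \bar R})
    (I : Type) (X : seq I) (B : I -> T -> bool) (v : I -> C) (m : R) (f : T -> C) :
  (forall i, measurable [set x | B i x]) ->
  (forall i, mu [set x | B i x] = m%:E) ->
  (forall x, f x = \sum_(i <- X) (if B i x then v i else 0)) ->
  cintegral mu setT f = m%:C%C * \sum_(i <- X) v i.
Proof.
move=> mB muB hf; rewrite /cintegral.
have hRe x : complex.Re (f x) = \sum_(i <- X) complex.Re (v i) * (B i x)%:R.
  rewrite hf raddf_sum; apply: eq_bigr => i _.
  by case: (B i x); rewrite ?mulr1 ?mulr0.
have hIm x : complex.Im (f x) = \sum_(i <- X) complex.Im (v i) * (B i x)%:R.
  rewrite hf raddf_sum; apply: eq_bigr => i _.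
  by case: (B i x); rewrite ?mulr1 ?mulr0.
under eq_Rintegral do rewrite hRe.
under [X in Complex _ X]eq_Rintegral do rewrite hIm.
rewrite !(Rintegral_step _ _ mB muB) -!raddf_sum.
by case: (\sum_(i <- X) v i) => a b /=; rewrite /GRing.mul /= !mul0r subr0 addr0.
Qed.

Lemma cintegral_mkcond d (T : measurableType d) (mu : {measure set T -> \bar R})
    (D : set T) (B : T -> bool) (f : T -> C) :
  (forall x, D x <-> B x) ->
  cintegral mu D f = cintegral mu setT (fun x => if B x then f x else 0).
Proof.
move=> hD; rewrite /cintegral.
rewrite Rintegral_mkcond [X in Complex _ X]Rintegral_mkcond.
have e x : (x \in D) = B x.
  by apply/idP/idP => [|h]; [rewrite inE => /hD|rewrite inE; exact/hD].
congr Complex; apply: eq_Rintegral => x _; rewrite patchE e; by case: (B x).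
Qed.

End StepFunctions.

(** * Haar measure of balls, and integration as a finite sum *)

Section Schwartz.
Variables (R : realType) (F : nonArchLocalFieldType R) (p : F).
Hypothesis punif : uniformizer p.
Variable dx : {measure set (borel (0 : F)) -> \bar R}.
Hypothesis dx_haar : haar_measure dx.
Local Notation "`| x |_F" := (@lfabs R F x) (format "`| x |_F").
Local Notation pi := (`|p|_F).
Local Notation C := R[i].
Local Notation sch := (@sch R F p _).
Local Notation schwartz := (@schwartz R F p _).
Local Notation net m j := (@net R F p m j).

Lemma measurable_ball (c : F) r : 0 < r ->
  measurable ([set x : F | `|x - c|_F <= r] : set (borel (0 : F))).
Proof. by move=> r0; apply: sub_sigma_algebra; exact: open_lfabs_ball. Qed.

Definition vol (r : R) : R := fine (dx [set x : F | `|x|_F <= r]).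

Lemma measure_ball0 r : 0 < r -> dx [set x : F | `|x|_F <= r] = (vol r)%:E.
Proof.
move=> r0; rewrite /vol fineK // ge0_fin_numE //.
have [j hj] := unifVX_large punif r.
have [_ hc _] := dx_haar.
have mb s : 0 < s -> measurable ([set x : F | `|x|_F <= s] : set (borel (0 : F))).
  by move=> s0; have := measurable_ball 0 s0; under eq_set do rewrite subr0.
apply: le_lt_trans (_ : (_ <= dx [set x : F | (`|x|_F <= pi ^- j)%R])%E) _; last first.
  exact: hc _ (@compact_lfabs_ball _ _ _ punif j).
apply: le_measure; rewrite ?inE; try exact: mb.
  by apply: mb; exact: unifVX_gt0.
by move=> x /= h; exact: le_trans hj.
Qed.

Lemma measure_ball c r : 0 < r -> dx [set x : F | `|x - c|_F <= r] = (vol r)%:E.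
Proof.
move=> r0; rewrite -measure_ball0 //; have [h _ _] := dx_haar.
have mb : measurable ([set x : F | `|x|_F <= r] : set (borel (0 : F))).
  by have := measurable_ball 0 r0; under eq_set do rewrite subr0.
rewrite -(h c _ mb); congr (dx _); apply/seteqP; split=> x /=.
  by move=> hx; exists (x - c) => //; rewrite addrC subrK.
by move=> [y hy <-]; rewrite addrC addKr.
Qed.

Lemma vol_gt0 r : 0 < r -> 0 < vol r.
Proof.
move=> r0; rewrite -lte_fin -measure_ball0 //; have [_ _ h] := dx_haar; apply: h.
  by have := @open_lfabs_ball R F 0 _ r0; under eq_set do rewrite subr0.
by exists 0; rewrite /= lfabs0 ltW.
Qed.

(** The ball of radius |d| is the disjoint union of q = 1 / pi translates of the ball of radius pi
    |d|. Integrating its indicator in both ways compares the volumes. *)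
Lemma vol_unif d : d != 0 -> vol (pi * `|d|_F) = pi * vol `|d|_F.
Proof.
move=> d0; have [s [ss s1 sc]] := residue_net punif 1.
have d0' : 0 < `|d|_F by rewrite lfabs_gt0.
have pd0 : 0 < pi * `|d|_F by rewrite mulr_gt0 // unif_gt0.
have hm (c : F) : measurable ([set x | `|x - c * d|_F <= pi * `|d|_F] : set (borel (0 : F))).
  exact: measurable_ball.
have := @cintegral_step R _ _ dx F s (fun c x => `|x - c * d|_F <= pi * `|d|_F)
  (fun=> 1) (vol (pi * `|d|_F)) (fun x => if `|x|_F <= `|d|_F then 1 else 0).
move=> /(_ hm (fun c => measure_ball _ pd0)) h1.
have hm' : measurable ([set x : F | `|x|_F <= `|d|_F] : set (borel (0 : F))).
  by have := measurable_ball 0 d0'; under eq_set do rewrite subr0.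
have := @cintegral_step R _ _ dx unit [:: tt] (fun _ x => `|x|_F <= `|d|_F)
  (fun=> 1) (vol `|d|_F) (fun x => if `|x|_F <= `|d|_F then 1 else 0).
move=> /(_ (fun=> hm') (fun=> measure_ball0 d0') (fun x => esym (big_seq1 _ _ _))).
rewrite big_seq1 h1 => [|x]; last first.
  rewrite sum_count_mul; case: ifPn => hx.
    rewrite (_ : count _ _ = 1%N) //; apply: etrans (sc (x / d) _).
      apply: eq_count => c; rewrite expr1 -[RHS](ler_pM2r d0') -(lfabsM (c - _)).
      by rewrite mulrBl divfK // lfabsBC.
    by rewrite lfabsM lfabsV ler_pdivrMr // mul1r.
  rewrite (_ : count _ _ = 0%N) //; apply/eqP; rewrite -leqn0 leqNgt -has_count.
  apply/hasPn => c cs; apply: contra hx => hx.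
  rewrite -(subrK (c * d) x) lfabsD_le //.
    by apply: le_trans hx _; rewrite ler_piMl ?lfabs_ge0 // ltW // unif_lt1.
  by rewrite lfabsM ler_piMl ?lfabs_ge0 //; exact: s1.
have -> : \sum_(i <- s) (1 : C) = ((size s)%:R : R)%:C%C.
  by rewrite big_const_seq count_predT iter_addr_0 rmorph_nat.
rewrite -rmorphM mulr1 => -[]; rewrite expr1 in ss; rewrite ss => <-.
rewrite [_ * _%:R]mulrC mulKf //.
by have := unif_gt0 punif; rewrite ss invr_gt0 => /lt0r_neq0.
Qed.

Lemma volE d : d != 0 -> vol `|d|_F = `|d|_F * vol 1.
Proof.
have volX n : vol (pi ^+ n) = pi ^+ n * vol 1.
  elim: n => [|n ih]; first by rewrite expr0 mul1r.
  by rewrite exprS -lfabsX vol_unif ?expf_neq0 ?unif_neq0 // lfabsX ih mulrA.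
have volV n : vol (pi ^- n) = pi ^- n * vol 1.
  elim: n => [|n ih]; first by rewrite expr0 invr1 mul1r.
  have p0 := unif_gt0 punif.
  have := @vol_unif (p ^- n.+1) _; rewrite invr_eq0 expf_neq0 ?unif_neq0 //.
  move=> /(_ isT); rewrite lfabsV lfabsX.
  have -> : pi * pi ^- n.+1 = pi ^- n.
    by rewrite exprS invfM mulrA divff ?mul1r // gt_eqF.
  rewrite ih => h; apply: (mulfI (lt0r_neq0 p0)); rewrite -h exprS invfM.
  by rewrite !mulrA divff ?mul1r // gt_eqF.
move=> d0; have [d1|d1] := leP `|d|_F 1.
  by have [n ->] := lfabs_le1_expn punif d0 d1.
have [||n hn] := @lfabs_le1_expn _ _ _ punif d^-1; first by rewrite invr_eq0.
  by rewrite lfabsV invf_le1 ?lfabs_gt0 // ltW.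
by rewrite -(invrK `|d|_F) -lfabsV hn.
Qed.

Definition net_sum m j (f : 'rV[F]_m -> C) : C :=
  (vol (pi ^+ j) ^+ m)%:C%C * \sum_(c <- net m j) f c.

Lemma sch_net_expand m j (f : 'rV[F]_m -> C) : sch j f -> forall x,
  f x = \sum_(c <- net m j) (if vle (pi ^+ j) (x - c) then f c else 0).
Proof.
move=> [h1 h2] x; have [n1 n2] := netP punif m j.
transitivity (\sum_(c <- net m j) (if vle (pi ^+ j) (c - x) then f x else 0)).
  rewrite sum_count_mul; have [hx|hx] := boolP (vle (pi ^- j) x).
    by rewrite n2 ?mulr1n.
  have /eqP -> : f x == 0 by apply: contraNT hx; exact: h1.
  by rewrite mul0rn.
apply: eq_bigr => c _; rewrite vleBC; case: ifPn => // h.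
exact: scaleinv_eq h2 h.
Qed.

Lemma open_vle_ball m c j : open [set x : 'rV[F]_m | vle (pi ^+ j) (x - c)].
Proof.
rewrite openE => x /= hx; apply/nbhs_lfabs_rV; exists (pi ^+ j).
  exact: unifX_gt0.
move=> w hw /=; rewrite -(subrK x w) -addrA vleD //.
by apply/vleP => i; rewrite !mxE ltW.
Qed.

Lemma cintegral_net_sum n (dA : {measure set (borel (0 : 'rV[F]_n)) -> \bar R})
    (f : 'rV[F]_n -> C) j :
  product_measure_of dx dA -> sch j f -> cintegral dA setT f = net_sum j f.
Proof.
move=> hdA hf; apply: (@cintegral_step R _ (borel (0 : 'rV[F]_n)) dA 'rV[F]_n
  (net n j) (fun c x => vle (pi ^+ j) (x - c))) (sch_net_expand hf) => c.
  by apply: sub_sigma_algebra; exact: open_vle_ball.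
have pj := unifX_gt0 punif j.
have := hdA (fun i => [set x : F | `|x - c 0 i|_F <= pi ^+ j]).
move=> /(_ (fun i => measurable_ball _ pj)).
under eq_bigr => i _ do rewrite measure_ball //.
have -> : (\prod_(i < n) (vol (pi ^+ j))%:E = (vol (pi ^+ j) ^+ n)%:E)%E.
  by elim: n {f c hf dA hdA} => [|n ih]; rewrite ?big_ord0 // big_ord_recl ih exprS EFinM.
move=> <-; congr (dA _); apply/seteqP; split=> x /=.
  by move=> /vleP h i; have := h i; rewrite !mxE.
by move=> h; apply/vleP => i; rewrite !mxE.
Qed.

Lemma cintegral1_net_sum (f : 'rV[F]_1 -> C) j : sch j f ->
  cintegral dx setT (fun x => f (const_mx x)) = net_sum j f.
Proof.
move=> hf; have pj := unifX_gt0 punif j.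
rewrite /net_sum expr1 (net_eq (net1_is_net punif j) (netP punif 1 j) hf.2) big_map.
apply: (@cintegral_step R _ (borel (0 : F)) dx F (fnet p j)
  (fun c x => `|x - c|_F <= pi ^+ j)) => [c|c|x].
- exact: measurable_ball.
- exact: measure_ball.
rewrite (sch_net_expand hf).
rewrite (net_eq (f := fun c => if vle (pi ^+ j) (const_mx x - c) then f c else 0)
  (net1_is_net punif j) (netP punif 1 j)) ?big_map.
  by apply: eq_bigr => c _; rewrite vleE1 !mxE.
by move=> y t ht; rewrite hf.2 // opprD addrA (vle_addr _ (eq_ind_r is_true ht (vleN _ t))).
Qed.

(** Fubini: a product of nets is a net, and the sum does not depend on the net. *)
Lemma net_sum_row_mx m n j (f : 'rV[F]_(m + n) -> C) : sch j f ->
  net_sum j f = net_sum j (fun u => net_sum j (fun v => f (row_mx u v))).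
Proof.
move=> hf; rewrite /net_sum -mulr_sumr mulrA -rmorphM -exprD; congr (_ * _).
rewrite (net_eq (net_row_mx (netP punif m j) (netP punif n j)) (netP punif _ j) hf.2).
by rewrite big_allpairs_dep.
Qed.

Lemma sch_net_sum m n j (f : 'rV[F]_(m + n) -> C) : sch j f ->
  sch j (fun u => net_sum j (fun v => f (row_mx u v))).
Proof.
move=> hf; split=> [u|u t ht].
  apply: contraNT => hu; rewrite /net_sum big1 ?mulr0 // => v _; apply/eqP.
  by apply: contraNT hu => /hf.1; rewrite vle_row_mx => /andP[].
rewrite /net_sum; congr (_ * _); apply: eq_bigr => v _.
exact: (sch_slicel punif v hf).2.
Qed.

(** Induction on the dimension. In one variable the sums at both levels are the integral of the same
    function against [dx], which avoids comparing nets of different levels. *)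
Lemma net_sum_leq m i j (f : 'rV[F]_m -> C) : (i <= j)%N -> sch i f -> net_sum i f = net_sum j f.
Proof.
move=> ij; elim: m f => [|m ih] f hf.
  by rewrite /net_sum !expr0.
have hf' := sch_leq punif ij hf.
rewrite (@net_sum_row_mx 1 m i f hf) (@net_sum_row_mx 1 m j f hf').
rewrite -(cintegral1_net_sum (@sch_net_sum 1 m i f hf)) -(cintegral1_net_sum (@sch_net_sum 1 m
  j f hf')).
congr (cintegral _ _ _); apply/funext => x; apply: ih.
exact: (@sch_slicer _ _ _ punif 1 m).
Qed.

(* By [SE] the level j does not matter; the value is junk if there is none. *)
Definition schwartz_int m (f : 'rV[F]_m -> C) : C := net_sum (xget 0%N [set j | sch j f]) f.

Local Notation S := schwartz_int.

Lemma SE m j (f : 'rV[F]_m -> C) : sch j f -> S f = net_sum j f.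
Proof.
move=> hf; rewrite /schwartz_int; have := @xgetPex _ 0%N [set j | sch j f] (ex_intro _ j hf).
move: (xget _ _) => i /= hi; have [ij|ji] := leqP i j; first exact: net_sum_leq.
by rewrite (net_sum_leq (ltnW ji)).
Qed.

Lemma S_row_mx m n (f : 'rV[F]_(m + n) -> C) : schwartz f ->
  S f = S (fun u => S (fun v => f (row_mx u v))).
Proof.
move=> [j hf]; rewrite (SE hf) net_sum_row_mx // -(SE (sch_net_sum hf)); congr S.
by apply/funext => u; rewrite (SE (sch_slicer punif u hf)).
Qed.

Lemma S_swap m n (f : 'rV[F]_(m + n) -> C) : schwartz f ->
  S (fun u => S (fun v => f (row_mx u v))) = S (fun v => S (fun u => f (row_mx u v))).
Proof.
move=> [j hf]; rewrite -S_row_mx; last by exists j.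
rewrite (SE hf) net_sum_row_mx // /net_sum.
have h : sch j (fun v => net_sum j (fun u => f (row_mx u v))).
  split=> [v|v t ht].
    apply: contraNT => hv; rewrite /net_sum big1 ?mulr0 // => u _; apply/eqP.
    by apply: contraNT hv => /hf.1; rewrite vle_row_mx => /andP[].
  rewrite /net_sum; congr (_ * _); apply: eq_bigr => u _.
  exact: (sch_slicer punif u hf).2.
transitivity (S (fun v => net_sum j (fun u => f (row_mx u v)))); last first.
  by congr S; apply/funext => v; rewrite (SE (sch_slicel punif v hf)).
rewrite (SE h) /net_sum -!mulr_sumr mulrCA; congr (_ * (_ * _)).
exact: exchange_big.
Qed.

Lemma S_shift m (f : 'rV[F]_m -> C) t : schwartz f ->
  S (fun x => f (x + t)) = S f.
Proof.
move=> [i hf]; have [k ht] := vle_ex punif t.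
have ht' : vle (pi ^- (maxn i k)) t.
  by apply: vle_trans ht; apply: unifVX_le; rewrite ?leq_maxr.
have hf' := sch_leq punif (leq_maxl i k) hf.
rewrite (SE hf') (SE (sch_shift ht' hf')) /net_sum; congr (_ * _).
exact: (net_shift (netP punif m _) hf'.2 ht').
Qed.

Lemma S_scale m (f : 'rV[F]_m -> C) c : schwartz f ->
  S (fun x => c * f x) = c * S f.
Proof.
move=> [j hf]; have h : sch j (fun x => c * f x).
  split=> [x|x t ht]; last by rewrite hf.2.
  by rewrite mulf_eq0 negb_or => /andP[_ /hf.1].
by rewrite (SE hf) (SE h) /net_sum -mulr_sumr mulrCA.
Qed.

Lemma sch_sum m j (I : Type) (X : seq I) (f : I -> 'rV[F]_m -> C) :
  (forall i, sch j (f i)) -> sch j (fun x => \sum_(i <- X) f i x).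
Proof.
move=> hf; split=> [x|x t ht].
  apply: contraNT => hx; rewrite big1 // => i _; apply/eqP.
  by apply: contraNT hx => /(hf i).1.
by apply: eq_bigr => i _; rewrite (hf i).2.
Qed.

Lemma S_sum m j (I : Type) (X : seq I) (f : I -> 'rV[F]_m -> C) :
  (forall i, sch j (f i)) ->
  S (fun x => \sum_(i <- X) f i x) = \sum_(i <- X) S (f i).
Proof.
move=> hf; rewrite (SE (sch_sum X hf)) /net_sum exchange_big /= mulr_sumr.
by apply: eq_bigr => i _; rewrite (SE (hf i)).
Qed.

Lemma schD m j (f g : 'rV[F]_m -> C) : sch j f -> sch j g ->
  sch j (fun x => f x + g x).
Proof.
move=> hf hg; split=> [x|x t ht]; last by rewrite hf.2 ?hg.2.
have [h|/hf.1 //] := eqVneq (f x) 0; rewrite h add0r; exact: hg.1.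
Qed.

Lemma S_add m (f g : 'rV[F]_m -> C) : schwartz f -> schwartz g ->
  S (fun x => f x + g x) = S f + S g.
Proof.
move=> hf hg; have [j [hfj hgj]] := sch2 punif hf hg.
by rewrite (SE (schD hfj hgj)) (SE hfj) (SE hgj) /net_sum big_split mulrDr.
Qed.

Lemma S0 m : S (fun _ : 'rV[F]_m => 0) = 0.
Proof.
have h : sch 0 (fun _ : 'rV[F]_m => 0) by split=> // x; rewrite eqxx.
by rewrite (SE h) /net_sum big1 ?mulr0.
Qed.

Lemma ball_scale (d : F) : d != 0 -> exists j,
  `|d|_F <= pi ^- j /\ pi ^+ j <= `|d|_F.
Proof.
move=> d0; have [i hi] := unifVX_large punif `|d|_F.
have [k hk] := @unifX_small _ _ _ punif `|d|_F (eq_ind_r is_true d0 (lfabs_gt0 d)).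
exists (maxn i k); split.
  by apply: le_trans hi _; apply: unifVX_le; rewrite ?leq_maxl.
by apply: le_trans (ltW hk); apply: unifX_le; rewrite ?leq_maxr.
Qed.

Lemma schwartz_ball m (d : F) : d != 0 ->
  schwartz (fun x : 'rV[F]_m => (vle `|d|_F x)%:R).
Proof.
move=> /ball_scale[j [h1 h2]]; exists j; split=> [x|x t ht].
  case: (boolP (vle _ x)) => [h _|]; last by rewrite eqxx.
  exact: vle_trans h1 h.
by rewrite vle_addr //; exact: vle_trans ht.
Qed.

Lemma S_ball m (d : F) : d != 0 ->
  S (fun x : 'rV[F]_m => (vle `|d|_F x)%:R) = ((`|d|_F * vol 1) ^+ m)%:C%C.
Proof.
move=> d0; elim: m => [|m ih].
  have [j hj] := schwartz_ball 0 d0.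
  by rewrite (SE hj) /net_sum big_seq1 vle_ord0 !expr0 mulr1.
rewrite (@S_row_mx 1 m); last exact: schwartz_ball.
transitivity (S (fun u : 'rV[F]_1 =>
    ((`|d|_F * vol 1) ^+ m)%:C%C * (vle `|d|_F u)%:R)).
  congr S; apply/funext => u; rewrite -ih.
  rewrite (_ : (fun v => _) = fun v : 'rV[F]_m => (vle `|d|_F u && vle `|d|_F v)%:R).
    by case: (vle _ u); rewrite ?mulr1 // mulr0 S0.
  apply/funext => v; congr (_%:R); congr nat_of_bool.
  exact: (@vle_row_mx R F 1 m).
rewrite S_scale; last exact: schwartz_ball.
have [j hj] := schwartz_ball 1 d0; rewrite (SE hj) -(cintegral1_net_sum hj).
have d0' : 0 < `|d|_F by rewrite lfabs_gt0.
have hm' : measurable ([set x : F | `|x|_F <= `|d|_F] : set (borel (0 : F))).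
  by have := measurable_ball 0 d0'; under eq_set do rewrite subr0.
rewrite (@cintegral_step R _ _ dx unit [:: tt] (fun _ x => `|x|_F <= `|d|_F)
  (fun=> 1) (vol `|d|_F)) //.
- by rewrite big_seq1 mulr1 volE // -rmorphM exprSr.
- by move=> _; exact: measure_ball0.
by move=> x; rewrite big_seq1 vleE1 mxE; case: ifP.
Qed.

(** The level j of the decomposition is unrelated to that of f. The balls may be larger than those
    on which f is invariant, so that a phase can oscillate inside each of them. *)
Lemma S_local m j (f : 'rV[F]_m -> C) : schwartz f ->
  (forall x, f x != 0 -> vle (pi ^- j) x) ->
  (forall c, S (fun x => if vle (pi ^+ j) (x - c) then f x else 0) = 0) -> S f = 0.
Proof.
move=> [i hf] hj h; have hk := sch_leq punif (leq_maxl i j) hf.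
have e x : f x = \sum_(c <- net m j) (if vle (pi ^+ j) (x - c) then f x else 0).
  have [n1 n2] := netP punif m j.
  under eq_bigr do rewrite vleBC.
  rewrite sum_count_mul; have [hx|hx] := boolP (vle (pi ^- j) x).
    by rewrite n2 ?mulr1n.
  have /eqP -> : f x == 0 by apply: contraNT hx; exact: hj.
  by rewrite mul0rn.
rewrite (_ : f = fun x => \sum_(c <- net m j) (if vle (pi ^+ j) (x - c) then f x else 0)).
  rewrite (@S_sum _ (maxn i j)) ?big1 // => c.
  split=> [x|x t ht]; first by case: ifP; [move=> _; exact: hk.1|rewrite eqxx].
  have ht' : vle (pi ^+ j) t.
    by apply: vle_trans ht; apply: unifX_le; rewrite ?leq_maxr.
  by rewrite hk.2 // (addrAC x) (vle_addr _ ht').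
exact/funext.
Qed.

(** An additive isometry carries cosets of a ball to cosets of a ball of the same radius, hence nets
    to nets. The equality m = n is a hypothesis because for an abstract chart the two dimensions are
    only provably equal. *)
Lemma S_linear_iso m n (L : 'rV[F]_m -> 'rV[F]_n) (L' : 'rV[F]_n -> 'rV[F]_m)
    (f : 'rV[F]_n -> C) :
  {morph L' : x y / x - y} -> cancel L L' -> cancel L' L ->
  (forall r v, vle r (L v) = vle r v) -> m = n ->
  schwartz f -> S (fun v => f (L v)) = S f.
Proof.
move=> L'B LK L'K hL emn [j hf].
have hL' r v : vle r (L' v) = vle r v by rewrite -hL L'K.
have LB x y : L (x + y) = L x + L y.
  apply: (can_inj L'K); rewrite LK.
  by rewrite -(opprK (L y)) L'B -sub0r L'B LK -[0](subrr 0) L'B subrr sub0r LK opprK.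
have h : sch j (fun v => f (L v)).
  split=> [x /hf.1|x t ht]; first by rewrite hL.
  by rewrite LB hf.2 ?hL.
rewrite (SE hf) (SE h) /net_sum; have -> : vol (pi ^+ j) ^+ m = vol (pi ^+ j) ^+ n by rewrite emn.
congr (_ * _).
apply: (net_change (netP punif n j) hf.2) => [c cX|d hd].
  by rewrite hL; exact: (netP punif m j).1.
apply: etrans ((netP punif m j).2 (L' d) _); last by rewrite hL'.
by apply: eq_count => c; rewrite vleBC -hL' L'B LK.
Qed.

End Schwartz.

(** * The conductor of an additive character *)

Section Characters.
Variables (R : realType) (F : nonArchLocalFieldType R) (p : F).
Hypothesis punif : uniformizer p.
Variable psi : F -> R[i].
Hypothesis psi_char : additive_character psi.
Local Notation "`| x |_F" := (@lfabs R F x) (format "`| x |_F").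
Local Notation pi := (`|p|_F).
Local Notation C := R[i].

Lemma psiD x y : psi (x + y) = psi x * psi y.
Proof. by case: psi_char. Qed.

Lemma psi_neq0 x : psi x != 0.
Proof. by case: psi_char => _ /(_ x) h _; rewrite -normr_eq0 h oner_eq0. Qed.

Lemma psi0 : psi 0 = 1.
Proof. by apply: (mulfI (psi_neq0 0)); rewrite -psiD addr0 mulr1. Qed.

Lemma psi_eq x y : psi (x - y) = 1 -> psi x = psi y.
Proof. by move=> h; rewrite -(subrK y x) psiD h mul1r. Qed.

(* The image of a small ball is a subgroup of the unit circle contained in
   {|z - 1| < 1/2}, hence trivial: doubling multiplies |z - 1| by at least 3/2. *)
Lemma psi_trivial_near0 : exists n, forall x, `|x|_F <= pi ^+ n -> psi x = 1.
Proof.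
have [_ psi1 psic] := psi_char.
have half0 : (0 : C) < 2^-1 by rewrite invr_gt0 ltr0n.
have /cvgrPdist_lt/(_ _ half0) := psic (0 : F).
rewrite psi0 => /nbhs_lfabsP[e e0 he].
have [n hn] := unifX_small punif e0; exists n => x hx.
have ball0 y : `|y|_F <= pi ^+ n -> `|psi y - 1| <= 2^-1.
  by move=> hy; rewrite distrC ltW // he // subr0 (le_lt_trans hy).
have grow k y : `|y|_F <= pi ^+ n -> (3 / 2) ^+ k * `|psi y - 1| <= 2^-1.
  elim: k y => [|k ih] y hy; first by rewrite expr0 mul1r ball0.
  apply: le_trans (ih (y + y) (lfabsD_le hy hy)).
  rewrite exprSr -mulrA ler_wpM2l ?exprn_ge0 ?divr_ge0 ?ler0n //.
  have -> : psi (y + y) - 1 = (psi y - 1) * (psi y + 1).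
    by rewrite psiD mulrDr mulr1 mulrBl mul1r addrA subrK.
  rewrite normrM mulrC ler_wpM2l ?normr_ge0 //.
  have -> : psi y + 1 = 2 - (1 - psi y) by ring.
  apply: le_trans (lerB_dist _ _); rewrite [`|2|]ger0_norm ?ler0n // distrC.
  have -> : 3 / 2 = 2 - 2^-1 :> C.
    apply: (mulIf (lt0r_neq0 (ltr0n C 2))).
    by rewrite divfK ?pnatr_eq0 // mulrBl mulVf ?pnatr_eq0 // -natrM -[1]/(1%:R) -natrB.
  by rewrite lerD2l lerN2 ball0.
apply/eqP; rewrite -subr_eq0; apply/negPn/negP => hne.
have d0 : 0 < Normc.normc (psi x - 1).
  by rewrite -ltcR -[(Normc.normc _)%:C%C]/(`|psi x - 1|) normr_gt0.
have r1 : `|(3 / 2)^-1 : R| < 1.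
  by rewrite ger0_norm ?invr_ge0 ?divr_ge0 ?ler0n // invf_lt1 ?divr_gt0 ?ltr0n // ltr_pdivlMr
    ?ltr0n // mul1r ltr_nat.
have /cvgrPdist_lt/(_ _ d0)[N _ /(_ N (leqnn N))] := @cvg_expr R _ r1.
rewrite /= sub0r normrN normrX ger0_norm ?invr_ge0 ?divr_ge0 ?ler0n // exprVn.
have h32 : 0 < (3 / 2 : R) ^+ N by rewrite exprn_gt0 // divr_gt0 ?ltr0n.
rewrite invf_plt ?posrE // => h.
have := grow N x hx; rewrite -[`|psi x - 1|]/((Normc.normc (psi x - 1))%:C%C).
have -> : (3 / 2) ^+ N = ((3 / 2) ^+ N : R)%:C%C.
  by rewrite rmorphXn rmorphM fmorphV !rmorph_nat.
have -> : 2^-1 = (2^-1 : R)%:C%C by rewrite fmorphV rmorph_nat.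
rewrite -rmorphM lecR => h'.
move: h; rewrite -(ltr_pM2r d0) mulVf ?gt_eqF // => h.
have := lt_le_trans h h'; rewrite invf_gt1 ?ltr0n //.
by rewrite ltrn1.
Qed.

(** The ball of radius |e| is the largest one on which psi is trivial, and x lies in the next larger
    one. The radius is pi^(i - k) with i least; k is such that the ball for i = 0 contains a point
    where psi is not 1, so that i is positive. *)
Lemma psi_conductor : nontrivial_character psi -> exists e : F,
  [/\ e != 0, forall x, `|x|_F <= `|e|_F -> psi x = 1
    & exists x, pi * `|x|_F <= `|e|_F /\ psi x != 1].
Proof.
move=> [x1 hx1]; have [n hn] := psi_trivial_near0.
have [k hk] := unifVX_large punif `|x1|_F.
pose P i := `[< forall x, `|x|_F <= `|p ^+ i / p ^+ k|_F -> psi x = 1 >].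
have p0 := unif_neq0 punif; have pk0 : p ^+ k != 0 by rewrite expf_neq0.
have ex : exists i, P i.
  exists (n + k)%N; apply/asboolP => x; rewrite exprD mulfK // lfabsX; exact: hn.
case: (ex_minnP ex) => -[|i] /asboolP hi hmin.
  case/eqP: hx1; apply: hi; rewrite expr0 mul1r lfabsV lfabsX; exact: hk.
exists (p ^+ i.+1 / p ^+ k); split=> //.
  by rewrite mulf_neq0 ?invr_eq0 // expf_neq0.
have /asboolP : ~~ P i by apply/negP => /hmin; rewrite ltnn.
move=> /existsNP[x /not_implyP[hx /eqP nx]]; exists x; split=> //.
rewrite exprS -mulrA lfabsM ler_pM2l //; exact: unif_gt0.
Qed.

End Characters.

(** * Size and variation of polynomial maps *)

Section Polynomials.
Variables (R : realType) (F : nonArchLocalFieldType R) (p : F).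
Hypothesis punif : uniformizer p.
Local Notation "`| x |_F" := (@lfabs R F x) (format "`| x |_F").
Local Notation pi := (`|p|_F).

(* Size and variation of a polynomial of degree at most n with coefficients in
   the ring of integers. *)
Definition pol m n (g : 'rV[F]_m -> F) := forall r s x t,
  1 <= r -> 0 <= s -> s <= r -> vle r x -> vle s t ->
  `|g x|_F <= r ^+ n /\ `|g (x + t) - g x|_F <= r ^+ n * s.

Lemma pol_cst m n c : `|c|_F <= 1 -> pol n (fun _ : 'rV[F]_m => c).
Proof.
move=> c1 r s x t r1 s0 sr _ _; have rn : 1 <= r ^+ n by exact: exprn_ege1.
by rewrite subrr lfabs0 (le_trans c1) // mulr_ge0 // (le_trans ler01).
Qed.

Lemma pol_coord m i : pol 1 (fun x : 'rV[F]_m => x 0 i).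
Proof.
move=> r s x t r1 s0 sr /vleP hx /vleP ht; rewrite expr1 hx mxE (addrC (x 0 i)) addrK; split=> //.
by rewrite (le_trans (ht i)) // ler_peMl.
Qed.

Lemma polD m n (g h : 'rV[F]_m -> F) : pol n g -> pol n h ->
  pol n (fun x => g x + h x).
Proof.
move=> hg hh r s x t r1 s0 sr hx ht.
have [g1 g2] := hg r s x t r1 s0 sr hx ht.
have [h1 h2] := hh r s x t r1 s0 sr hx ht.
by rewrite lfabsD_le // opprD addrACA lfabsD_le.
Qed.

Lemma polN m n (g : 'rV[F]_m -> F) : pol n g -> pol n (fun x => - g x).
Proof.
move=> hg r s x t r1 s0 sr hx ht; have := hg r s x t r1 s0 sr hx ht.
by rewrite lfabsN -opprD lfabsN.
Qed.

Lemma polB m n (g h : 'rV[F]_m -> F) : pol n g -> pol n h ->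
  pol n (fun x => g x - h x).
Proof. by move=> hg hh; apply: polD => //; exact: polN. Qed.

Lemma polM m n k (g h : 'rV[F]_m -> F) : pol n g -> pol k h ->
  pol (n + k) (fun x => g x * h x).
Proof.
move=> hg hh r s x t r1 s0 sr hx ht.
have r0 : 0 <= r by exact: le_trans r1.
have [g1 g2] := hg r s x t r1 s0 sr hx ht.
have [h1 h2] := hh r s x t r1 s0 sr hx ht.
have hxt : vle r (x + t) by rewrite vleD //; exact: vle_trans ht.
have [h1' _] := hh r s (x + t) t r1 s0 sr hxt ht.
rewrite lfabsM exprD ler_pM ?lfabs_ge0 //; split=> //.
have -> : g (x + t) * h (x + t) - g x * h x =
  (g (x + t) - g x) * h (x + t) + g x * (h (x + t) - h x) by ring.
apply: lfabsD_le; rewrite lfabsM.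
  by rewrite mulrAC ler_pM ?lfabs_ge0.
by rewrite -mulrA ler_pM ?lfabs_ge0.
Qed.

Lemma pol_sum m n (I : Type) (X : seq I) (P : pred I) (g : I -> 'rV[F]_m -> F) :
  (forall i, pol n (g i)) -> pol n (fun x => \sum_(i <- X | P i) g i x).
Proof.
move=> hg r s x t r1 s0 sr hx ht.
have rn : 0 <= r ^+ n by rewrite exprn_ge0 // (le_trans ler01).
split; first by apply: lfabs_sum_le => // i _; exact: (hg i r s x t _ _ _ hx ht).1.
rewrite -sumrB; apply: lfabs_sum_le => [|i _]; first exact: mulr_ge0.
exact: (hg i r s x t _ _ _ hx ht).2.
Qed.

Lemma pol_comp m m' n (g : 'rV[F]_m -> F) (L : 'rV[F]_m' -> 'rV[F]_m) :
  {morph L : x y / x + y} -> (forall r v, vle r v -> vle r (L v)) ->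
  pol n g -> pol n (fun x => g (L x)).
Proof.
by move=> LD hL hg r s x t r1 s0 sr hx ht; rewrite LD; apply: hg => //; exact: hL.
Qed.

(** Uniform continuity on bounded sets, which makes psi (g / b) invariant at a fixed scale on the
    support of an amplitude. Unlike [pol] it also covers coefficients outside O, such as those of
    the phase in (u, v) for fixed x and y. *)
Definition locunif m (g : 'rV[F]_m -> F) := forall (r e : R), 0 < e ->
  exists j, forall x t, vle r x -> vle (pi ^+ j) t -> `|g (x + t) - g x|_F <= e.

Lemma pol_locunif m n (g : 'rV[F]_m -> F) : pol n g -> locunif g.
Proof.
move=> hg r e e0; pose r' := Num.max 1 r.
have r'1 : 1 <= r' by rewrite le_max lexx.
have r'n : 0 < r' ^+ n by rewrite exprn_gt0 // (lt_le_trans ltr01).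
have [j hj] := unifX_small punif (divr_gt0 e0 r'n); exists j => x t hx ht.
have hx' : vle r' x by apply: vle_trans hx; rewrite le_max lexx orbT.
apply: le_trans (hg r' _ x t r'1 (unifX_ge0 punif j) _ hx' ht).2 _.
  by apply: le_trans r'1; rewrite exprn_ile1 ?lfabs_ge0 // ltW // unif_lt1.
by rewrite mulrC -ler_pdivlMr // ltW.
Qed.

Definition dot l (u v : 'rV[F]_l) : F := \sum_i u 0 i * v 0 i.

Lemma dotC l (u v : 'rV[F]_l) : dot u v = dot v u.
Proof. by apply: eq_bigr => i _; rewrite mulrC. Qed.

Lemma dotDl l (u u' v : 'rV[F]_l) : dot (u + u') v = dot u v + dot u' v.
Proof. by rewrite -big_split; apply: eq_bigr => i _; rewrite mxE mulrDl. Qed.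

Lemma dotDr l (u v v' : 'rV[F]_l) : dot u (v + v') = dot u v + dot u v'.
Proof. by rewrite dotC dotDl !(dotC u). Qed.

Lemma dotZl l c (u v : 'rV[F]_l) : dot (c *: u) v = c * dot u v.
Proof. by rewrite mulr_sumr; apply: eq_bigr => i _; rewrite mxE mulrA. Qed.

Lemma dotZr l c (u v : 'rV[F]_l) : dot u (c *: v) = c * dot u v.
Proof. by rewrite dotC dotZl dotC. Qed.

Lemma dot_delta l (c : F) (i : 'I_l) (v : 'rV[F]_l) :
  dot (c *: delta_mx 0 i) v = c * v 0 i.
Proof.
rewrite dotZl /dot (bigD1 i) //= mxE !eqxx mul1r big1 ?addr0 // => j ji.
by rewrite mxE (negPf ji) andbF mul0r.
Qed.

Lemma dot_le l r s (u v : 'rV[F]_l) : 0 <= r -> 0 <= s -> vle r u -> vle s v ->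
  `|dot u v|_F <= r * s.
Proof.
move=> r0 s0 /vleP hu /vleP hv; apply: lfabs_sum_le => [|i _]; first exact: mulr_ge0.
by rewrite lfabsM ler_pM ?lfabs_ge0.
Qed.

Lemma vle_delta l r (c : F) (i : 'I_l) : 0 <= r -> `|c|_F <= r ->
  vle r (c *: delta_mx 0 i).
Proof.
move=> r0 hc; apply/vleP => j; rewrite !mxE eqxx /=.
by case: eqP => _; rewrite ?mulr1 ?mulr0 ?lfabs0.
Qed.

Lemma pol_dot l : pol 2 (fun z : 'rV[F]_(l + l) => dot (lsubmx z) (rsubmx z)).
Proof.
apply: pol_sum => i; apply: (@polM _ 1 1).
  by have := @pol_coord (l + l) (lshift l i); congr pol; apply/funext => z; rewrite mxE.
by have := @pol_coord (l + l) (rshift l i); congr pol; apply/funext => z; rewrite mxE.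
Qed.

End Polynomials.

(** * Gaussian and nonstationary integrals *)

Section StationaryPhase.
Variables (R : realType) (F : nonArchLocalFieldType R) (p : F).
Hypothesis punif : uniformizer p.
Variable psi : F -> R[i].
Hypothesis psi_char : additive_character psi.
Variable dx : {measure set (borel (0 : F)) -> \bar R}.
Hypothesis dx_haar : haar_measure dx.
Local Notation "`| x |_F" := (@lfabs R F x) (format "`| x |_F").
Local Notation pi := (`|p|_F).
Local Notation C := R[i].
Local Notation sch := (@sch R F p _).
Local Notation schwartz := (@schwartz R F p _).
Local Notation S := (@schwartz_int R F p dx _).
Local Notation vol := (@vol R F dx).
Variable e : F.
Hypothesis e_neq0 : e != 0.
Hypothesis psi_triv : forall x, `|x|_F <= `|e|_F -> psi x = 1.
Hypothesis psi_nontriv : exists x, pi * `|x|_F <= `|e|_F /\ psi x != 1.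

(** The character t -> psi (t c) has conductor |e / c|. By discreteness |c r| > |e| forces pi |c r|
    >= |e|, so the quotient by c of a point just outside the conductor of psi has absolute value at
    most |r|. *)
Lemma psi_nontriv_at (c r : F) : `|e|_F < `|c * r|_F ->
  exists2 t, `|t|_F <= `|r|_F & psi (t * c) != 1.
Proof.
move=> h; have [x [hx nx]] := psi_nontriv.
have cr0 : 0 < `|c * r|_F by apply: le_lt_trans h; exact: lfabs_ge0.
have c0 : c != 0 by move: cr0; rewrite lfabs_gt0 mulf_eq0 negb_or => /andP[].
exists (x / c); last by rewrite divfK.
rewrite lfabsM lfabsV ler_pdivrMr ?lfabs_gt0 // -lfabsM mulrC.
have := le_trans hx (lfabs_gap punif h).
by rewrite ler_pM2l //; exact: unif_gt0.
Qed.

Lemma schwartzI m (f : 'rV[F]_m -> C) r d : d != 0 ->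
  (forall x, f x != 0 -> vle r x) ->
  (forall x t, vle `|d|_F t -> f (x + t) = f x) -> schwartz f.
Proof.
move=> d0 h1 h2; have [i hi] := unifVX_large punif r.
have [k hk] := @unifX_small _ _ _ punif `|d|_F (eq_ind_r is_true d0 (lfabs_gt0 d)).
exists (maxn i k); split=> [x /h1|x t ht].
  by apply: vle_trans; apply: le_trans hi _; apply: unifVX_le; rewrite ?leq_maxl.
apply: h2; apply: vle_trans ht; apply: le_trans (ltW hk); apply: unifX_le => //.
exact: leq_maxr.
Qed.

Lemma schwartz_psi m (f : 'rV[F]_m -> C) (g : 'rV[F]_m -> F) b :
  schwartz f -> locunif p g -> schwartz (fun x => f x * psi (g x / b)).
Proof.
move=> [i hf] hg.
(* The case b = 0 is included: division by 0 gives 0, and the factor is psi 0 = 1. *)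
have [b0|b0] := eqVneq b 0.
  exists i; split=> [x|x t ht]; rewrite b0 invr0 !mulr0 psi0 // ?mulr1.
    exact: hf.1.
  by rewrite hf.2.
have eb : 0 < `|e|_F * `|b|_F by rewrite mulr_gt0 // lfabs_gt0.
have [j hj] := hg (pi ^- i) _ eb.
have hk := sch_leq punif (leq_maxl i j) hf.
exists (maxn i j); split=> [x|x t ht].
  by rewrite mulf_eq0 negb_or => /andP[/hk.1].
rewrite hk.2 //; have [->|fx] := eqVneq (f x) 0; first by rewrite !mul0r.
congr (_ * _); apply: psi_eq => //; apply: psi_triv.
rewrite -mulrBl lfabsM lfabsV ler_pdivrMr ?lfabs_gt0 //; apply: hj.
  exact: hf.1.
by apply: vle_trans ht; apply: unifX_le; rewrite ?leq_maxr.
Qed.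

Lemma vle_submx m n r (z : 'rV[F]_(m + n)) :
  vle r z = vle r (lsubmx z) && vle r (rsubmx z).
Proof. by rewrite -vle_row_mx hsubmxK. Qed.

(** Translation invariance gives S f = c S f. The oscillatory integrals below vanish for this
    reason. *)
Lemma S_shift_eq0 m (f : 'rV[F]_m -> C) t c : schwartz f ->
  (forall x, f (x + t) = c * f x) -> c != 1 -> S f = 0.
Proof.
move=> hf h c1; have := S_shift punif dx_haar t hf.
under eq_fun do rewrite h.
rewrite S_scale // => /eqP; rewrite -subr_eq0 -{2}(mul1r (S f)) -mulrBl mulf_eq0.
by rewrite subr_eq0 (negPf c1) => /eqP.
Qed.

Lemma schwartz_slicer m n (f : 'rV[F]_(m + n) -> C) u :
  schwartz f -> schwartz (fun v => f (row_mx u v)).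
Proof. by move=> [j hf]; exists j; exact: sch_slicer. Qed.

Lemma schwartz_slicel m n (f : 'rV[F]_(m + n) -> C) v :
  schwartz f -> schwartz (fun u => f (row_mx u v)).
Proof. by move=> [j hf]; exists j; exact: sch_slicel. Qed.

Lemma locunif_dot2 l (s : 'rV[F]_l) : locunif p (fun u : 'rV[F]_l => dot u s).
Proof.
have [k hk] := vle_ex punif s.
move=> r r' r'0; have [j hj] := unifX_small punif (divr_gt0 r'0 (unifVX_gt0 punif k)).
exists j => x t _ ht; rewrite dotDl addrC addKr.
apply: le_trans (dot_le (unifX_ge0 punif j) (ltW (unifVX_gt0 punif k)) ht hk) _.
by rewrite -ler_pdivlMr ?unifVX_gt0 // ltW.
Qed.

(** The cubic phase for fixed x and y, where z = (u, v), s = sigma(y), t = tau(y). It is linear in u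
    and in v separately. *)
Definition phase l (x : F) (s t : 'rV[F]_l) (z : 'rV[F]_(l + l)) : F :=
  x * (1 + dot (lsubmx z) (rsubmx z)) - dot (lsubmx z) t - dot (rsubmx z) s.

Lemma phase_square l (x : F) (s t : 'rV[F]_l) z : x != 0 ->
  phase x s t (z + row_mx (x^-1 *: s) (x^-1 *: t)) =
  x - dot s t / x + x * dot (lsubmx z) (rsubmx z).
Proof.
move=> x0; rewrite -{1}(hsubmxK z) add_row_mx /phase row_mxKl row_mxKr.
rewrite !(dotDl, dotDr, dotZl, dotZr) (dotC t s) (dotC (rsubmx z) s).
by field.
Qed.

Lemma locunif_phase l (x : F) (s t : 'rV[F]_l) : locunif p (phase x s t).
Proof.
move=> r r' r'0.
have x1 : 0 < `|x|_F + 1 by rewrite ltr_wpDl ?lfabs_ge0.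
have [i hi] := pol_locunif punif (@pol_dot R F l) r (divr_gt0 r'0 x1).
have [j hj] := locunif_dot2 t r r'0; have [k hk] := locunif_dot2 s r r'0.
exists (maxn i (maxn j k)) => z w hz hw.
have hw' n : (n <= maxn i (maxn j k))%N -> vle (pi ^+ n) w.
  by move=> h; apply: vle_trans hw; exact: unifX_le.
have -> : phase x s t (z + w) - phase x s t z =
  x * (dot (lsubmx (z + w)) (rsubmx (z + w)) - dot (lsubmx z) (rsubmx z))
  - (dot (lsubmx (z + w)) t - dot (lsubmx z) t)
  - (dot (rsubmx (z + w)) s - dot (rsubmx z) s) by rewrite /phase; ring.
have hzl : vle r (lsubmx z) && vle r (rsubmx z) by rewrite -vle_row_mx hsubmxK.
have hwl n : vle (pi ^+ n) w -> vle (pi ^+ n) (lsubmx w) && vle (pi ^+ n) (rsubmx w).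
  by rewrite -vle_row_mx hsubmxK.
case/andP: hzl => hzl hzr.
apply: lfabsB_le; first apply: lfabsB_le.
- rewrite lfabsM; have := hi z w hz (hw' i (leq_maxl _ _)) => h.
  apply: le_trans (ler_wpM2l (lfabs_ge0 x) h) _.
  rewrite mulrCA ler_piMr ?(ltW r'0) // ler_pdivrMr // mul1r lerDl ler01 //.
- rewrite linearD /=; apply: hj => //.
  by have /hwl/andP[] := hw' j (leq_trans (leq_maxl _ _) (leq_maxr _ _)).
rewrite linearD /=; apply: hk => //.
by have /hwl/andP[] := hw' k (leq_trans (leq_maxr _ _) (leq_maxr _ _)).
Qed.

Section Gauss.
Hypothesis self_dual_vol : `|e|_F * vol 1 * vol 1 = 1.

(* The quadratic phase restricts first u, then v, to the ball on which the
   amplitude is constant. *)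
Lemma S_gauss l (b d : F) (f : 'rV[F]_(l + l) -> C) :
  b != 0 -> d != 0 -> schwartz f ->
  (forall x t, vle `|d|_F t -> f (x + t) = f x) ->
  `|e|_F * `|b|_F <= `|d|_F ^+ 2 ->
  S (fun z => f z * psi (dot (lsubmx z) (rsubmx z) / b)) =
  (`|b|_F ^+ l)%:C%C * f 0.
Proof.
move=> b0 d0 hf fd hb.
have b0' : 0 < `|b|_F by rewrite lfabs_gt0.
have d0' : 0 < `|d|_F by rewrite lfabs_gt0.
have hfpsi := schwartz_psi b hf (pol_locunif punif (@pol_dot R F l)).
(* The balls of radii |d| and |e b / d| are dual for the pairing psi (u.v / b). The bound on b
   places the dual ball inside the ball of radius |d|. *)
have eb0 : e * b / d != 0 by rewrite !mulf_neq0 // invr_eq0.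
have ebd : `|e * b / d|_F <= `|d|_F.
  by rewrite !lfabsM lfabsV ler_pdivrMr // -expr2.
have f00 (u v : 'rV[F]_l) : vle `|d|_F u -> f (row_mx u v) = f (row_mx 0 v).
  move=> hu; rewrite -(fd (row_mx 0 v) (row_mx u 0)); last first.
    by rewrite vle_row_mx hu vle0 // ltW.
  by rewrite add_row_mx add0r addr0.
have f0v (v : 'rV[F]_l) : vle `|d|_F v -> f (row_mx 0 v) = f 0.
  by move=> hv; rewrite -(fd 0 (row_mx 0 v)) ?add0r // vle_row_mx hv vle0 ?(ltW d0').
have nontriv (w : 'rV[F]_l) : ~~ vle `|e * b / d|_F w ->
    exists2 t : 'rV[F]_l, vle `|d|_F t & psi (dot t w / b) != 1.
  move=> /vleP/existsNP[i /negP]; rewrite -ltNge => hi.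
  have [|t ht nt] := @psi_nontriv_at (w 0 i / b) d.
    move: hi; rewrite !lfabsM !lfabsV ltr_pdivrMr // => hi.
    by rewrite mulrAC ltr_pdivlMr.
  exists (t *: delta_mx 0 i); first by rewrite vle_delta // ltW.
  by rewrite dot_delta -mulrA.
rewrite S_row_mx //.
(* For u outside the dual ball, a translation of v by at most |d| kills the inner integral. So u may
   be cut off at |d|, where the amplitude no longer depends on it. *)
transitivity (S (fun u => S (fun v : 'rV[F]_l =>
    (vle `|d|_F u)%:R * f (row_mx 0 v) * psi (dot u v / b)))).
  congr S; apply/funext => u.
  have [hu|hu] := boolP (vle `|d|_F u).
    congr S; apply/funext => v; rewrite row_mxKl row_mxKr f00 // mul1r //.
  rewrite [RHS](_ : _ = 0); last first.
    by rewrite -[RHS](S0 punif dx_haar l); congr S; apply/funext => v; rewrite !mul0r.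
  have [|t ht nt] := nontriv u.
    by apply: contra hu; apply: vle_trans.
  apply: (S_shift_eq0 (t := t) (c := psi (dot t u / b))) => // [|v].
    exact: (schwartz_slicer u hfpsi).
  rewrite !row_mxKl !row_mxKr dotDr mulrDl psiD // (dotC u t).
  rewrite -(fd (row_mx u v) (row_mx 0 t)) ?vle_row_mx ?ht ?vle0 ?(ltW d0') //.
  by rewrite add_row_mx addr0; ring.
have hF1 : schwartz (fun z : 'rV[F]_(l + l) => (vle `|d|_F (lsubmx z))%:R *
    f (row_mx 0 (rsubmx z)) * psi (dot (lsubmx z) (rsubmx z) / b)).
  apply: schwartz_psi; last exact: (pol_locunif punif (@pol_dot R F l)).
  have [j hj] := hf; have [k [k1 k2]] := ball_scale punif d0.
  have hjk := sch_leq punif (leq_maxl j k) hj.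
  exists (maxn j k); split=> [z|z t].
    rewrite vle_submx mulf_eq0 negb_or => /andP[h1 h2].
    apply/andP; split; last by have := hjk.1 _ h2; rewrite vle_row_mx => /andP[].
    move: h1; case: (boolP (vle _ _)) => [h _|]; last by rewrite eqxx.
    apply: vle_trans h; apply: le_trans k1 _; apply: unifVX_le => //; exact: leq_maxr.
  rewrite vle_submx => /andP[t1 t2]; rewrite !linearD /= vle_addr; last first.
    apply: vle_trans t1; apply: le_trans k2; apply: unifX_le => //; exact: leq_maxr.
  congr (_ * _); have := hjk.2 (row_mx 0 (rsubmx z)) (row_mx 0 (rsubmx t)).
  rewrite add_row_mx addr0 => -> //.
  by rewrite vle_row_mx t2 vle0 // unifX_ge0.
have := S_swap punif dx_haar hF1.
under eq_fun => u do under eq_fun => v do rewrite row_mxKl row_mxKr.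
under [X in _ = _ X -> _]eq_fun => v do under eq_fun => u do rewrite row_mxKl row_mxKr.
move=> ->.
(* After the exchange the u-integral is that of a character over a ball. It vanishes unless v is in
   the dual ball, where both the character and f are constant. *)
transitivity (S (fun v : 'rV[F]_l => ((`|d|_F * vol 1) ^+ l)%:C%C * f 0 *
   (vle `|e * b / d|_F v)%:R)).
  congr S; apply/funext => v.
  have [hv|hv] := boolP (vle `|e * b / d|_F v).
    rewrite mulr1 mulrC -(S_ball punif dx_haar l d0) -(S_scale punif dx_haar); last exact:
      schwartz_ball.
    congr S; apply/funext => u; rewrite f0v; last exact: vle_trans hv.
    have [hu|hu] := boolP (vle `|d|_F u); last by rewrite !mul0r mulr0.
    rewrite psi_triv ?mul1r ?mulr1 //.
    rewrite lfabsM lfabsV ler_pdivrMr //.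
    apply: le_trans (dot_le (lfabs_ge0 _) (lfabs_ge0 _) hu hv) _.
    by rewrite !lfabsM lfabsV mulrC divfK ?gt_eqF.
  rewrite mulr0; have [t ht nt] := nontriv v hv.
  apply: (S_shift_eq0 (t := t) (c := psi (dot t v / b))) => // [|u].
    have := schwartz_slicel v hF1.
    by under eq_fun => u do rewrite row_mxKl row_mxKr.
  by rewrite dotDl mulrDl psiD // vle_addr //; ring.
rewrite S_scale //; last exact: schwartz_ball.
rewrite S_ball // mulrAC -rmorphM -exprMn; congr (_%:C%C * _); congr (_ ^+ _).
rewrite !lfabsM lfabsV.
(* By self-duality the volumes of the two dual balls of F multiply to |b|. *)
have -> : `|d|_F * vol 1 * (`|e|_F * `|b|_F / `|d|_F * vol 1) =
  (`|e|_F * vol 1 * vol 1) * `|b|_F by field; rewrite gt_eqF.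
by rewrite self_dual_vol mul1r.
Qed.

(** Translating by the critical point (s / x, t / x) leaves the hyperbolic form x u.v, and the
    Gaussian formula applies with b = a / x. The translated amplitude at 0 is the amplitude at the
    critical point. *)
Lemma S_square l (a x d : F) (s t : 'rV[F]_l) (f : 'rV[F]_(l + l) -> C) :
  a != 0 -> x != 0 -> d != 0 -> schwartz f ->
  (forall z w, vle `|d|_F w -> f (z + w) = f z) ->
  `|e|_F * `|a / x|_F <= `|d|_F ^+ 2 ->
  S (fun z => f z * psi (phase x s t z / a)) =
  (`|a / x|_F ^+ l)%:C%C * (f (row_mx (x^-1 *: s) (x^-1 *: t)) *
    psi ((x - dot s t / x) / a)).
Proof.
move=> a0 x0 d0 hf fd hax.
have hfp := schwartz_psi a hf (locunif_phase x s t).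
have ax0 : a / x != 0 by rewrite mulf_neq0 ?invr_eq0.
set z0 := row_mx _ _.
rewrite -(S_shift punif dx_haar z0 hfp).
pose f0 z := f (z + z0).
have hf0 : schwartz f0.
  have [i hi] := hf; have [k hk] := vle_ex punif z0; exists (maxn i k).
  apply: sch_shift; last by apply: (sch_leq punif) hi; exact: leq_maxl.
  by apply: vle_trans hk; apply: unifVX_le => //; exact: leq_maxr.
have := @S_gauss l (a / x) d f0 ax0 d0 hf0 _ hax.
rewrite /f0 add0r => hg; rewrite mulrA -hg => [|z w hw]; last first.
  by rewrite addrAC fd.
rewrite mulrC -S_scale //; last exact: (schwartz_psi _ hf0 (pol_locunif punif (@pol_dot R F l))).
congr S; apply/funext => z; rewrite phase_square // mulrDl psiD // mulrCA; congr (_ * (_ * psi _)).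
by rewrite invf_div mulrA (mulrC x).
Qed.

End Gauss.

(** The phase has derivative x v - t in u and x u - s in v. On the support x u and x v have norm
    below 1, so where a coordinate of s or t is at least 1 the derivative has absolute value at
    least 1. As the phase is linear in that direction, some translation by at most |d| multiplies
    the integrand by a value of psi other than 1 once |e a| < |d|. *)
Lemma S_nonstationary l (a x d : F) r (s t : 'rV[F]_l) (f : 'rV[F]_(l + l) -> C) :
  a != 0 -> d != 0 -> 0 <= r -> (forall z, f z != 0 -> vle r z) ->
  (forall z w, vle `|d|_F w -> f (z + w) = f z) ->
  `|x|_F * r < 1 -> `|e|_F * `|a|_F < `|d|_F ->
  (exists i, 1 <= `|s 0 i|_F \/ 1 <= `|t 0 i|_F) ->
  S (fun z => f z * psi (phase x s t z / a)) = 0.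
Proof.
move=> a0 d0 r0 fr fd xr ead hst.
have hf := schwartzI d0 fr fd.
have hfp := schwartz_psi a hf (locunif_phase x s t).
have a0' : 0 < `|a|_F by rewrite lfabs_gt0.
have d0' : 0 < `|d|_F by rewrite lfabs_gt0.
have key (u w : 'rV[F]_l) i : vle r u -> 1 <= `|w 0 i|_F ->
  exists2 c, `|c|_F <= `|d|_F & psi (c * ((x * u 0 i - w 0 i) / a)) != 1.
  move=> /vleP hu hw; apply: psi_nontriv_at.
  rewrite !lfabsM lfabsV mulrAC ltr_pdivlMr //; apply: lt_le_trans ead _.
  rewrite ler_peMl ?(ltW d0') // -lfabsN opprB lfabs_add_eq // lfabsN lfabsM.
  apply: lt_le_trans hw; apply: le_lt_trans xr.
  by rewrite ler_wpM2l ?lfabs_ge0.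
have [i [si|ti]] := hst.
  rewrite S_row_mx //; rewrite -[RHS](S0 punif dx_haar l).
  congr S; apply/funext => u; have [hu|hu] := boolP (vle r u); last first.
    rewrite -[RHS](S0 punif dx_haar l); congr S; apply/funext => v.
    have [->|/fr] := eqVneq (f (row_mx u v)) 0; first by rewrite mul0r.
    by rewrite vle_row_mx (negPf hu).
  have [c hc nc] := key u s i hu si.
  apply: (S_shift_eq0 (t := c *: delta_mx 0 i) (c := psi (c * ((x * u 0 i - s 0 i) / a)))) =>
    // [|v].
    exact: (schwartz_slicer u hfp).
  have -> : f (row_mx u (v + c *: delta_mx 0 i)) = f (row_mx u v).
    rewrite -(fd (row_mx u v) (row_mx 0 (c *: delta_mx 0 i))).
      by rewrite add_row_mx addr0.
    by rewrite vle_row_mx vle0 ?vle_delta // ltW.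
  rewrite mulrCA -psiD //; congr (_ * psi _); rewrite /phase !row_mxKl !row_mxKr.
  rewrite !(dotDl, dotDr) (dotC u (c *: _)) !dot_delta; by field.
rewrite S_row_mx //; apply: etrans (S_swap punif dx_haar hfp) _.
rewrite -[RHS](S0 punif dx_haar l); congr S; apply/funext => v; have [hv|hv] := boolP (vle r
  v); last first.
  rewrite -[RHS](S0 punif dx_haar l); congr S; apply/funext => u.
  have [->|/fr] := eqVneq (f (row_mx u v)) 0; first by rewrite mul0r.
  by rewrite vle_row_mx (negPf hv) andbF.
have [c hc nc] := key v t i hv ti.
apply: (S_shift_eq0 (t := c *: delta_mx 0 i) (c := psi (c * ((x * v 0 i - t 0 i) / a)))) => // [|u].
  exact: (schwartz_slicel v hfp).
have -> : f (row_mx (u + c *: delta_mx 0 i) v) = f (row_mx u v).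
  rewrite -(fd (row_mx u v) (row_mx (c *: delta_mx 0 i) 0)).
    by rewrite add_row_mx addr0.
  by rewrite vle_row_mx vle0 ?vle_delta // ltW.
rewrite mulrCA -psiD //; congr (_ * psi _); rewrite /phase !row_mxKl !row_mxKr.
rewrite !(dotDl, dotDr) !dot_delta; by field.
Qed.

End StationaryPhase.

(** * Reduction of the cubic phase to one variable *)

Section Reduction.
Variables (R : realType) (F : nonArchLocalFieldType R) (p : F).
Hypothesis punif : uniformizer p.
Variable psi : F -> R[i].
Hypothesis psi_char : additive_character psi.
Variable dx : {measure set (borel (0 : F)) -> \bar R}.
Hypothesis dx_haar : haar_measure dx.
Local Notation "`| x |_F" := (@lfabs R F x) (format "`| x |_F").
Local Notation pi := (`|p|_F).
Local Notation C := R[i].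
Local Notation schwartz := (@schwartz R F p _).
Local Notation S := (@schwartz_int R F p dx _).
Local Notation vol := (@vol R F dx).
Variable e : F.
Hypothesis e_neq0 : e != 0.
Hypothesis psi_triv : forall x, `|x|_F <= `|e|_F -> psi x = 1.
Hypothesis psi_nontriv : exists x, pi * `|x|_F <= `|e|_F /\ psi x != 1.
Hypothesis self_dual_vol : `|e|_F * vol 1 * vol 1 = 1.

Variables (k l : nat) (sg tu : 'rV[F]_(k + k) -> 'rV[F]_l) (i0 : 'I_l).
Hypothesis sg_pol : forall i, pol 2 (fun y => sg y 0 i).
Hypothesis tu_pol : forall i, pol 2 (fun y => tu y 0 i).
Hypothesis sgtu_quad : forall y,
  1 + dot (sg y) (tu y) + dot (lsubmx y) (rsubmx y) = 0.
Hypothesis sgtu_unit : forall y,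
  sg y 0 i0 - tu y 0 i0 + dot (sg y) (tu y) = 1.

Definition pack (x : F) (y : 'rV[F]_(k + k)) (z : 'rV[F]_(l + l)) :
  'rV[F]_(1 + ((k + k) + (l + l))) := row_mx (const_mx x) (row_mx y z).

Definition cubic (w : 'rV[F]_(1 + ((k + k) + (l + l)))) : F :=
  phase (lsubmx w 0 0) (sg (lsubmx (rsubmx w))) (tu (lsubmx (rsubmx w)))
    (rsubmx (rsubmx w)).

Lemma cubic_pack x y z : cubic (pack x y z) = phase x (sg y) (tu y) z.
Proof. by rewrite /cubic /pack !row_mxKr !row_mxKl mxE. Qed.

Lemma vle_pack r x y z : vle r (pack x y z) = [&& `|x|_F <= r, vle r y & vle r z].
Proof. by rewrite /pack !vle_row_mx vle_const1. Qed.

Lemma packD x x' y y' z z' :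
  pack x y z + pack x' y' z' = pack (x + x') (y + y') (z + z').
Proof. by rewrite /pack !add_row_mx; congr row_mx; apply/rowP => i; rewrite !mxE. Qed.

(* If all sg_i, tu_i were smaller than 1, sgtu_unit would give 1 < 1. *)
Lemma sgtu_large y : exists i, 1 <= `|sg y 0 i|_F \/ 1 <= `|tu y 0 i|_F.
Proof.
apply: contrapT => /forallNP h.
have hs i : `|sg y 0 i|_F < 1 by rewrite ltNge; apply/negP => h1; apply: (h i); left.
have ht i : `|tu y 0 i|_F < 1 by rewrite ltNge; apply/negP => h1; apply: (h i); right.
have : `|(1 : F)|_F < 1.
  rewrite -(sgtu_unit y); apply: lfabsD_lt; first by apply: lfabsD_lt; rewrite ?lfabsN.
  apply: lfabs_sum_lt => // i _; rewrite lfabsM -(mulr1 1) ltr_pM ?lfabs_ge0 //.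
by rewrite lfabs1 ltxx.
Qed.

Lemma pol_cubic : pol 3 cubic.
Proof.
have hl : pol 1 (fun w : 'rV[F]_(1 + ((k + k) + (l + l))) => lsubmx w 0 0).
  by have := @pol_coord R F (1 + ((k + k) + (l + l))) (lshift _ 0); congr pol;
    apply/funext => z; rewrite mxE.
have subl m n : forall r (v : 'rV[F]_(m + n)), vle r v -> vle r (lsubmx v).
  by move=> r v; rewrite vle_submx => /andP[].
have subr m n : forall r (v : 'rV[F]_(m + n)), vle r v -> vle r (rsubmx v).
  by move=> r v; rewrite vle_submx => /andP[].
have hy (g : 'rV[F]_(k + k) -> F) : pol 2 g ->
    pol 2 (fun w : 'rV[F]_(1 + ((k + k) + (l + l))) => g (lsubmx (rsubmx w))).
  apply: (pol_comp (L := fun w : 'rV[F]_(1 + ((k + k) + (l + l))) => lsubmx (rsubmx w))).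
    by move=> x y; rewrite !linearD.
  by move=> r v hv; exact: (subl _ _ _ _ (subr _ _ _ _ hv)).
have hz n (g : 'rV[F]_(l + l) -> F) : pol n g ->
    pol n (fun w : 'rV[F]_(1 + ((k + k) + (l + l))) => g (rsubmx (rsubmx w))).
  apply: (pol_comp (L := fun w : 'rV[F]_(1 + ((k + k) + (l + l))) => rsubmx (rsubmx w))).
    by move=> x y; rewrite !linearD.
  by move=> r v hv; exact: (subr _ _ _ _ (subr _ _ _ _ hv)).
apply: polB; first apply: polB.
- apply: (@polM _ _ _ 1 2) => //; apply: polD; first by apply: pol_cst; rewrite lfabs1.
  exact: (hz 2 _ (@pol_dot R F l)).
- apply: pol_sum => i; apply: (@polM _ _ _ 1 2); last exact: (hy (fun y => tu y 0 i)).
  apply: (hz 1 (fun z => lsubmx z 0 i)).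
  by have := @pol_coord R F _ (lshift l i); congr pol; apply/funext => z; rewrite mxE.
apply: pol_sum => i; apply: (@polM _ _ _ 1 2); last exact: (hy (fun y => sg y 0 i)).
apply: (hz 1 (fun z => rsubmx z 0 i)).
by have := @pol_coord R F _ (rshift l i); congr pol; apply/funext => z; rewrite mxE.
Qed.

Lemma S_null m (f : 'rV[F]_m -> C) : (forall x, f x = 0) -> S f = 0.
Proof. by move=> h; rewrite -[RHS](S0 punif dx_haar m); congr S; exact/funext. Qed.

(** Here r bounds the support of f, |d| is its scale of invariance, and [eps] separates the
    nonstationary range of x. After the integration over (u, v) the amplitude depends on y also
    through sg(y) / x and tu(y) / x; these move by at most r^2 |d'| / eps, so it is invariant at the
    finer scale |d'|. The three bounds on |e a| serve, in order, the nonstationary range, the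
    Gaussian integral in (u, v), where |a / x| <= |a| / eps, and the one in y, where |x a| <= r |a|.
    The weak inequalities allow all scales to be 1 in the unramified case. *)
Lemma S_reduction (a d d' : F) (r eps : R) (f : 'rV[F]_(1 + ((k + k) + (l + l))) -> C) :
  a != 0 -> d != 0 -> d' != 0 -> 1 <= r -> 0 < eps -> eps * r <= 1 ->
  `|d'|_F <= `|d|_F -> `|d|_F <= r -> r ^+ 2 * `|d'|_F <= eps * `|d|_F ->
  `|e|_F * `|a|_F < `|d|_F -> `|e|_F * `|a|_F <= eps * `|d|_F ^+ 2 ->
  `|e|_F * `|a|_F * r <= `|d'|_F ^+ 2 ->
  (forall w, f w != 0 -> vle r w) ->
  (forall w t, vle `|d|_F t -> f (w + t) = f w) ->
  S (fun w => f w * psi (cubic w / a)) =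
  S (fun X : 'rV[F]_1 => let x := X 0 0 in
    if `|x|_F < eps then 0 else (`|a / x|_F ^+ l * `|x * a|_F ^+ k)%:C%C *
      (f (pack x 0 (x^-1 *: row_mx (sg 0) (tu 0))) * psi ((x + x^-1) / a))).
Proof.
move=> a0 d0 d'0 r1 eps0 epsr d'd dr rd' ead ead2 ear fr fd.
have r0 : 0 <= r by exact: le_trans r1.
have a0' : 0 < `|a|_F by rewrite lfabs_gt0.
have hf := schwartzI punif d0 fr fd.
have hfp := schwartz_psi punif psi_char e_neq0 psi_triv a hf (pol_locunif punif pol_cubic).
rewrite (S_row_mx punif dx_haar hfp); congr S; apply/funext => X /=; set x := X 0 0.
have eX : X = const_mx x by apply/rowP => i; rewrite (ord1 i) mxE.
rewrite eX; have hfx := schwartz_slicer punif (const_mx x) hfp.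
rewrite (S_row_mx punif dx_haar hfx).
have fz y : schwartz (fun z => f (pack x y z)).
  by have := schwartz_slicer punif y (schwartz_slicer punif (const_mx x) hf).
have fzd y : forall z w, vle `|d|_F w -> f (pack x y (z + w)) = f (pack x y z).
  move=> z w hw; rewrite -(fd (pack x y z) (pack 0 0 w)) ?packD ?addr0 //.
  by rewrite vle_pack hw lfabs0 vle0 lfabs_ge0.
have ecub y z : cubic (row_mx (const_mx x) (row_mx y z)) = phase x (sg y) (tu y) z.
  exact: cubic_pack.
case: ifPn => [xe|]; last rewrite -leNgt => xe.
  apply: S_null => y; under eq_fun => z do rewrite ecub.
  apply: (S_nonstationary punif psi_char dx_haar e_neq0 psi_triv psi_nontriv a0 d0 r0) => //.
  - by move=> z /fr; rewrite vle_row_mx => /andP[_]; rewrite vle_row_mx => /andP[].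
  - exact: fzd.
  - have [r00|r00] := eqVneq r 0; first by rewrite r00 mulr0.
    by apply: lt_le_trans epsr; rewrite ltr_pM2r // lt_neqAle eq_sym r00.
  exact: sgtu_large.
have x0' : 0 < `|x|_F by exact: lt_le_trans xe.
have x0 : x != 0 by rewrite -lfabs_gt0.
(* For |x| > r both sides vanish by the support of f; the bound |x| <= r is needed for the Gaussian
   integral in y. *)
have [xr|xr] := leP `|x|_F r; last first.
  have f0 y z : f (pack x y z) = 0.
    apply/eqP; apply: contraTT xr => /fr; rewrite vle_pack -leNgt => /andP[]//.
  rewrite f0 mul0r mulr0; apply: S_null => y; apply: S_null => z.
  by rewrite -/(pack x y z) f0 mul0r.
have eax : `|e|_F * `|a / x|_F <= `|d|_F ^+ 2.
  rewrite lfabsM lfabsV mulrA ler_pdivrMr // (le_trans ead2) // mulrC ler_wpM2l //.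
  by rewrite exprn_ge0 ?lfabs_ge0.
pose s y := x^-1 *: row_mx (sg y) (tu y).
pose f1 y := f (pack x y (s y)).
transitivity (S (fun y => (`|a / x|_F ^+ l)%:C%C * psi ((x + x^-1) / a) *
    (f1 y * psi (dot (lsubmx y) (rsubmx y) / (x * a))))).
  congr S; apply/funext => y; under eq_fun => z do rewrite ecub.
  have := @S_square _ _ _ punif _ psi_char _ dx_haar _ e_neq0 psi_triv psi_nontriv
    self_dual_vol l a x d (sg y) (tu y) _ a0 x0 d0 (fz y) (fzd y) eax.
  rewrite /pack => ->; rewrite -mulrA; congr (_ * _).
  rewrite mulrCA -psiD // /f1 /pack /s scale_row_mx; congr (_ * psi _).
  have -> : dot (sg y) (tu y) = - 1 - dot (lsubmx y) (rsubmx y).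
    by have /eqP := sgtu_quad y; rewrite -addrA addrC addr_eq0 => /eqP h; rewrite -h addrK.
  by field; rewrite a0.
have f1r y : f1 y != 0 -> vle r y.
  by move=> /fr; rewrite vle_pack => /and3P[].
have d'r : `|d'|_F <= r by exact: le_trans dr.
have f1d y t : vle `|d'|_F t -> f1 (y + t) = f1 y.
  move=> ht; have [hy|hy] := boolP (vle r y); last first.
    have -> : f1 y = 0 by apply/eqP; apply: contraNT hy; exact: f1r.
    apply/eqP; apply: contraNT hy => /f1r; rewrite vle_addr //.
    exact: vle_trans ht.
  rewrite /f1 -(fd (pack x y (s y)) (pack 0 t (s (y + t) - s y))) ?packD.
    by rewrite addr0 (addrC (s y)) subrK.
  rewrite vle_pack lfabs0 lfabs_ge0 (vle_trans d'd ht) /=.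
  rewrite /s -scalerBr opp_row_mx add_row_mx.
  have hst : vle (eps * `|d|_F) (row_mx (sg (y + t) - sg y) (tu (y + t) - tu y)).
    rewrite vle_row_mx; apply/andP; split; apply/vleP => i; rewrite !mxE.
      by apply: le_trans rd'; exact: (@sg_pol i r _ y t r1 (lfabs_ge0 d') d'r hy ht).2.
    by apply: le_trans rd'; exact: (@tu_pol i r _ y t r1 (lfabs_ge0 d') d'r hy ht).2.
  apply: vle_trans (vleZ x^-1 hst); rewrite lfabsV mulrA ler_piMl ?lfabs_ge0 //.
  by rewrite mulrC ler_pdivrMr // mul1r.
have hf1 := schwartzI punif d'0 f1r f1d.
have xa0 : x * a != 0 by rewrite mulf_neq0.
rewrite S_scale //; last first.
  exact: (schwartz_psi punif psi_char e_neq0 psi_triv (x * a) hf1 (pol_locunif punif (@pol_dot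
    R F k))).
rewrite (@S_gauss _ _ _ punif _ psi_char _ dx_haar _ e_neq0 psi_triv psi_nontriv
    self_dual_vol k (x * a) d' f1) //.
  by rewrite rmorphM /f1 /s; ring.
rewrite lfabsM mulrCA mulrC; apply: le_trans ear; rewrite ler_wpM2l // mulr_ge0 ?lfabs_ge0 //.
Qed.

End Reduction.

(** * The oscillatory integral with phase x + 1/x *)

Section OneDimensional.
Variables (R : realType) (F : nonArchLocalFieldType R) (p : F).
Hypothesis punif : uniformizer p.
Variable psi : F -> R[i].
Hypothesis psi_char : additive_character psi.
Variable dx : {measure set (borel (0 : F)) -> \bar R}.
Hypothesis dx_haar : haar_measure dx.
Local Notation "`| x |_F" := (@lfabs R F x) (format "`| x |_F").
Local Notation pi := (`|p|_F).
Local Notation C := R[i].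
Local Notation schwartz := (@schwartz R F p _).
Local Notation S := (@schwartz_int R F p dx _).
Variable e : F.
Hypothesis e_neq0 : e != 0.
Hypothesis psi_triv : forall x, `|x|_F <= `|e|_F -> psi x = 1.
Hypothesis psi_nontriv : exists x, pi * `|x|_F <= `|e|_F /\ psi x != 1.

Definition klo (a : F) (h : F -> C) (X : 'rV[F]_1) : C :=
  h (X 0 0) * psi ((X 0 0 + (X 0 0)^-1) / a).

Lemma lfabs_perturb (x t : F) r : r <= `|x|_F -> `|t|_F < r -> `|x + t|_F = `|x|_F.
Proof. by move=> h1 h2; apply: lfabs_add_eq; exact: lt_le_trans h2 h1. Qed.

Lemma schwartz_klo (a d : F) (eps r : R) (h : F -> C) :
  a != 0 -> d != 0 -> 0 < eps ->
  (forall x, h x != 0 -> eps <= `|x|_F <= r) ->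
  (forall x t, `|t|_F <= `|d|_F -> h (x + t) = h x) ->
  schwartz (klo a h).
Proof.
move=> a0 d0 eps0 hs hd.
have d0' : 0 < `|d|_F by rewrite lfabs_gt0.
have ea0 : 0 < `|e|_F * `|a|_F by rewrite mulr_gt0 // lfabs_gt0.
(* [M] bounds 1 - 1 / (x (x + t)), the difference quotient of x + 1/x between x and x + t. *)
pose M := 1 + eps ^- 2; have M0 : 0 < M by rewrite addr_gt0 // invr_gt0 exprn_gt0.
pose B := Num.min `|d|_F (Num.min eps (`|e|_F * `|a|_F / M)).
have B0 : 0 < B by rewrite !lt_min d0' eps0 divr_gt0.
have [j hj] := unifX_small punif B0.
move: hj; rewrite !lt_min => /and3P[j1 j2 j3].
apply: (@schwartzI R F p punif 1 _ r (p ^+ j)); first by rewrite expf_neq0 // unif_neq0.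
  move=> X; rewrite mulf_eq0 negb_or vleE1 => /andP[/hs/andP[]//].
move=> X T; rewrite vleE1 lfabsX /klo mxE; set x := X 0 0; set t := T 0 0 => ht.
rewrite hd; last by apply: le_trans ht (ltW j1).
have [->|hx] := eqVneq (h x) 0; first by rewrite !mul0r.
congr (_ * _); apply: psi_eq => //; apply: psi_triv.
have /andP[ex _] := hs x hx.
have x0' : 0 < `|x|_F by exact: lt_le_trans ex.
have xt : `|x + t|_F = `|x|_F by apply: lfabs_perturb ex _; exact: le_lt_trans j2.
have x0 : x != 0 by rewrite -lfabs_gt0.
have xt0 : x + t != 0 by rewrite -lfabs_gt0 xt.
rewrite -mulrBl lfabsM lfabsV ler_pdivrMr ?lfabs_gt0 //.
have -> : x + t + (x + t)^-1 - (x + x^-1) = t * (1 - (x * (x + t))^-1).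
  by field; rewrite x0 xt0.
rewrite lfabsM; apply: le_trans (_ : pi ^+ j * M <= _); last first.
  by rewrite -ler_pdivlMr // ltW.
rewrite ler_pM ?lfabs_ge0 //; apply: lfabsB_le.
  by rewrite lfabs1 lerDl invr_ge0 exprn_ge0 // ltW.
rewrite lfabsV lfabsM xt -expr2; apply: le_trans (_ : eps ^- 2 <= _); last by rewrite lerDr.
rewrite lef_pV2 ?posrE ?exprn_gt0 //; apply: lerXn2r => //; rewrite nnegrE ?lfabs_ge0 // ltW //.
Qed.

(** Taylor expansion of x + 1/x with the derivative taken at the centre x0 and not at x0 + s, so
    that the linear term is the same all over the ball. The remainder is quadratic in (s, t), with
    denominator of order |x0|^3. *)
Lemma klo_shift (x0 s t : F) (rho eps : R) : 0 < eps -> eps <= `|x0|_F ->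
  rho < eps -> `|s|_F <= rho -> `|t|_F <= rho ->
  `|(x0 + s + t) + (x0 + s + t)^-1 - ((x0 + s) + (x0 + s)^-1)
     - t * (1 - x0 ^- 2)|_F <= rho ^+ 2 / eps ^+ 3.
Proof.
move=> eps0 ex re hs ht.
have x0' : 0 < `|x0|_F by exact: lt_le_trans ex.
have rho0 : 0 <= rho by apply: le_trans hs; exact: lfabs_ge0.
have hst : `|s + t|_F <= rho by exact: lfabsD_le.
have x1 : `|x0 + s|_F = `|x0|_F by apply: lfabs_perturb ex _; exact: le_lt_trans re.
have x2 : `|x0 + s + t|_F = `|x0|_F.
  by rewrite -addrA; apply: lfabs_perturb ex _; exact: le_lt_trans re.
have n0 : x0 != 0 by rewrite -lfabs_gt0.
have n1 : x0 + s != 0 by rewrite -lfabs_gt0 x1.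
have n2 : x0 + s + t != 0 by rewrite -lfabs_gt0 x2.
have -> : (x0 + s + t) + (x0 + s + t)^-1 - ((x0 + s) + (x0 + s)^-1)
     - t * (1 - x0 ^- 2) =
  t * (x0 * (s + (s + t)) + s * (s + t)) / (x0 ^+ 2 * ((x0 + s) * (x0 + s + t))).
  by field; rewrite n0 n1 n2.
have h : `|x0 * (s + (s + t)) + s * (s + t)|_F <= `|x0|_F * rho.
  apply: lfabsD_le; rewrite lfabsM ler_pM ?lfabs_ge0 //; first exact: lfabsD_le.
  by apply: le_trans hs _; apply: le_trans (ltW re) ex.
rewrite lfabsM lfabsV lfabsM [`|x0 ^+ 2 * _|_F]lfabsM [`|(x0 + s) * _|_F]lfabsM.
rewrite lfabsX x1 x2 -expr2 -exprD ler_pdivrMr ?exprn_gt0 //.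
apply: le_trans (ler_pM (lfabs_ge0 _) (lfabs_ge0 _) ht h) _.
rewrite [X in X <= _](_ : _ = rho ^+ 2 * `|x0|_F); last by ring.
rewrite -[X in _ <= X]mulrA ler_wpM2l ?exprn_ge0 // mulrC ler_pdivlMr ?exprn_gt0 //.
rewrite [`|x0|_F ^+ (2 + 2)]exprS ler_pM2l //.
by apply: lerXn2r => //; rewrite nnegrE ltW.
Qed.

(** On balls of radius q of order |a|^(1/2) the quadratic remainder, divided by a, falls in the
    kernel of psi. The linear term has slope 1 - x^-2, at least (rho / r)^2 on the support, so it
    remains a nontrivial character of the ball once |a| / q is small. Hence the integral over each
    ball vanishes. *)
Lemma S_klo_eq0 (d : F) (eps r rho : R) (h : F -> C) :
  d != 0 -> 0 < eps -> 0 < r -> 0 < rho ->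
  (forall x, h x != 0 ->
    [/\ eps <= `|x|_F, `|x|_F <= r, rho < `|x - 1|_F & rho < `|x + 1|_F]) ->
  (forall x t, `|t|_F <= `|d|_F -> h (x + t) = h x) ->
  exists2 eta : R, 0 < eta & forall a, a != 0 -> `|a|_F < eta -> S (klo a h) = 0.
Proof.
move=> d0 eps0 r0 rho0 hs hd.
have d0' : 0 < `|d|_F by rewrite lfabs_gt0.
have e0' : 0 < `|e|_F by rewrite lfabs_gt0.
have p0 := unif_gt0 punif.
(* Upper bounds for q: h is constant on the balls, |x| is constant on those meeting the support, the
   support has radius at most 1 / q, and q < 1. *)
pose B := Num.min `|d|_F (Num.min (eps / 2) (Num.min r^-1 1)).
have B0 : 0 < B by rewrite !lt_min d0' divr_gt0 // invr_gt0 r0 /=.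
pose E := eps ^+ 3 * `|e|_F; have E0 : 0 < E by rewrite mulr_gt0 // exprn_gt0.
(* Squaring the required |e a| < q (rho / r)^2 and inserting q^2 > pi^2 E |a| gives |a| < G. *)
pose G := pi ^+ 2 * eps ^+ 3 * (rho / r) ^+ 4 / `|e|_F.
have G0 : 0 < G by rewrite !mulr_gt0 ?invr_gt0 ?exprn_gt0 ?divr_gt0.
exists (Num.min (B ^+ 2 / E) G).
  by rewrite lt_min G0 divr_gt0 // exprn_gt0.
move=> a a0; rewrite lt_min => /andP[aB aG].
have a0' : 0 < `|a|_F by rewrite lfabs_gt0.
have Ea0 : 0 < E * `|a|_F by rewrite mulr_gt0.
have EaB : E * `|a|_F < B ^+ 2 by rewrite mulrC -ltr_pdivlMr.
have B1 : B <= 1 by rewrite !ge_min lexx !orbT.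
have ex : exists j, (pi ^+ j) ^+ 2 <= E * `|a|_F.
  have [j hj] := unifX_small punif Ea0; exists j; apply: le_trans (ltW hj).
  by rewrite expr2 ler_piMr ?exprn_ge0 ?lfabs_ge0 // exprn_ile1 ?lfabs_ge0 // ltW // unif_lt1.
(* The least exponent is positive and is written j + 1. Its minimality gives the lower bound on q,
   which keeps q of order |a|^(1/2). *)
case: (ex_minnP ex) => -[|j] hj hmin.
  move: hj; rewrite expr0 expr1n => hj.
  have := le_lt_trans hj EaB; rewrite ltNge expr2 mulr_ile1 //; exact: ltW.
have hj' : E * `|a|_F < (pi ^+ j) ^+ 2.
  by rewrite ltNge; apply/negP => /hmin; rewrite ltnn.
set q := pi ^+ j.+1 in hj *.
have q0 : 0 < q by exact: exprn_gt0.
have qB : q < B.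
  by rewrite -(@ltr_pXn2r _ 2) ?nnegrE ?ltW // (le_lt_trans hj).
have [qd qe qr] : [/\ q <= `|d|_F, q < eps & r <= q^-1].
  move: qB; rewrite !lt_min => /and4P[h1 h2 h3 _]; split; first exact: ltW.
    by apply: lt_trans h2 _; rewrite gtr_pMr // invf_lt1 // ltr1n.
  by rewrite -(invrK r) lef_pV2 ?posrE ?invr_gt0 // ltW.
have T1 : q ^+ 2 / eps ^+ 3 <= `|e|_F * `|a|_F.
  rewrite ler_pdivrMr ?exprn_gt0 //; apply: le_trans hj _.
  by rewrite le_eqVlt; apply/orP; left; apply/eqP; rewrite /E; ring.
have T2 : `|e|_F * `|a|_F < q * (rho / r) ^+ 2.
  have ea0 : 0 <= `|e|_F * `|a|_F by rewrite mulr_ge0 ?lfabs_ge0.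
  have rr0 : 0 < (rho / r) ^+ 2 by rewrite exprn_gt0 // divr_gt0.
  have qr0 : 0 <= q * (rho / r) ^+ 2 by rewrite ltW // mulr_gt0.
  rewrite -(@ltr_pXn2r _ 2) ?nnegrE //.
  rewrite [X in _ < X]exprMn -[(rho / r) ^+ 2 ^+ 2]exprM; apply: lt_trans (_ : pi ^+ 2 * (E *
    `|a|_F) * (rho / r) ^+ 4 < _).
    rewrite expr2; move: aG; rewrite /G ltr_pdivlMr // mulrC => aG.
    rewrite [X in _ < X](_ : _ = pi ^+ 2 * eps ^+ 3 * (rho / r) ^+ 4 * (`|e|_F * `|a|_F)).
      by rewrite ltr_pM2r // mulr_gt0.
    by rewrite /E; ring.
  have -> : q ^+ 2 = pi ^+ 2 * pi ^+ j ^+ 2 by rewrite /q [pi ^+ j.+1]exprS exprMn.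
  by rewrite ltr_pM2r ?exprn_gt0 ?divr_gt0 // ltr_pM2l // exprn_gt0.
have hsch : schwartz (klo a h).
  by apply: (schwartz_klo a0 d0 eps0 (r := r)) => // x /hs[-> ->].
apply: (S_local punif dx_haar (j := j.+1) hsch).
  move=> X; rewrite mulf_eq0 negb_or vleE1 => /andP[/hs[_ xr _ _] _].
  exact: le_trans xr qr.
move=> c; set x0 := c 0 0.
have [h0|h0] := eqVneq (h x0) 0.
  apply: S_null => // X; case: ifPn => //; rewrite vleE1 !mxE => hX.
  by rewrite /klo -(subrK x0 (X 0 0)) addrC hd ?h0 ?mul0r //; exact: le_trans hX qd.
have [xe xr x1 x2] := hs _ h0.
have x0' : 0 < `|x0|_F by exact: lt_le_trans xe.
have n0 : x0 != 0 by rewrite -lfabs_gt0.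
have [|t ht nt] := @psi_nontriv_at _ _ _ punif _ e psi_nontriv ((1 - x0 ^- 2) / a) (p ^+ j.+1).
  rewrite lfabsM lfabsX lfabsM lfabsV mulrAC ltr_pdivlMr //; apply: lt_le_trans T2 _.
  rewrite mulrC ler_pM2r //.
  have -> : 1 - x0 ^- 2 = (x0 - 1) * (x0 + 1) / x0 ^+ 2 by field.
  rewrite lfabsM lfabsV lfabsX lfabsM expr_div_n; apply: ler_pM.
  - by rewrite exprn_ge0 // ltW.
  - by rewrite invr_ge0 exprn_ge0 // ltW.
  - by rewrite expr2; apply: ler_pM; rewrite ltW.
  by rewrite lef_pV2 ?posrE ?exprn_gt0 //; apply: lerXn2r => //; rewrite nnegrE ltW.
rewrite lfabsX in ht.
apply: (@S_shift_eq0 _ _ _ punif _ dx_haar 1 _ (const_mx t) (psi (t * ((1 - x0 ^- 2) / a)))) => //.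
  have [i hi] := hsch; have hk := sch_leq punif (leq_maxl i j.+1) hi.
  exists (maxn i j.+1); split=> [X|X T hT].
    by case: ifP; [move=> _; exact: hk.1|rewrite eqxx].
  have hT' : vle (pi ^+ j.+1) T.
    by apply: vle_trans hT; apply: unifX_le => //; exact: leq_maxr.
  by rewrite hk.2 // (addrAC X) (vle_addr _ hT').
have hct : vle (pi ^+ j.+1) (const_mx t : 'rV[F]_1) by rewrite vle_const1.
move=> X; rewrite (addrAC X) (vle_addr _ hct).
case: ifPn => [|_]; last by rewrite mulr0.
rewrite vleE1 /klo !mxE; set s := X 0 0 - x0 => hs'.
have -> : X 0 0 = x0 + s by rewrite addrC subrK.
rewrite (hd (x0 + s) t); last exact: le_trans ht qd.
rewrite mulrCA -psiD //; congr (_ * _); apply: psi_eq => //; apply: psi_triv.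
have -> : (x0 + s + t + (x0 + s + t)^-1) / a -
   (t * ((1 - x0 ^- 2) / a) + (x0 + s + (x0 + s)^-1) / a) =
   ((x0 + s + t) + (x0 + s + t)^-1 - ((x0 + s) + (x0 + s)^-1) - t * (1 - x0 ^- 2)) / a.
  by ring.
rewrite lfabsM lfabsV ler_pdivrMr //; apply: le_trans T1.
exact: (klo_shift eps0 xe qe hs' ht).
Qed.

Lemma schwartz_klo_ball (a c : F) m : a != 0 -> `|c|_F = 1 -> (0 < m)%N ->
  schwartz (klo a (fun x => (`|x + c|_F <= pi ^+ m)%R%:R)).
Proof.
move=> a0 c1 m0.
have m1 : pi ^+ m < 1 by rewrite exprn_ilt1 ?lfabs_ge0 ?unif_lt1 // -lt0n.
apply: (@schwartz_klo a (p ^+ m) 1 1) => // [|x|x t].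
- by rewrite expf_neq0 // unif_neq0.
- case: (boolP (_ <= _)) => [h _|]; last by rewrite eqxx.
  suff -> : `|x|_F = 1 by rewrite lexx.
  rewrite -(addrK c x) addrC lfabs_add_eq ?lfabsN c1 //; exact: le_lt_trans h m1.
rewrite lfabsX addrAC => ht; congr (_%:R); congr nat_of_bool.
by apply/idP/idP => h; [rewrite -(addrK t (x + c)) lfabsB_le|rewrite lfabsD_le].
Qed.

(** Subtracting from h its values at 1 and -1 times the indicators of the balls of radius pi^m
    leaves a function that vanishes near both critical points. Since |p^m| < |2|, the two balls are
    disjoint and the corrections do not interfere; since m > 0, they consist of units. *)
Lemma S_klo_germ (d : F) (eps r : R) (h : F -> C) m :
  d != 0 -> 0 < eps -> 0 < r -> (0 < m)%N -> `|p ^+ m|_F < `|2|_F ->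
  (forall x, h x != 0 -> eps <= `|x|_F <= r) ->
  (forall x t, `|t|_F <= `|d|_F -> h (x + t) = h x) ->
  exists2 eta : R, 0 < eta & forall a, a != 0 -> `|a|_F < eta -> S (klo a h) =
   h 1 * S (klo a (fun x => (`|x - 1|_F <= pi ^+ m)%R%:R)) +
   h (-1) * S (klo a (fun x => (`|x + 1|_F <= pi ^+ m)%R%:R)).
Proof.
move=> d0 eps0 r0 m0 hm hs hd.
have d0' : 0 < `|d|_F by rewrite lfabs_gt0.
rewrite lfabsX in hm.
have [j hj] := unifX_small punif d0'.
pose n := maxn j m; pose d2 := p ^+ n.
have d20 : d2 != 0 by rewrite expf_neq0 // unif_neq0.
have d2d : `|d2|_F <= `|d|_F.
  by rewrite lfabsX; apply: le_trans (ltW hj); apply: unifX_le => //; exact: leq_maxl.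
have d2m : `|d2|_F <= pi ^+ m by rewrite lfabsX; apply: unifX_le => //; exact: leq_maxr.
have m1 : pi ^+ m < 1.
  by rewrite exprn_ilt1 ?lfabs_ge0 ?unif_lt1 // -lt0n.
have bs (c x : F) : `|c|_F = 1 -> `|x + c|_F <= pi ^+ m -> `|x|_F = 1.
  move=> c1 h1; rewrite -(addrK c x) addrC lfabs_add_eq ?lfabsN c1 //.
  exact: le_lt_trans h1 m1.
have bd (c x t : F) : `|t|_F <= `|d2|_F ->
    (`|x + t + c|_F <= pi ^+ m) = (`|x + c|_F <= pi ^+ m).
  move=> ht; have ht' := le_trans ht d2m; rewrite addrAC.
  by apply/idP/idP => h1; [rewrite -(addrK t (x + c)) lfabsB_le|rewrite lfabsD_le].
(* The ball is centred at -c, so [b (-1)] belongs to the critical point 1. *)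
pose b c x : C := (`|x + c|_F <= pi ^+ m)%R%:R.
pose h2 x := h x + (- h 1 * b (-1) x + - h (-1) * b 1 x).
have h2d x t : `|t|_F <= `|d2|_F -> h2 (x + t) = h2 x.
  by move=> ht; rewrite /h2 /b !bd // hd //; exact: le_trans d2d.
have N1 : `|- (1 : F)|_F = 1 by rewrite lfabsN lfabs1.
pose eps' := Num.min eps 1; pose r' := Num.max r 1.
have eps'0 : 0 < eps' by rewrite lt_min eps0 ltr01.
have r'0 : 0 < r' by rewrite lt_max r0.
have h2s x : h2 x != 0 -> [/\ eps' <= `|x|_F, `|x|_F <= r',
    `|d2|_F < `|x - 1|_F & `|d2|_F < `|x + 1|_F].
  move=> hx; have bz c : `|c|_F = 1 -> b c x != 0 -> `|x|_F = 1.
    by rewrite /b => c1; case: (boolP (_ <= _)) => [/(bs _ _ c1)//|]; rewrite eqxx.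
  have [h1 h1'] : eps' <= `|x|_F /\ `|x|_F <= r'.
    rewrite ge_min le_max.
    have [hx0|/hs/andP[-> ->]//] := eqVneq (h x) 0.
    have [b1|/(bz _ N1) ->] := eqVneq (b (-1) x) 0; last by rewrite lexx !orbT.
    have [b2|/(bz _ (lfabs1 F)) ->] := eqVneq (b 1 x) 0; last by rewrite lexx !orbT.
    by case/eqP: hx; rewrite /h2 hx0 b1 b2 !mulr0 !addr0.
  split=> //; rewrite ltNge; apply/negP => hx1; case/eqP: hx; rewrite /h2 /b.
    have -> : h x = h 1 by rewrite -(subrK 1 x) addrC hd //; exact: le_trans d2d.
    rewrite (le_trans hx1 d2m) (_ : (`|x + 1|_F <= _) = false) ?mulr1 ?mulr0 ?addr0 ?subrr //.
    apply/negbTE; rewrite -ltNge (_ : x + 1 = 2 + (x - 1)); last by ring.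
    by rewrite lfabs_add_eq //; apply: le_lt_trans hx1 _; exact: le_lt_trans hm.
  have -> : h x = h (-1) by rewrite -(addrK 1 x) addrC hd //; exact: le_trans d2d.
  rewrite (le_trans hx1 d2m) (_ : (`|x - 1|_F <= _) = false) ?mulr1 ?mulr0 ?add0r ?subrr //.
  apply/negbTE; rewrite -ltNge (_ : x - 1 = - 2 + (x + 1)); last by ring.
  by rewrite lfabs_add_eq ?lfabsN //; apply: le_lt_trans hx1 _; exact: le_lt_trans hm.
have d20' : 0 < `|d2|_F by rewrite lfabs_gt0.
have [eta eta0 heta] := S_klo_eq0 d20 eps'0 r'0 d20' h2s h2d.
exists eta => // a a0 /(heta a a0) h0.
have b1 := schwartz_klo_ball a0 N1 m0.
have b2 := schwartz_klo_ball a0 (lfabs1 F) m0.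
have hsch : schwartz (klo a h) by exact: (schwartz_klo a0 d0 eps0 hs hd).
have scal c f : schwartz f -> schwartz (fun X : 'rV[F]_1 => c * f X).
  move=> [i hi]; exists i; split=> [x|x t ht]; last by rewrite hi.2.
  by rewrite mulf_eq0 negb_or => /andP[_ /hi.1].
have hadd f g : schwartz f -> schwartz g -> schwartz (fun X : 'rV[F]_1 => f X + g X).
  by move=> hf hg; have [i [i1 i2]] := sch2 punif hf hg; exists i; exact: schD.
have e2 : klo a h2 = fun X => klo a h X +
   (- h 1 * klo a (b (-1)) X + - h (-1) * klo a (b 1) X).
  by apply/funext => X; rewrite /klo /h2; ring.
move: h0; rewrite e2 S_add //; last by apply: hadd; exact: scal.
rewrite S_add //; [|exact: scal|exact: scal].
rewrite !S_scale // => /eqP; rewrite addr_eq0 => /eqP ->.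
by rewrite !mulNr opprD !opprK.
Qed.

End OneDimensional.

(** * Test functions and uniform levels *)

Section TestFunctions.
Variables (R : realType) (F : nonArchLocalFieldType R) (p : F).
Hypothesis punif : uniformizer p.
Local Notation "`| x |_F" := (@lfabs R F x) (format "`| x |_F").
Local Notation pi := (`|p|_F).
Local Notation C := R[i].

(** Each coordinate of an ultrafilter converges by compactness of balls of F; finitely many
    coordinates can be controlled together. *)
Lemma compact_vle n j : compact [set v : 'rV[F]_n | vle (pi ^- j) v].
Proof.
rewrite compact_ultra => U UU UB; have PU : ProperFilter U by exact: ultra_proper.
have hl (i : 'I_n) : exists l : F, `|l|_F <= pi ^- j /\ (fun v : 'rV[F]_n => v 0 i) @ U --> l.
  have := @compact_lfabs_ball R F p punif j.
  rewrite compact_ultra => /(_ ((fun v : 'rV[F]_n => v 0 i) @ U)) h.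
  have [||l [l1 l2]] := h; last by exists l.
    constructor; first exact: fmap_proper_filter.
    move=> G PG UG; apply/funext => A; apply/propext; split=> [GA|]; last exact: UG.
    have [//|nA] := in_ultra_setVsetC ((fun v : 'rV[F]_n => v 0 i) @^-1` A) UU.
    exfalso; apply: (@filter_not_empty _ G PG).
    have : G (A `&` ~` A) by apply: filterI => //; exact: UG.
    by rewrite setICr.
  suff : U [set v : 'rV[F]_n | `|v 0 i|_F <= pi ^- j] by [].
  by apply: filterS UB => v /= /forallP/(_ i).
have /choice[l hl'] := hl.
exists (\row_i l i); split=> /=.
  by apply/vleP => i; rewrite mxE; exact: (hl' i).1.
move=> A /nbhs_lfabs_rV[e e0 he].
have : U [set v : 'rV[F]_n | forall i, `|v 0 i - l i|_F < e].
  apply: filter_forall => i.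
  have /(hl' i).2 : nbhs (l i) [set y | `|y - l i|_F < e].
    by apply/nbhs_lfabsP; exists e.
  by [].
by apply: filterS => v hv; apply: he => i; rewrite mxE.
Qed.

Lemma nbhs_lfabs_prod n (y : F * 'rV[F]_n) (A : set (F * 'rV[F]_n)) :
  nbhs y A <-> exists2 e : R, 0 < e & forall z : F * 'rV[F]_n,
    `|z.1 - y.1|_F < e -> (forall i, `|z.2 0 i - y.2 0 i|_F < e) -> A z.
Proof.
split=> [[[P Q] /= [/nbhs_lfabsP[e1 e10 h1] /nbhs_lfabs_rV[e2 e20 h2]] PQA]|[e e0 he]].
  exists (Num.min e1 e2); first by rewrite lt_min e10.
  move=> z z1 z2; apply: PQA; split=> /=.
    by apply: h1; move: z1; rewrite lt_min => /andP[].
  by apply: h2 => i; move: (z2 i); rewrite lt_min => /andP[].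
exists ([set a | `|a - y.1|_F < e],
        [set v : 'rV[F]_n | forall i, `|v 0 i - y.2 0 i|_F < e]) => /=.
  by split; [apply/nbhs_lfabsP; exists e|apply/nbhs_lfabs_rV; exists e].
by move=> z [/= z1 z2]; exact: he.
Qed.

(** Compactness makes the local bounds and scales uniform: near each point of the closed support a
    condition depending on N holds for all large N, hence it holds on the whole support for one
    N. *)
Lemma test_function_uniform n (phi : F * 'rV[F]_n -> C) : test_function phi ->
  exists j, (forall a v, phi (a, v) != 0 -> `|a|_F <= pi ^- j /\ vle (pi ^- j) v) /\
    (forall a v b t, `|b|_F <= pi ^+ j -> vle (pi ^+ j) t ->
      phi (a + b, v + t) = phi (a, v)).
Proof.
move=> [lc /compact_near_coveringP cK]; set K := closure _ in cK.
have sK y : phi y != 0 -> K y by move=> h; exact: subset_closure.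
have [N1 _ /(_ N1 (leqnn _)) hN1] : \forall N \near \oo, K `<=` (fun N (y : F * 'rV[F]_n) =>
    `|y.1|_F <= pi ^- N /\ vle (pi ^- N) y.2) N.
  apply: cK => y _; have [k hk] := unifVX_large punif `|y.1|_F.
  have [k' hk'] := vle_ex punif y.2.
  exists ([set z : F * 'rV[F]_n | `|z.1 - y.1|_F < 1 /\ forall i, `|z.2 0 i - y.2 0 i|_F < 1],
    [set N | (maxn k k' <= N)%N]) => /=.
    split; last by exists (maxn k k').
    by apply/nbhs_lfabs_prod; exists 1.
  move=> [z N] /= [[z1 z2] hN]; split.
    rewrite -(subrK y.1 z.1) lfabsD_le //.
      by apply: le_trans (ltW z1) _; exact: unifVX_ge1.
    apply: le_trans hk _; apply: unifVX_le => //; exact: leq_trans (leq_maxl _ _) hN.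
  rewrite -(subrK y.2 z.2) vleD //.
    apply/vleP => i; rewrite !mxE; apply: le_trans (ltW (z2 i)) _; exact: unifVX_ge1.
  apply: vle_trans hk'; apply: unifVX_le => //; exact: leq_trans (leq_maxr _ _) hN.
have [N2 _ /(_ N2 (leqnn _)) hN2] : \forall N \near \oo, K `<=` (fun N (y : F * 'rV[F]_n) =>
    forall b t, `|b|_F <= pi ^+ N -> vle (pi ^+ N) t ->
      phi (y.1 + b, y.2 + t) = phi y) N.
  apply: cK => y _; have /nbhs_lfabs_prod[e e0 he] := lc y.
  have [k hk] := unifX_small punif e0.
  exists ([set z : F * 'rV[F]_n | `|z.1 - y.1|_F < e /\ forall i, `|z.2 0 i - y.2 0 i|_F < e],
    [set N | (k <= N)%N]) => /=.
    by split; [apply/nbhs_lfabs_prod; exists e|exists k].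
  move=> [z N] /= [[z1 z2] hN] b t hb /vleP ht.
  have hNe : pi ^+ N < e by apply: le_lt_trans hk; exact: unifX_le.
  rewrite (he z) // he //=.
    by rewrite addrAC lfabsD_lt // (le_lt_trans hb).
  by move=> i; rewrite mxE addrAC lfabsD_lt // (le_lt_trans (ht i)).
exists (maxn N1 N2); split=> [a v /sK/hN1[/= h1 h2]|a v b t hb ht].
  split; first by apply: le_trans h1 _; apply: unifVX_le => //; exact: leq_maxl.
  by apply: vle_trans h2; apply: unifVX_le => //; exact: leq_maxl.
have hb' : `|b|_F <= pi ^+ N2 by apply: le_trans hb _; apply: unifX_le => //; exact: leq_maxr.
have ht' : vle (pi ^+ N2) t by apply: vle_trans ht; apply: unifX_le => //; exact: leq_maxr.
have [h0|/sK/hN2 h] := eqVneq (phi (a, v)) 0; last exact: h.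
(* Invariance is known at points of [K] only. If phi vanishes at (a, v) but not at the translate, it
   is applied at the translate with the opposite increment. *)
have [//|/sK/hN2 h] := eqVneq (phi (a + b, v + t)) 0; first by rewrite h0.
have := h (- b) (- t); rewrite /= !addrK lfabsN vleN => -> //.
Qed.

Lemma test_functionI n (phi : F * 'rV[F]_n -> C) j :
  locally_constant phi ->
  (forall a v, phi (a, v) != 0 -> `|a|_F <= pi ^- j /\ vle (pi ^- j) v) ->
  test_function phi.
Proof.
move=> lc hs; split=> //.
apply: (@subclosed_compact _ _ ([set a : F | `|a|_F <= pi ^- j] `*` [set v : 'rV[F]_n | vle (pi
  ^- j) v])).
- exact: closed_closure.
- by apply: compact_setX; [exact: compact_lfabs_ball|exact: compact_vle].
move=> [a v] hav; have : nbhs (a, v) [set z : F * 'rV[F]_n |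
    `|z.1 - a|_F < 1 /\ forall i, `|z.2 0 i - v 0 i|_F < 1].
  by apply/nbhs_lfabs_prod; exists 1.
move=> /hav[[b w] /= [/hs[h1 h2] [h3 h4]]]; split=> /=.
  rewrite -(subrK b a) lfabsD_le // lfabsBC (le_trans (ltW h3)) //; exact: unifVX_ge1.
rewrite -(subrK w v) vleD //; apply/vleP => i; rewrite !mxE lfabsBC.
by apply: le_trans (ltW (h4 i)) _; exact: unifVX_ge1.
Qed.

Lemma test_function_integers :
  test_function (fun x : F => if `|x|_F <= 1 then 1 else 0 : C).
Proof.
split=> [x|].
  apply/nbhs_lfabsP; exists 1 => // y hy /=; congr (if _ then _ else _).
  apply/idP/idP => h; first by rewrite -(subrK y x) lfabsD_le // lfabsBC ltW.
  by rewrite -(subrK x y) lfabsD_le // ltW.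
apply: (@subclosed_compact _ _ [set a : F | `|a|_F <= pi ^- 0]).
- exact: closed_closure.
- exact: compact_lfabs_ball.
move=> a ha; have : nbhs a [set z : F | `|z - a|_F < 1] by apply/nbhs_lfabsP; exists 1.
move=> /ha[b /= []]; case: ifPn => [h _|]; last by rewrite eqxx.
by move=> hb; rewrite expr0 invr1 -(subrK b a) lfabsD_le // lfabsBC ltW.
Qed.

Lemma nbhs_units (a : units F) (A : set (units F)) :
  nbhs a A <-> exists2 e : R, 0 < e &
    forall b : units F, `|\val b - \val a|_F < e -> A b.
Proof.
split.
  move=> [B [[W oW <-] Wa WA]].
  have /nbhs_lfabsP[e e0 he] : nbhs (\val a : F) W by exact: open_nbhs_nbhs.
  by exists e => // b hb; apply: WA; exact: he.
move=> [e e0 he].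
apply: (@filterS _ (nbhs a) _ (set_val @^-1` [set y : F | `|y - \val a|_F < e])).
  by move=> b hb; exact: he.
apply: (@initial_continuous _ _ (set_val : units F -> F) a).
by apply/nbhs_lfabsP; exists e.
Qed.

(** The absolute value is locally constant on F^x, so on a compact set it is bounded above and away
    from 0. *)
Lemma test_function_units (Phi : units F -> C) : test_function Phi ->
  exists j, forall a : units F, Phi a != 0 -> pi ^+ j <= `|\val a|_F <= pi ^- j.
Proof.
move=> [lc /compact_near_coveringP cK]; set K := closure _ in cK.
have sK y : Phi y != 0 -> K y by move=> h; exact: subset_closure.
have [N _ /(_ N (leqnn _)) hN] : \forall N \near \oo, K `<=` (fun N (a : units F) =>
    pi ^+ N <= `|\val a|_F <= pi ^- N) N.
  apply: cK => a _; have a0 : 0 < `|\val a|_F.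
    by rewrite lfabs_gt0; have := set_valP a.
  have [k hk] := unifX_small punif a0; have [k' hk'] := unifVX_large punif `|\val a|_F.
  exists ([set b : units F | `|\val b - \val a|_F < `|\val a|_F],
    [set N | (maxn k k' <= N)%N]) => /=.
    split; last by exists (maxn k k').
    by apply/nbhs_units; exists `|\val a|_F.
  move=> [b N] /= [hb hN].
  rewrite -(subrK (\val a) (\val b)) addrC lfabs_add_eq //; apply/andP; split.
    apply: le_trans (ltW hk); apply: unifX_le => //; exact: leq_trans (leq_maxl _ _) hN.
  apply: le_trans hk' _; apply: unifVX_le => //; exact: leq_trans (leq_maxr _ _) hN.
by exists N => a /sK/hN.
Qed.

End TestFunctions.

(** * The volume of O for the self-dual measure *)

Section SelfDual.
Variables (R : realType) (F : nonArchLocalFieldType R) (p : F).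
Hypothesis punif : uniformizer p.
Variable psi : F -> R[i].
Hypothesis psi_char : additive_character psi.
Variable dx : {measure set (borel (0 : F)) -> \bar R}.
Hypothesis dx_sd : self_dual psi dx.
Local Notation "`| x |_F" := (@lfabs R F x) (format "`| x |_F").
Local Notation pi := (`|p|_F).
Local Notation C := R[i].
Local Notation schwartz := (@schwartz R F p _).
Local Notation S := (@schwartz_int R F p dx _).
Local Notation vol := (@vol R F dx).
Variable e : F.
Hypothesis e_neq0 : e != 0.
Hypothesis psi_triv : forall x, `|x|_F <= `|e|_F -> psi x = 1.
Hypothesis psi_nontriv : exists x, pi * `|x|_F <= `|e|_F /\ psi x != 1.

Lemma cintegral_schwartz_int (f : F -> C) : schwartz (fun X : 'rV[F]_1 => f (X 0 0)) ->
  cintegral dx setT f = S (fun X : 'rV[F]_1 => f (X 0 0)).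
Proof.
move=> [j hf]; rewrite (SE punif dx_sd.1 hf) -(cintegral1_net_sum punif dx_sd.1 hf).
by congr cintegral; apply/funext => x; rewrite mxE.
Qed.

(** The indicator of O has Fourier transform vol(O) times the indicator of e O, whose integral is
    |e| vol(O)^2. Fourier inversion at 0 equates this with 1. *)
Lemma self_dual_vol : `|e|_F * vol 1 * vol 1 = 1.
Proof.
have haar := dx_sd.1.
pose f (x : F) : C := if `|x|_F <= 1 then 1 else 0.
have ff y : fourier dx psi f y = (vol 1)%:C%C * (`|y|_F <= `|e|_F)%R%:R.
  have sch1 := @schwartz_ball R F p punif 1 1 (oner_neq0 F).
  have hl : locunif p (fun X : 'rV[F]_1 => X 0 0 * y).
    move=> r d d0; have y1 : 0 < `|y|_F + 1 by rewrite ltr_wpDl ?lfabs_ge0.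
    have [j hj] := unifX_small punif (divr_gt0 d0 y1).
    exists j => X T _; rewrite vleE1 mxE mulrDl (addrC (X 0 0 * y)) addrK lfabsM => hT.
    apply: le_trans (ler_wpM2r (lfabs_ge0 y) hT) _.
    move: hj; rewrite ltr_pdivlMr // => /ltW; apply: le_trans.
    by rewrite ler_wpM2l ?exprn_ge0 ?lfabs_ge0 // lerDl.
  have hsch := schwartz_psi punif psi_char e_neq0 psi_triv 1 sch1 hl.
  have eg : (fun X : 'rV[F]_1 => (vle `|1|_F X)%:R * psi (X 0 0 * y / 1)) =
      fun X : 'rV[F]_1 => f (X 0 0) * psi (X 0 0 * y).
    by apply/funext => X; rewrite vleE1 lfabs1 divr1 /f; case: ifP.
  rewrite /fourier cintegral_schwartz_int -eg //.
  case: (boolP (_ <= _)) => hy; rewrite ?mulr1 ?mulr0.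
    transitivity (S (fun X : 'rV[F]_1 => (vle `|1|_F X)%:R : C)).
      congr S; apply/funext => X; rewrite vleE1 lfabs1.
      have [hX|_] := boolP (_ <= _); last by rewrite mul0r.
      rewrite psi_triv ?mulr1 // divr1 lfabsM; apply: le_trans hy.
      by rewrite ler_piMl ?lfabs_ge0.
    by rewrite S_ball ?oner_neq0 // lfabs1 mul1r expr1.
  rewrite -ltNge in hy.
  have [|t ht nt] := @psi_nontriv_at _ _ _ punif _ e psi_nontriv y 1.
    by rewrite mulr1.
  apply: (@S_shift_eq0 _ _ _ punif _ haar 1 _ (const_mx t) (psi (t * y))) => // X.
  rewrite vle_addr ?vle_const1 // mxE [const_mx _ _ _]mxE !divr1 mulrDl psiD //.
  by ring.
have [_ /(_ f (test_function_integers punif) 0)] := dx_sd.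
rewrite oppr0 /f lfabs0 ler01 /fourier.
have sch2 := @schwartz_ball R F p punif 1 e e_neq0.
have eg : (fun X : 'rV[F]_1 => (vol 1)%:C%C * (vle `|e|_F X)%:R) =
   fun X : 'rV[F]_1 => fourier dx psi f (X 0 0) * psi (X 0 0 * 0).
  by apply/funext => X; rewrite ff mulr0 psi0 // mulr1 vleE1.
rewrite (@cintegral_schwartz_int (fun x => fourier dx psi f x * psi (x * 0))) -eg.
  rewrite S_scale // S_ball // expr1 -rmorphM => -[h].
  by rewrite -[RHS]h; ring.
have [i hi] := sch2; exists i; split=> [x|x t ht]; last by rewrite hi.2.
by rewrite mulf_eq0 negb_or => /andP[_ /hi.1].
Qed.

End SelfDual.

(** * Explicit determinants and Pfaffians *)

Section Entries.
Variable F : fieldType.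

(* Matrix entries with natural number indices, so that closed indices compute. *)
Definition mn m n (A : 'M[F]_(m, n)) (i j : nat) : F :=
  if insub i is Some i' then if insub j is Some j' then A i' j' else 0 else 0.

Lemma mnE m n (A : 'M[F]_(m, n)) (i : 'I_m) (j : 'I_n) : A i j = mn A i j.
Proof. by rewrite /mn !valK. Qed.

Lemma mn_lsubmx m n (v : 'rV[F]_(m + n)) i : (i < m)%N ->
  mn (lsubmx v) 0 i = mn v 0 i.
Proof.
move=> im; rewrite -[X in mn (lsubmx _) X _]/(nat_of_ord (0 : 'I_1)).
by rewrite -[i in LHS]/(nat_of_ord (Ordinal im)) -(mnE (lsubmx v)) mxE mnE.
Qed.

Lemma mn_rsubmx m n (v : 'rV[F]_(m + n)) i : mn (rsubmx v) 0 i = mn v 0 (m + i).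
Proof.
have [i_n|ni] := ltnP i n.
  rewrite -[X in mn (rsubmx _) X _]/(nat_of_ord (0 : 'I_1)).
  rewrite -[i in LHS]/(nat_of_ord (Ordinal i_n)) -(mnE (rsubmx v)) mxE mnE.
  by [].
rewrite /mn; case: insub => // a; rewrite !insubF //; apply/negbTE; rewrite -leqNgt //.
by rewrite leq_add2l.
Qed.

Lemma mn_row n (h : nat -> F) j : (j < n)%N -> mn (\row_(i < n) h i) 0 j = h j.
Proof.
move=> jn; rewrite -[X in mn _ X _]/(nat_of_ord (0 : 'I_1)).
by rewrite -[j in LHS]/(nat_of_ord (Ordinal jn)) -mnE mxE.
Qed.

Lemma mn0 m n i j : mn (0 : 'M[F]_(m, n)) i j = 0.
Proof. by rewrite /mn; case: insub => // a; case: insub => // b; rewrite mxE. Qed.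

Lemma eq_mn_rowP n (u v : 'rV[F]_n) :
  (forall j, (j < n)%N -> mn u 0 j = mn v 0 j) -> u = v.
Proof. by move=> h; apply/rowP => i; rewrite !mnE h. Qed.

Lemma mn_alt n (v : 'rV[F]_('C(n, 2))) i j : (i < n)%N -> (j < n)%N ->
  mn (alt_mx v) i j = if (i < j)%N then mn v 0 ('C(j, 2) + i)
    else if (j < i)%N then - mn v 0 ('C(i, 2) + j) else 0.
Proof.
have key (b : bool) (t : nat) :
    \sum_(k < 'C(n, 2) | b && (k == t :> nat)%N) v 0 k = if b then mn v 0 t else 0.
  case: b => /=; last by rewrite big_pred0.
  rewrite /mn (insubT (fun i => i < 1)%N (ltn0Sn 0)); case: insubP => [k _ kt|nt].
    rewrite (big_pred1 k) => [|k']; first by congr (v _ _); exact: val_inj.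
    by rewrite -kt; apply/eqP/eqP => [/val_inj|->].
  by rewrite big_pred0 // => k; apply: contraNF nt => /eqP <-.
move=> hi hj; rewrite -[i in LHS]/(nat_of_ord (Ordinal hi)) -[j in LHS]/(nat_of_ord (Ordinal hj)).
rewrite -(mnE (alt_mx v)) mxE !key /=.
by case: (ltngtP i j) => _; rewrite ?subr0 ?sub0r ?subrr.
Qed.

Lemma det2E (A : 'M[F]_2) : \det A = A 0 0 * A 1 1 - A 0 1 * A 1 0.
Proof.
rewrite (expand_det_row _ 0) !big_ord_recl big_ord0 /cofactor !det_mx11 !mxE !mnE /=.
rewrite /bump /= !exprS !expr0.
ring.
Qed.

Lemma det3E (A : 'M[F]_3) : \det A =
  mn A 0 0 * (mn A 1 1 * mn A 2 2 - mn A 1 2 * mn A 2 1)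
  - mn A 0 1 * (mn A 1 0 * mn A 2 2 - mn A 1 2 * mn A 2 0)
  + mn A 0 2 * (mn A 1 0 * mn A 2 1 - mn A 1 1 * mn A 2 0).
Proof.
rewrite (expand_det_row _ 0) !big_ord_recl big_ord0 /cofactor !det2E !mxE !mnE /=.
rewrite /bump /= !exprS !expr0.
ring.
Qed.

Lemma pfaffian2E (A : 'M[F]_4) : @pfaffian F 2 A =
  mn A 0 1 * mn A 2 3 - mn A 0 2 * mn A 1 3 + mn A 0 3 * mn A 1 2.
Proof.
rewrite /pfaffian !big_ord_recl !big_ord0 /= !mxE !mnE /= /bump /= !exprS !expr0.
ring.
Qed.

Lemma pfaffian3E (A : 'M[F]_6) : @pfaffian F 3 A =
  let a := mn A in
  a 0%N 1%N * (a 2%N 3%N * a 4%N 5%N - a 2%N 4%N * a 3%N 5%N + a 2%N 5%N * a 3%N 4%N)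
  - a 0%N 2%N * (a 1%N 3%N * a 4%N 5%N - a 1%N 4%N * a 3%N 5%N + a 1%N 5%N * a 3%N 4%N)
  + a 0%N 3%N * (a 1%N 2%N * a 4%N 5%N - a 1%N 4%N * a 2%N 5%N + a 1%N 5%N * a 2%N 4%N)
  - a 0%N 4%N * (a 1%N 2%N * a 3%N 5%N - a 1%N 3%N * a 2%N 5%N + a 1%N 5%N * a 2%N 3%N)
  + a 0%N 5%N * (a 1%N 2%N * a 3%N 4%N - a 1%N 3%N * a 2%N 4%N + a 1%N 4%N * a 2%N 3%N).
Proof.
rewrite /pfaffian !big_ord_recl !big_ord0 /= !mxE !mnE /= /bump /= !exprS !expr0.
ring.
Qed.

End Entries.

(** * Coordinates in which the phase has its normal form *)

Section Charts.
Variables (R : realType) (F : nonArchLocalFieldType R).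
Local Notation "`| x |_F" := (@lfabs R F x) (format "`| x |_F").

(* Coordinates (x, y, u, v) of J up to signs, in which the phase is the cubic
   form x (1 + u.v) - u.tu(y) - v.sg(y). *)
Definition signed_perm m n (idx : 'I_n -> 'I_m) (sgn : 'I_n -> bool)
    (w : 'rV[F]_m) : 'rV[F]_n := \row_i ((-1) ^+ sgn i * w 0 (idx i)).

(** Later arguments are uniform in the algebra and see it through a chart. The field [cone] puts the
    identity at the parameter x = 1 of the critical curve (x, 0, sg(0) / x, tu(0) / x); its negative
    is then at x = -1. *)
Record chart (J : cubicJordan F) := Chart {
  ck : nat;
  cl : nat;
  csg : 'rV[F]_(ck + ck) -> 'rV[F]_cl;
  ctu : 'rV[F]_(ck + ck) -> 'rV[F]_cl;
  ci0 : 'I_cl;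
  cidx : 'I_(jdim J) -> 'I_(1 + ((ck + ck) + (cl + cl)));
  csgn : 'I_(jdim J) -> bool;
  cdim : jdim J = (1 + ((ck + ck) + (cl + cl)))%N;
  cidx_inj : injective cidx;
  csg_pol : forall i, pol 2 (fun y => csg y 0 i);
  ctu_pol : forall i, pol 2 (fun y => ctu y 0 i);
  cquad : forall y, 1 + dot (csg y) (ctu y) + dot (lsubmx y) (rsubmx y) = 0;
  cunit : forall y, csg y 0 ci0 - ctu y 0 ci0 + dot (csg y) (ctu y) = 1;
  cphase : forall w, jtrace (signed_perm cidx csgn w) -
    jnorm (signed_perm cidx csgn w) = cubic csg ctu w;
  cone : signed_perm cidx csgn (pack 1 0 (row_mx (csg 0) (ctu 0))) = jone J }.

Section Table.
Variables (m n : nat) (tab : seq (bool * nat)).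
Hypothesis tab_ok : [&& size tab == n, uniq (unzip2 tab) & all (fun c => c.2 < m)%N tab].

Lemma tab_lt (i : 'I_n) : ((nth (false, 0) tab i).2 < m)%N.
Proof.
have /and3P[/eqP st _ /all_nthP] := tab_ok; apply; by rewrite st.
Qed.

Definition tab_idx (i : 'I_n) : 'I_m := Ordinal (tab_lt i).
Definition tab_sgn (i : 'I_n) : bool := (nth (false, 0) tab i).1.

Lemma tab_idx_inj : injective tab_idx.
Proof.
move=> i j /(congr1 val) /= h; have /and3P[/eqP st ut _] := tab_ok.
have hk (k : 'I_n) : (nth (false, 0) tab k).2 = nth 0%N (unzip2 tab) k.
  by rewrite (nth_map (false, 0%N)) // st.
apply/ord_inj/eqP; rewrite -(nth_uniq 0%N _ _ ut) ?size_map ?st ?ltn_ord //; apply/eqP.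
by rewrite -!hk.
Qed.

Lemma mn_signed_perm (w : 'rV[F]_m) j : (j < n)%N ->
  mn (signed_perm tab_idx tab_sgn w) 0 j =
  let c := nth (false, 0%N) tab j in if c.1 then - mn w 0 c.2 else mn w 0 c.2.
Proof.
move=> jn; rewrite -[X in mn (signed_perm _ _ _) X _]/(nat_of_ord (0 : 'I_1)).
rewrite -[j in LHS]/(nat_of_ord (Ordinal jn)) -mnE mxE mnE /= /tab_sgn /=.
by case: (nth _ _ _).1; rewrite ?mulN1r ?mul1r.
Qed.

End Table.

(** The coordinates are listed as functions and the conjunction over the list unfolds by
    computation, so that [pol_tac] can treat them one by one. *)
Lemma pol_nth m (gs : seq ('rV[F]_m -> F)) n (i : 'I_n) :
  foldr (fun g P => pol 2 g /\ P) True gs ->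
  pol 2 (fun y => (\row_(i < n) nth (fun=> 0) gs i y) 0 i).
Proof.
move=> h; have -> : (fun y => (\row_(i < n) nth (fun=> 0) gs i y) 0 i) = nth (fun=> 0) gs i.
  by apply/funext => y; rewrite mxE.
move: (nat_of_ord i) => {}i; elim: gs i h => [|g gs ih] [|i] /=.
- by move=> _; apply: pol_cst; rewrite lfabs0.
- by move=> _; apply: pol_cst; rewrite lfabs0.
- by case.
by move=> [_ /ih].
Qed.

Lemma pol_mn2 m i j : pol 2 (fun y : 'rV[F]_m => mn y 0 i * mn y 0 j).
Proof.
have h k : pol 1 (fun y : 'rV[F]_m => mn y 0 k).
  rewrite /mn (insubT (fun i => i < 1)%N (ltn0Sn 0)).
  case: insubP => [k' _ _|_]; first exact: pol_coord.
  by apply: pol_cst; rewrite lfabs0.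
exact: (@polM _ _ _ 1 1).
Qed.

Lemma pol_one m : pol 2 (fun _ : 'rV[F]_m => 1).
Proof. by apply: pol_cst; rewrite lfabs1. Qed.

Lemma pol_zero m : pol 2 (fun _ : 'rV[F]_m => 0).
Proof. by apply: pol_cst; rewrite lfabs0. Qed.

End Charts.

Ltac pol_tac := rewrite /=; repeat first [exact: I | refine (conj _ _);
  [repeat first [exact: pol_mn2 | exact: pol_one | exact: pol_zero | apply: polB
                | apply: polN | apply: polD] | ]].

Lemma nth_allpairs_mul (S T U : Type) (f : S -> T -> U) x0 y0 z0 s t i j :
  (i < size s)%N -> (j < size t)%N ->
  nth z0 [seq f x y | x <- s, y <- t] (i * size t + j) = f (nth x0 s i) (nth y0 t j).
Proof.
elim: s i => [|x s ih] [|i] //= hi hj; rewrite nth_cat size_map.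
  by rewrite mul0n add0n hj (nth_map y0).
by rewrite mulSn -addnA ltnNge leq_addr /= addKn ih.
Qed.

(** [mxvec] follows the enumeration of pairs, which is lexicographic: matrices are read row by row,
    as the tables assume. *)
Lemma mxvec_index_val m n (i : 'I_m) (j : 'I_n) :
  mxvec_index i j = (i * n + j)%N :> nat.
Proof.
have hk : (i * n + j < #|{: 'I_m * 'I_n}|)%N.
  rewrite card_prod !card_ord; apply: (@leq_trans (i.+1 * n)).
    by rewrite mulSn addnC ltn_add2r.
  by rewrite leq_mul2r ltn_ord orbT.
suff -> : mxvec_index i j = cast_ord (mxvec_cast m n) (Ordinal hk) by [].
rewrite /mxvec_index; congr cast_ord; apply: enum_val_inj; rewrite enum_rankK.
rewrite (enum_val_nth (i, j)) enumT unlock /= /prod_enum.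
have := @nth_allpairs_mul _ _ _ (fun (a : 'I_m) (b : 'I_n) => (a, b)) i j (i, j)
  (enum 'I_m) (enum 'I_n) i j.
by rewrite !size_enum_ord !nth_ord_enum => ->.
Qed.

Section MoreEntries.
Variable F : fieldType.

Lemma mn_row_mx m n (u : 'rV[F]_m) (v : 'rV[F]_n) j :
  mn (row_mx u v) 0 j = if (j < m)%N then mn u 0 j else mn v 0 (j - m).
Proof.
case: ltnP => jm; first by rewrite -[u in RHS](@row_mxKl F 1 m n u v) mn_lsubmx.
by rewrite -[v in RHS](@row_mxKr F 1 m n u v) mn_rsubmx subnKC.
Qed.

Lemma mn_const n x j : (j < n)%N -> mn (const_mx x : 'rV[F]_n) 0 j = x.
Proof.
move=> jn; rewrite -[X in mn _ X _]/(nat_of_ord (0 : 'I_1)).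
by rewrite -[j in LHS]/(nat_of_ord (Ordinal jn)) -mnE mxE.
Qed.

Lemma mn_mxvec m n (A : 'M[F]_(m, n)) i j : (i < m)%N -> (j < n)%N ->
  mn (mxvec A) 0 (i * n + j) = mn A i j.
Proof.
move=> im jn; have := mxvecE A (Ordinal im) (Ordinal jn).
by rewrite !mnE mxvec_index_val.
Qed.

Lemma mn_scalar n i j : (i < n)%N -> (j < n)%N ->
  mn (1%:M : 'M[F]_n) i j = (i == j)%:R.
Proof.
move=> hi hj; rewrite -[i in LHS]/(nat_of_ord (Ordinal hi)).
by rewrite -[j in LHS]/(nat_of_ord (Ordinal hj)) -mnE mxE.
Qed.

Lemma mn_alt_coord n (A : 'M[F]_n) k : (k < 'C(n, 2))%N ->
  mn (alt_coord A) 0 k =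
  \sum_(i < n) \sum_(j < n) ((i < j) && (k == 'C(j, 2) + i))%N%:R * A i j.
Proof.
move=> hk; rewrite (mn_row (fun k => \sum_(i < n) \sum_(j < n | _ && (k == _)%N) A i j)) //.
apply: eq_bigr => i _; rewrite big_mkcond; apply: eq_bigr => j _.
by case: ifP; rewrite ?mul1r ?mul0r.
Qed.

End MoreEntries.

(** * The four algebras in normal form *)

Section Examples.
Variables (R : realType) (F : nonArchLocalFieldType R).

(* For the Albert algebra, x = c_0, y consists of the octonions x_1 and x_2, and
   (u, v) of c_1, c_2 and x_0; the coordinates of sg and tu are 1 + N(x_2),
   -(1 + N(x_1)) and, up to sign, those of x_1 x_2.  The phases of the other three
   algebras are its restrictions to coordinate subspaces.  Entry i of a table is
   the sign (true for -1) and the index in (x, y, u, v) of coordinate i of J. *)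
Definition mat3_sg (y : 'rV[F]_(2 + 2)) : 'rV[F]_2 :=
  \row_(i < 2) nth (fun=> 0) [:: fun y => 1 + mn y 0 1 * mn y 0 3;
    fun y => mn y 0 2 * mn y 0 3] i y.

Definition mat3_tu (y : 'rV[F]_(2 + 2)) : 'rV[F]_2 :=
  \row_(i < 2) nth (fun=> 0) [:: fun y => - (1 + mn y 0 0 * mn y 0 2);
    fun y => mn y 0 0 * mn y 0 1] i y.

(** x is the upper left entry, y the rest of the first row and column, and (u, v) the lower right 2
    by 2 block; the sign makes the determinant of this block -u.v. *)
Definition mat3_tab := [:: (false, 0); (false, 2); (false, 3); (false, 4); (false, 5);
  (false, 6); (false, 1); (false, 8); (true, 7)]%N.

Definition asym4_sg (y : 'rV[F]_(0 + 0)) : 'rV[F]_3 :=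
  \row_(i < 3) nth (fun=> 0) [:: fun=> 1;
    fun=> 0;
    fun=> 0] i y.

Definition asym4_tu (y : 'rV[F]_(0 + 0)) : 'rV[F]_3 :=
  \row_(i < 3) nth (fun=> 0) [:: fun=> - 1;
    fun=> 0;
    fun=> 0] i y.

(** x is the summand F and (u, v) the alternating matrix; the two signs make its Pfaffian -u.v. *)
Definition asym4_tab := [:: (false, 0); (false, 1); (false, 2); (true, 6); (false, 3);
  (false, 5); (true, 4)]%N.

Definition asym6_sg (y : 'rV[F]_(4 + 4)) : 'rV[F]_3 :=
  \row_(i < 3) nth (fun=> 0) [:: fun y => 1 + mn y 0 2 * mn y 0 6 + mn y 0 3 * mn y 0 7;
    fun y => mn y 0 0 * mn y 0 7 - mn y 0 2 * mn y 0 5;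
    fun y => mn y 0 2 * mn y 0 4 + mn y 0 1 * mn y 0 7] i y.

Definition asym6_tu (y : 'rV[F]_(4 + 4)) : 'rV[F]_3 :=
  \row_(i < 3) nth (fun=> 0) [:: fun y => - (1 + mn y 0 0 * mn y 0 4 + mn y 0 1 * mn y 0 5);
    fun y => mn y 0 3 * mn y 0 4 - mn y 0 1 * mn y 0 6;
    fun y => mn y 0 3 * mn y 0 5 + mn y 0 0 * mn y 0 6] i y.

(** x is the entry (0, 1), y consists of the entries (i, j) with i < 2 <= j, and (u, v) is the
    alternating block on the last four indices, of Pfaffian -u.v. *)
Definition asym6_tab := [:: (false, 0); (false, 3); (true, 8); (false, 4); (false, 7);
  (false, 9); (false, 1); (true, 6); (false, 10); (true, 14); (false, 2); (false, 5);
  (false, 11); (false, 13); (true, 12)]%N.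

Definition albert_sg (y : 'rV[F]_(8 + 8)) : 'rV[F]_5 :=
  \row_(i < 5) nth (fun=> 0) [:: fun y => 1 + mn y 0 4 * mn y 0 12 + mn y 0 5 * mn y 0 13 + mn
    y 0 6 * mn y 0 14 + mn y 0 7 * mn y 0 15;
    fun y => mn y 0 8 * mn y 0 12 - mn y 0 9 * mn y 0 5 - mn y 0 10 * mn y 0 6 - mn y 0 11 * mn
      y 0 7;
    fun y => - (mn y 0 0 * mn y 0 5) - mn y 0 12 * mn y 0 1 + mn y 0 10 * mn y 0 15 - mn y 0 11
      * mn y 0 14;
    fun y => - (mn y 0 0 * mn y 0 6) - mn y 0 12 * mn y 0 2 + mn y 0 11 * mn y 0 13 - mn y 0 9
      * mn y 0 15;
    fun y => - (mn y 0 0 * mn y 0 7) - mn y 0 12 * mn y 0 3 + mn y 0 9 * mn y 0 14 - mn y 0 10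
      * mn y 0 13] i y.

Definition albert_tu (y : 'rV[F]_(8 + 8)) : 'rV[F]_5 :=
  \row_(i < 5) nth (fun=> 0) [:: fun y => - (1 + mn y 0 0 * mn y 0 8 + mn y 0 1 * mn y 0 9 + mn
    y 0 2 * mn y 0 10 + mn y 0 3 * mn y 0 11);
    fun y => mn y 0 0 * mn y 0 4 - mn y 0 1 * mn y 0 13 - mn y 0 2 * mn y 0 14 - mn y 0 3 * mn
      y 0 15;
    fun y => mn y 0 2 * mn y 0 7 - mn y 0 3 * mn y 0 6 - mn y 0 4 * mn y 0 9 - mn y 0 8 * mn y 0 13;
    fun y => mn y 0 3 * mn y 0 5 - mn y 0 1 * mn y 0 7 - mn y 0 4 * mn y 0 10 - mn y 0 8 * mn y
      0 14;
    fun y => mn y 0 1 * mn y 0 6 - mn y 0 2 * mn y 0 5 - mn y 0 4 * mn y 0 11 - mn y 0 8 * mn y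
      0 15] i y.

Definition albert_tab := [:: (false, 0); (false, 17); (true, 22); (false, 18); (false, 19);
  (false, 20); (false, 21); (true, 24); (true, 25); (true, 26); (false, 23); (false, 1);
  (false, 2); (false, 3); (false, 4); (true, 10); (true, 11); (true, 12); (false, 9);
  (false, 5); (false, 6); (false, 7); (false, 8); (true, 14); (true, 15); (true, 16);
  (false, 13)]%N.

(* [ring] compares atoms syntactically, so the indices must be in normal form. *)
Ltac mn_norm := repeat match goal with
  |- context [@mn ?F ?m ?n ?A ?i ?j] =>
    let i' := eval vm_compute in i in let j' := eval vm_compute in j in
    progress change (@mn F m n A i j) with (@mn F m n A i' j') end.

Lemma mat3_phase (v : 'rV[F]_(3 * 3)) :
  @jtrace F (jordan_mat3 F) v - @jnorm F (jordan_mat3 F) v =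
  let a := mn v 0 in
  a 0%N + a 4%N + a 8%N - (a 0%N * (a 4%N * a 8%N - a 5%N * a 7%N)
  - a 1%N * (a 3%N * a 8%N - a 5%N * a 6%N)
  + a 2%N * (a 3%N * a 7%N - a 4%N * a 6%N)).
Proof.
have e (i j : nat) : (i < 3)%N -> (j < 3)%N ->
    mn (vec_mx v : 'M[F]_3) i j = mn v 0 (i * 3 + j).
  move=> hi hj; rewrite -[i in LHS]/(nat_of_ord (Ordinal hi)).
  rewrite -[j in LHS]/(nat_of_ord (Ordinal hj)) -mnE mxE mnE; congr (mn _ _ _).
  exact: mxvec_index_val.
rewrite /= /mxtrace !big_ord_recl big_ord0 det3E !(mnE (vec_mx v)) !e //=.
by rewrite addr0 addrA.
Qed.

Lemma alt_trace2E (A : 'M[F]_4) : @alt_trace F 2 A = mn A 0 1 + mn A 2 3.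
Proof.
rewrite /alt_trace; under eq_bigr do rewrite big_mkcond.
by rewrite !big_ord_recl !big_ord0 /= !mnE /= !add0r !addr0.
Qed.

Lemma alt_trace3E (A : 'M[F]_6) :
  @alt_trace F 3 A = mn A 0 1 + mn A 2 3 + mn A 4 5.
Proof.
rewrite /alt_trace; under eq_bigr do rewrite big_mkcond.
by rewrite !big_ord_recl !big_ord0 /= !mnE /= !add0r !addr0 addrA.
Qed.

Lemma asym4_phase (v : 'rV[F]_(1 + 'C(4, 2))) :
  @jtrace F (jordan_F_asym4 F) v - @jnorm F (jordan_F_asym4 F) v =
  let a := mn v 0 in
  a 0%N + (a 1%N + a 6%N) -
  a 0%N * (a 1%N * a 6%N - a 2%N * a 5%N + a 4%N * a 3%N).
Proof.
rewrite -[@jnorm F (jordan_F_asym4 F) v]/(lsubmx v 0 0 * @pfaffian F 2 (@alt_mx F 4 (rsubmx v))).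
rewrite -[@jtrace F (jordan_F_asym4 F) v]/(lsubmx v 0 0 + @alt_trace F 2 (@alt_mx F 4 (rsubmx v))).
rewrite pfaffian2E alt_trace2E !(@mn_alt F 4) //= !(@mn_rsubmx F 1).
by have -> : lsubmx v 0 0 = mn v 0 0 by rewrite mxE mnE.
Qed.

Lemma asym6_phase (v : 'rV[F]_('C(6, 2))) :
  @jtrace F (jordan_asym6 F) v - @jnorm F (jordan_asym6 F) v =
  let a := mn v 0 in
  a 0%N + a 5%N + a 14%N -
  (a 0%N * (a 5%N * a 14%N - a 8%N * a 13%N + a 12%N * a 9%N)
  - a 1%N * (a 4%N * a 14%N - a 7%N * a 13%N + a 11%N * a 9%N)
  + a 3%N * (a 2%N * a 14%N - a 7%N * a 12%N + a 11%N * a 8%N)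
  - a 6%N * (a 2%N * a 13%N - a 4%N * a 12%N + a 11%N * a 5%N)
  + a 10%N * (a 2%N * a 9%N - a 4%N * a 8%N + a 7%N * a 5%N)).
Proof.
rewrite -[@jnorm F (jordan_asym6 F) v]/(@pfaffian F 3 (@alt_mx F 6 v)).
rewrite -[@jtrace F (jordan_asym6 F) v]/(@alt_trace F 3 (@alt_mx F 6 v)).
by rewrite pfaffian3E alt_trace3E /= !(@mn_alt F 6).
Qed.

Lemma albert_normE (c : 'rV[F]_3) (x : 'I_3 -> zorn F) : albert_norm c x =
  c 0 0 * c 0 1 * c 0 2 -
  (c 0 0 * (za (x 0) * zb (x 0) - (zu (x 0) 0 0 * zv (x 0) 0 0 + zu (x 0) 0 1 * zv (x 0) 0 1 +
    zu (x 0) 0 2 * zv (x 0) 0 2))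
   + c 0 1 * (za (x 1) * zb (x 1) - (zu (x 1) 0 0 * zv (x 1) 0 0 + zu (x 1) 0 1 * zv (x 1) 0 1
     + zu (x 1) 0 2 * zv (x 1) 0 2))
   + c 0 2 * (za (x 2) * zb (x 2) - (zu (x 2) 0 0 * zv (x 2) 0 0 + zu (x 2) 0 1 * zv (x 2) 0 1
     + zu (x 2) 0 2 * zv (x 2) 0 2)))
  + (za (x 0) * (za (x 1) * za (x 2) + zu (x 1) 0 0 * zv (x 2) 0 0 + zu (x 1) 0 1 * zv (x 2) 0
    1 + zu (x 1) 0 2 * zv (x 2) 0 2)
    + zb (x 0) * (zb (x 1) * zb (x 2) + zv (x 1) 0 0 * zu (x 2) 0 0 + zv (x 1) 0 1 * zu (x 2) 0
      1 + zv (x 1) 0 2 * zu (x 2) 0 2)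
    + zu (x 0) 0 0 * (za (x 2) * zv (x 1) 0 0 + zb (x 1) * zv (x 2) 0 0 + (zu (x 1) 0 1 * zu (x
      2) 0 2 - zu (x 1) 0 2 * zu (x 2) 0 1))
    + zu (x 0) 0 1 * (za (x 2) * zv (x 1) 0 1 + zb (x 1) * zv (x 2) 0 1 + (zu (x 1) 0 2 * zu (x
      2) 0 0 - zu (x 1) 0 0 * zu (x 2) 0 2))
    + zu (x 0) 0 2 * (za (x 2) * zv (x 1) 0 2 + zb (x 1) * zv (x 2) 0 2 + (zu (x 1) 0 0 * zu (x
      2) 0 1 - zu (x 1) 0 1 * zu (x 2) 0 0))
    + zv (x 0) 0 0 * (za (x 1) * zu (x 2) 0 0 + zb (x 2) * zu (x 1) 0 0 - (zv (x 1) 0 1 * zv (x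
      2) 0 2 - zv (x 1) 0 2 * zv (x 2) 0 1))
    + zv (x 0) 0 1 * (za (x 1) * zu (x 2) 0 1 + zb (x 2) * zu (x 1) 0 1 - (zv (x 1) 0 2 * zv (x
      2) 0 0 - zv (x 1) 0 0 * zv (x 2) 0 2))
    + zv (x 0) 0 2 * (za (x 1) * zu (x 2) 0 2 + zb (x 2) * zu (x 1) 0 2 - (zv (x 1) 0 0 * zv (x
      2) 0 1 - zv (x 1) 0 1 * zv (x 2) 0 0))).
Proof.
have e1 : lift ord0 ord0 = 1 :> 'I_3 by exact: val_inj.
have e2 : lift ord0 (lift ord0 ord0) = 2 :> 'I_3 by exact: val_inj.
have e2' : lift ord0 1 = 2 :> 'I_3 by exact: val_inj.
have e3 : 1 + 1 = 2 :> 'I_3 by exact: val_inj.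
have e4 : 1 + 2 = 0 :> 'I_3 by exact: val_inj.
have e5 : 2 + 1 = 0 :> 'I_3 by exact: val_inj.
have e6 : 2 + 2 = 1 :> 'I_3 by exact: val_inj.
rewrite /albert_norm !big_ord_recl !big_ord0 /zorn_norm /zorn_trace /zorn_mul /dot3.
rewrite /= !big_ord_recl !big_ord0 !(e1, e2, e2') !mxE.
rewrite !(@add0r 'I_3) !(e3, e4, e5, e6).
ring.
Qed.

Lemma albert_phase (v : 'rV[F]_(3 + 3 * 8)) :
  @jtrace F (jordan_albert F) v - @jnorm F (jordan_albert F) v =
  let a := mn v 0 in
  a 0%N + a 1%N + a 2%N - (a 0%N * a 1%N * a 2%N -
  (a 0%N * (a 3%N * a 10%N - (a 4%N * a 7%N + a 5%N * a 8%N + a 6%N * a 9%N))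
   + a 1%N * (a 11%N * a 18%N - (a 12%N * a 15%N + a 13%N * a 16%N + a 14%N * a 17%N))
   + a 2%N * (a 19%N * a 26%N - (a 20%N * a 23%N + a 21%N * a 24%N + a 22%N * a 25%N)))
  + (a 3%N * (a 11%N * a 19%N + a 12%N * a 23%N + a 13%N * a 24%N + a 14%N * a 25%N)
    + a 10%N * (a 18%N * a 26%N + a 15%N * a 20%N + a 16%N * a 21%N + a 17%N * a 22%N)
    + a 4%N * (a 19%N * a 15%N + a 18%N * a 23%N + (a 13%N * a 22%N - a 14%N * a 21%N))
    + a 5%N * (a 19%N * a 16%N + a 18%N * a 24%N + (a 14%N * a 20%N - a 12%N * a 22%N))
    + a 6%N * (a 19%N * a 17%N + a 18%N * a 25%N + (a 12%N * a 21%N - a 13%N * a 20%N))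
    + a 7%N * (a 11%N * a 20%N + a 26%N * a 12%N - (a 16%N * a 25%N - a 17%N * a 24%N))
    + a 8%N * (a 11%N * a 21%N + a 26%N * a 13%N - (a 17%N * a 23%N - a 15%N * a 25%N))
    + a 9%N * (a 11%N * a 22%N + a 26%N * a 14%N - (a 15%N * a 24%N - a 16%N * a 23%N)))).
Proof.
have hv (i : 'I_3) (j : nat) (hj : (j < 8)%N) :
    row i (vec_mx (rsubmx v)) 0 (Ordinal hj) = mn v 0 (3 + (i * 8 + j)).
  rewrite !mxE mnE; congr (mn _ _ (3 + _)).
  exact: mxvec_index_val.
have za_ i : za (albert_offdiag v i) = mn v 0 (3 + (i * 8 + 0)).
  by rewrite -(hv i 0%N isT) /albert_offdiag /= mxE [LHS]mxE; congr (row _ _ _ _); apply: val_inj.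
have zb_ i : zb (albert_offdiag v i) = mn v 0 (3 + (i * 8 + 7)).
  by rewrite -(hv i 7%N isT) /albert_offdiag /= mxE [LHS]mxE; congr (row _ _ _ _); apply: val_inj.
have zu_ i (k : 'I_3) : zu (albert_offdiag v i) 0 k = mn v 0 (3 + (i * 8 + k.+1)).
  have hk : (k.+1 < 8)%N by case: k => -[|[|[|]]].
  by rewrite -(hv i k.+1 hk) /albert_offdiag /= mxE [LHS]mxE; congr (row _ _ _ _); apply: val_inj.
have zv_ i (k : 'I_3) : zv (albert_offdiag v i) 0 k = mn v 0 (3 + (i * 8 + (4 + k))).
  have hk : (4 + k < 8)%N by case: k => -[|[|[|]]].
  by rewrite -(hv i (4 + k)%N hk) /albert_offdiag /= mxE [LHS]mxE; congr (row _ _ _ _); apply: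
    val_inj.
have hd i : albert_diag v 0 i = mn v 0 i by rewrite /albert_diag mxE mnE.
rewrite -[@jnorm F (jordan_albert F) v]/(albert_norm (albert_diag v) (albert_offdiag v)).
rewrite -[@jtrace F (jordan_albert F) v]/(\sum_i albert_diag v 0 i).
rewrite albert_normE !big_ord_recl !big_ord0 !(za_, zb_, zu_, zv_, hd).
mn_norm.
rewrite /=; ring.
Qed.

Ltac chart_eq := rewrite /dot !big_ord_recl !big_ord0 !mxE /= ?mnE
  ?mn_lsubmx // ?mn_rsubmx; mn_norm; ring.

(** In each example sg(0) and tu(0) are the first unit vector and its negative, so in normal
    coordinates the identity has entries 1, 1, -1 at the starts of the blocks x, u, v. The tables
    attach a sign to the start of v. *)
Lemma mn_pack_one k l (s t : 'rV[F]_l) j :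
  (forall i, (i < l)%N -> mn s 0 i = (i == 0)%:R) ->
  (forall i, (i < l)%N -> mn t 0 i = - (i == 0)%:R) ->
  (j < 1 + ((k + k) + (l + l)))%N ->
  mn (pack 1 (0 : 'rV[F]_(k + k)) (row_mx s t)) 0 j =
  (j == 0)%:R + (j == (k + k).+1)%:R - (j == ((k + k) + l).+1)%:R
  :> F.
Proof.
move=> hs ht; rewrite /pack !mn_row_mx; case: j => [|j] /=.
  by rewrite mn_const // addr0 subr0.
rewrite add1n ltnS subn1 /= add0r !eqSS => hj.
have [jk|kj] := ltnP j (k + k).
  by rewrite mn0 !ltn_eqF ?subr0 // (leq_trans jk) // leq_addr.
set i := (j - (k + k))%N.
have [-> ->] : (j == k + k)%N = (i == 0)%N /\ (j == k + k + l)%N = (i == l).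
  by rewrite /i; split; apply/eqP/eqP; lia.
have hi : (i < l + l)%N by rewrite /i; lia.
have [il|li] := ltnP i l; first by rewrite hs // (ltn_eqF il) subr0.
rewrite ht; last by lia.
have [-> ->] : (i - l == 0)%N = (i == l) /\ (i == 0)%N = false.
  by split; [apply/eqP/eqP; lia | apply/eqP; lia].
by rewrite add0r.
Qed.

Ltac bool_norm := repeat match goal with |- context [nat_of_bool ?b] =>
  let b' := eval vm_compute in b in
  progress change (nat_of_bool b) with (nat_of_bool b') end.

Lemma mat3_tab_ok : [&& size mat3_tab == 9, uniq (unzip2 mat3_tab) &
  all (fun c => c.2 < 1 + ((2 + 2) + (2 + 2)))%N mat3_tab].
Proof. by []. Qed.

Lemma mat3_sg_pol i : pol 2 (fun y => mat3_sg y 0 i).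
Proof. by apply: pol_nth; pol_tac. Qed.

Lemma mat3_tu_pol i : pol 2 (fun y => mat3_tu y 0 i).
Proof. by apply: pol_nth; pol_tac. Qed.

Lemma mat3_quad y :
  1 + dot (mat3_sg y) (mat3_tu y) + dot (lsubmx y) (rsubmx y) = 0.
Proof. chart_eq. Qed.

Lemma mat3_unit y :
  mat3_sg y 0 0 - mat3_tu y 0 0 + dot (mat3_sg y) (mat3_tu y) = 1.
Proof. chart_eq. Qed.

Lemma mat3_cubic w :
  let L := signed_perm (tab_idx mat3_tab_ok) (tab_sgn mat3_tab) w in
  @jtrace F (jordan_mat3 F) L - @jnorm F (jordan_mat3 F) L = cubic mat3_sg mat3_tu w.
Proof.
rewrite /= mat3_phase /= !mn_signed_perm //= /cubic /phase; chart_eq.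
Qed.

Lemma mn_mat3_jone j : (j < 9)%N ->
  mn (mxvec (1%:M : 'M[F]_3)) 0 j = (j \in [:: 0; 4; 8]%N)%:R :> F.
Proof.
move=> hj; rewrite {1}(divn_eq j 3) mn_mxvec ?mn_scalar ?ltn_pmod ?ltn_divLR // -/(mxvec _).
by do 9 (case: j hj => [|j] hj //).
Qed.

Lemma mat3_sg0 i : (i < 2)%N -> mn (mat3_sg 0) 0 i = (i == 0)%:R.
Proof.
move=> hi; rewrite (mn_row (fun i => nth _ _ i 0)) //.
by do 2 (case: i hi => [|i] hi; first by
  rewrite /= ?mn0 ?(mulr0, mul0r, addr0, subr0, oppr0)).
Qed.

Lemma mat3_tu0 i : (i < 2)%N -> mn (mat3_tu 0) 0 i = - (i == 0)%:R.
Proof.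
move=> hi; rewrite (mn_row (fun i => nth _ _ i 0)) //.
by do 2 (case: i hi => [|i] hi; first by
  rewrite /= ?mn0 ?(mulr0, mul0r, addr0, subr0, oppr0)).
Qed.

Lemma mat3_one : signed_perm (tab_idx mat3_tab_ok) (tab_sgn mat3_tab)
  (pack 1 0 (row_mx (mat3_sg 0) (mat3_tu 0))) = jone (jordan_mat3 F).
Proof.
apply: eq_mn_rowP => j hj; rewrite mn_signed_perm // [RHS]mn_mat3_jone //.
do 9 (case: j hj => [|j] hj; first by
  rewrite /= (mn_pack_one mat3_sg0 mat3_tu0) //= ?(addr0, add0r, subr0, oppr0, opprK)).
by [].
Qed.

Definition mat3_chart : chart (jordan_mat3 F) :=
  @Chart R F (jordan_mat3 F) 2 2 _ _ _ _ _ erefl (@tab_idx_inj _ _ _ mat3_tab_ok)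
    mat3_sg_pol mat3_tu_pol mat3_quad mat3_unit mat3_cubic mat3_one.

Lemma asym4_tab_ok : [&& size asym4_tab == 7, uniq (unzip2 asym4_tab) &
  all (fun c => c.2 < 1 + ((0 + 0) + (3 + 3)))%N asym4_tab].
Proof. by []. Qed.

Lemma asym4_sg_pol i : pol 2 (fun y => asym4_sg y 0 i).
Proof. by apply: pol_nth; pol_tac. Qed.

Lemma asym4_tu_pol i : pol 2 (fun y => asym4_tu y 0 i).
Proof. by apply: pol_nth; pol_tac. Qed.

Lemma asym4_quad y :
  1 + dot (asym4_sg y) (asym4_tu y) + dot (lsubmx y) (rsubmx y) = 0.
Proof. chart_eq. Qed.

Lemma asym4_unit y :
  asym4_sg y 0 0 - asym4_tu y 0 0 + dot (asym4_sg y) (asym4_tu y) = 1.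
Proof. chart_eq. Qed.

Lemma asym4_cubic w :
  let L := signed_perm (tab_idx asym4_tab_ok) (tab_sgn asym4_tab) w in
  @jtrace F (jordan_F_asym4 F) L - @jnorm F (jordan_F_asym4 F) L = cubic asym4_sg asym4_tu w.
Proof.
rewrite /= asym4_phase /= !mn_signed_perm //= /cubic /phase; chart_eq.
Qed.

Lemma mn_asym4_jone j : (j < 7)%N ->
  mn (row_mx 1%:M (@alt_coord F 4 (symp F 2))) 0 j = (j \in [:: 0; 1; 6]%N)%:R :> F.
Proof.
move=> hj; rewrite mn_row_mx; case: j hj => [|j] hj /=; first by rewrite mn_scalar.
rewrite subn1 /= (@mn_alt_coord F 4) // !big_ord_recl !big_ord0.
by do 6 (case: j hj => [|j] hj; first by bool_norm;
  rewrite ?(mul0r, addr0, add0r, mul1r) ?mxE /= ?subr0).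
Qed.

Lemma asym4_sg0 i : (i < 3)%N -> mn (asym4_sg 0) 0 i = (i == 0)%:R.
Proof.
move=> hi; rewrite (mn_row (fun i => nth _ _ i 0)) //.
by do 3 (case: i hi => [|i] hi; first by
  rewrite /= ?mn0 ?(mulr0, mul0r, addr0, subr0, oppr0)).
Qed.

Lemma asym4_tu0 i : (i < 3)%N -> mn (asym4_tu 0) 0 i = - (i == 0)%:R.
Proof.
move=> hi; rewrite (mn_row (fun i => nth _ _ i 0)) //.
by do 3 (case: i hi => [|i] hi; first by
  rewrite /= ?mn0 ?(mulr0, mul0r, addr0, subr0, oppr0)).
Qed.

Lemma asym4_one : signed_perm (tab_idx asym4_tab_ok) (tab_sgn asym4_tab)
  (pack 1 0 (row_mx (asym4_sg 0) (asym4_tu 0))) = jone (jordan_F_asym4 F).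
Proof.
apply: eq_mn_rowP => j hj; rewrite mn_signed_perm // [RHS]mn_asym4_jone //.
do 7 (case: j hj => [|j] hj; first by
  rewrite /= (mn_pack_one asym4_sg0 asym4_tu0) //= ?(addr0, add0r, subr0, oppr0, opprK)).
by [].
Qed.

Definition asym4_chart : chart (jordan_F_asym4 F) :=
  @Chart R F (jordan_F_asym4 F) 0 3 _ _ _ _ _ erefl (@tab_idx_inj _ _ _ asym4_tab_ok)
    asym4_sg_pol asym4_tu_pol asym4_quad asym4_unit asym4_cubic asym4_one.

Lemma asym6_tab_ok : [&& size asym6_tab == 15, uniq (unzip2 asym6_tab) &
  all (fun c => c.2 < 1 + ((4 + 4) + (3 + 3)))%N asym6_tab].
Proof. by []. Qed.

Lemma asym6_sg_pol i : pol 2 (fun y => asym6_sg y 0 i).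
Proof. by apply: pol_nth; pol_tac. Qed.

Lemma asym6_tu_pol i : pol 2 (fun y => asym6_tu y 0 i).
Proof. by apply: pol_nth; pol_tac. Qed.

Lemma asym6_quad y :
  1 + dot (asym6_sg y) (asym6_tu y) + dot (lsubmx y) (rsubmx y) = 0.
Proof. chart_eq. Qed.

Lemma asym6_unit y :
  asym6_sg y 0 0 - asym6_tu y 0 0 + dot (asym6_sg y) (asym6_tu y) = 1.
Proof. chart_eq. Qed.

Lemma asym6_cubic w :
  let L := signed_perm (tab_idx asym6_tab_ok) (tab_sgn asym6_tab) w in
  @jtrace F (jordan_asym6 F) L - @jnorm F (jordan_asym6 F) L = cubic asym6_sg asym6_tu w.
Proof.
rewrite /= asym6_phase /= !mn_signed_perm //= /cubic /phase; chart_eq.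
Qed.

Lemma mn_asym6_jone j : (j < 15)%N ->
  mn (@alt_coord F 6 (symp F 3)) 0 j = (j \in [:: 0; 5; 14]%N)%:R :> F.
Proof.
move=> hj; rewrite (@mn_alt_coord F 6) // !big_ord_recl !big_ord0.
by do 15 (case: j hj => [|j] hj; first by bool_norm;
  rewrite ?(mul0r, addr0, add0r, mul1r) ?mxE /= ?subr0).
Qed.

Lemma asym6_sg0 i : (i < 3)%N -> mn (asym6_sg 0) 0 i = (i == 0)%:R.
Proof.
move=> hi; rewrite (mn_row (fun i => nth _ _ i 0)) //.
by do 3 (case: i hi => [|i] hi; first by
  rewrite /= ?mn0 ?(mulr0, mul0r, addr0, subr0, oppr0)).
Qed.

Lemma asym6_tu0 i : (i < 3)%N -> mn (asym6_tu 0) 0 i = - (i == 0)%:R.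
Proof.
move=> hi; rewrite (mn_row (fun i => nth _ _ i 0)) //.
by do 3 (case: i hi => [|i] hi; first by
  rewrite /= ?mn0 ?(mulr0, mul0r, addr0, subr0, oppr0)).
Qed.

Lemma asym6_one : signed_perm (tab_idx asym6_tab_ok) (tab_sgn asym6_tab)
  (pack 1 0 (row_mx (asym6_sg 0) (asym6_tu 0))) = jone (jordan_asym6 F).
Proof.
apply: eq_mn_rowP => j hj; rewrite mn_signed_perm // [RHS]mn_asym6_jone //.
do 15 (case: j hj => [|j] hj; first by
  rewrite /= (mn_pack_one asym6_sg0 asym6_tu0) //= ?(addr0, add0r, subr0, oppr0, opprK)).
by [].
Qed.

Definition asym6_chart : chart (jordan_asym6 F) :=
  @Chart R F (jordan_asym6 F) 4 3 _ _ _ _ _ erefl (@tab_idx_inj _ _ _ asym6_tab_ok)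
    asym6_sg_pol asym6_tu_pol asym6_quad asym6_unit asym6_cubic asym6_one.

Lemma albert_tab_ok : [&& size albert_tab == 27, uniq (unzip2 albert_tab) &
  all (fun c => c.2 < 1 + ((8 + 8) + (5 + 5)))%N albert_tab].
Proof. by []. Qed.

Lemma albert_sg_pol i : pol 2 (fun y => albert_sg y 0 i).
Proof. by apply: pol_nth; pol_tac. Qed.

Lemma albert_tu_pol i : pol 2 (fun y => albert_tu y 0 i).
Proof. by apply: pol_nth; pol_tac. Qed.

Lemma albert_quad y :
  1 + dot (albert_sg y) (albert_tu y) + dot (lsubmx y) (rsubmx y) = 0.
Proof. chart_eq. Qed.

Lemma albert_unit y :
  albert_sg y 0 0 - albert_tu y 0 0 + dot (albert_sg y) (albert_tu y) = 1.
Proof. chart_eq. Qed.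

Lemma albert_cubic w :
  let L := signed_perm (tab_idx albert_tab_ok) (tab_sgn albert_tab) w in
  @jtrace F (jordan_albert F) L - @jnorm F (jordan_albert F) L = cubic albert_sg albert_tu w.
Proof.
rewrite /= albert_phase /= !mn_signed_perm //= /cubic /phase; chart_eq.
Qed.

Lemma mn_albert_jone j : (j < 27)%N ->
  mn (row_mx (const_mx 1 : 'rV[F]_3) (0 : 'rV[F]_(3 * 8))) 0 j = (j \in [:: 0; 1; 2]%N)%:R :> F.
Proof.
move=> hj; rewrite mn_row_mx mn0; case: ltnP => h; first by rewrite mn_const //; case: j h hj
  => [|[|[|]]].
by do 3 (case: j h hj => [|j] h hj //).
Qed.

Lemma albert_sg0 i : (i < 5)%N -> mn (albert_sg 0) 0 i = (i == 0)%:R.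
Proof.
move=> hi; rewrite (mn_row (fun i => nth _ _ i 0)) //.
by do 5 (case: i hi => [|i] hi; first by
  rewrite /= ?mn0 ?(mulr0, mul0r, addr0, subr0, oppr0)).
Qed.

Lemma albert_tu0 i : (i < 5)%N -> mn (albert_tu 0) 0 i = - (i == 0)%:R.
Proof.
move=> hi; rewrite (mn_row (fun i => nth _ _ i 0)) //.
by do 5 (case: i hi => [|i] hi; first by
  rewrite /= ?mn0 ?(mulr0, mul0r, addr0, subr0, oppr0)).
Qed.

Lemma albert_one : signed_perm (tab_idx albert_tab_ok) (tab_sgn albert_tab)
  (pack 1 0 (row_mx (albert_sg 0) (albert_tu 0))) = jone (jordan_albert F).
Proof.
apply: eq_mn_rowP => j hj; rewrite mn_signed_perm // [RHS]mn_albert_jone //.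
do 27 (case: j hj => [|j] hj; first by
  rewrite /= (mn_pack_one albert_sg0 albert_tu0) //= ?(addr0, add0r, subr0, oppr0, opprK)).
by [].
Qed.

Definition albert_chart : chart (jordan_albert F) :=
  @Chart R F (jordan_albert F) 8 5 _ _ _ _ _ erefl (@tab_idx_inj _ _ _ albert_tab_ok)
    albert_sg_pol albert_tu_pol albert_quad albert_unit albert_cubic albert_one.

Lemma split_chart J : @split_cubicJordan F J -> inhabited (chart J).
Proof.
case; constructor;
  [exact: mat3_chart|exact: asym4_chart|exact: asym6_chart|exact: albert_chart].
Qed.

End Examples.

(** * Signed permutations as isometries *)

Section SignedPermutations.
Variables (R : realType) (F : nonArchLocalFieldType R).
Local Notation "`| x |_F" := (@lfabs R F x) (format "`| x |_F").
Variables (m n : nat) (idx : 'I_n -> 'I_m) (sgn : 'I_n -> bool).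
Hypothesis nm : n = m.
Hypothesis idx_inj : injective idx.
Local Notation L := (@signed_perm R F m n idx sgn).

Lemma signed_permD : {morph L : v w / v + w}.
Proof. by move=> v w; apply/rowP => i; rewrite !mxE mulrDr. Qed.

Lemma signed_permN v : L (- v) = - L v.
Proof. by apply/rowP => i; rewrite !mxE mulrN. Qed.

Lemma signed_perm_inv : exists L' : 'rV[F]_n -> 'rV[F]_m,
  [/\ cancel L L', cancel L' L, {morph L' : v w / v + w} &
      {morph L' : v w / v - w}].
Proof.
have [g gK Kg] : bijective idx by apply: inj_card_bij => //; rewrite !card_ord nm.
exists (fun v => \row_j ((-1) ^+ sgn (g j) * v 0 (g j))); split.
- by move=> v; apply/rowP => j; rewrite !mxE Kg signrMK.
- by move=> v; apply/rowP => j; rewrite !mxE gK signrMK.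
- by move=> v w; apply/rowP => j; rewrite !mxE mulrDr.
by move=> v w; apply/rowP => j; rewrite !mxE mulrBr.
Qed.

Lemma vle_signed_perm r v : vle r (L v) = vle r v.
Proof.
have [g gK Kg] : bijective idx by apply: inj_card_bij => //; rewrite !card_ord nm.
apply/vleP/vleP => h i; last by rewrite mxE lfabsM lfabs_sign mul1r.
by have := h (g i); rewrite mxE lfabsM lfabs_sign mul1r Kg.
Qed.

End SignedPermutations.

(** * Orbital integrals in the coordinates of a chart *)

Section OrbitalIntegrals.
Variables (R : realType) (F : nonArchLocalFieldType R) (p : F).
Hypothesis punif : uniformizer p.
Variable psi : F -> R[i].
Hypothesis psi_char : additive_character psi.
Variable dx : {measure set (borel (0 : F)) -> \bar R}.
Hypothesis dx_sd : self_dual psi dx.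
Local Notation "`| x |_F" := (@lfabs R F x) (format "`| x |_F").
Local Notation pi := (`|p|_F).
Local Notation C := R[i].
Local Notation schwartz := (@schwartz R F p _).
Local Notation S := (@schwartz_int R F p dx _).
Local Notation vol := (@vol R F dx).
Local Notation klo := (@klo R F psi).
Variable e : F.
Hypothesis e_neq0 : e != 0.
Hypothesis psi_triv : forall x, `|x|_F <= `|e|_F -> psi x = 1.
Hypothesis psi_nontriv : exists x, pi * `|x|_F <= `|e|_F /\ psi x != 1.
Variables (J : cubicJordan F) (ch : chart J).
Variable dA : {measure set (borel (0 : 'rV[F]_(jdim J))) -> \bar R}.
Hypothesis dA_prod : product_measure_of dx dA.

Let haar := dx_sd.1.
Let sdv := self_dual_vol punif psi_char dx_sd e_neq0 psi_triv psi_nontriv.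
Local Notation k := (ck ch).
Local Notation l := (cl ch).
Local Notation sg := (@csg R F J ch).
Local Notation tu := (@ctu R F J ch).
Local Notation L := (@signed_perm R F (1 + ((k + k) + (l + l))) (jdim J) (@cidx R F J ch)
  (@csgn R F J ch)).
Local Notation s0 := (row_mx (sg 0) (tu 0)).
Let P (A : 'rV[F]_(jdim J)) : F := jtrace A - jnorm A.

Lemma half_jdim : (jdim J).-1./2 = (k + l)%N.
Proof. by rewrite (cdim ch) add1n /= !addnn -doubleD doubleK. Qed.

(** The bound is pulled back from the normal form along the inverse signed permutation, an isometry,
    so the four norms need no separate estimate. *)
Lemma pol_phase : pol 3 P.
Proof.
have [L' [LK L'K L'D _]] := signed_perm_inv F (@csgn R F J ch) (cdim ch) (@cidx_inj _ _ _ ch).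
have -> : P = fun A => cubic sg tu (L' A).
  by apply/funext => A; rewrite -(@cphase R F J ch) L'K.
apply: pol_comp => //; first by move=> r v; rewrite -{1}(L'K v) vle_signed_perm ?(cdim ch) //;
  exact: cidx_inj.
exact: (pol_cubic (@csg_pol _ _ _ ch) (@ctu_pol _ _ _ ch)).
Qed.

Lemma phase0 : P 0 = 0.
Proof.
have e0 : L (0 : 'rV[F]_(1 + ((k + k) + (l + l)))) = 0 by apply/rowP => i; rewrite !mxE mulr0.
have z0 : pack 0 (0 : 'rV[F]_(k + k)) (0 : 'rV[F]_(l + l)) = 0.
  by rewrite /pack (_ : const_mx 0 = 0) ?row_mx0.
rewrite /P -e0 (@cphase R F J ch) -z0 cubic_pack /phase mul0r.
have h0 s : dot (lsubmx (0 : 'rV[F]_(l + l))) s = 0.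
  by rewrite /dot big1 // => i _; rewrite !mxE mul0r.
have h1 s : dot (rsubmx (0 : 'rV[F]_(l + l))) s = 0.
  by rewrite /dot big1 // => i _; rewrite !mxE mul0r.
by rewrite h0 h1 !subr0.
Qed.

Lemma cintegral_dA (f : 'rV[F]_(jdim J) -> C) : schwartz f ->
  cintegral dA setT f = S f.
Proof.
by move=> [j hf]; rewrite (SE punif haar hf); exact: (cintegral_net_sum punif haar dA_prod hf).
Qed.

Lemma orbI_S (phi : F * 'rV[F]_(jdim J) -> C) a :
  schwartz (fun A => phi (a, A)) ->
  orbI psi dA phi a = S (fun w => phi (a, L w) * psi (cubic sg tu w / a)).
Proof.
move=> hf.
have hfp := schwartz_psi punif psi_char e_neq0 psi_triv a hf (pol_locunif punif pol_phase).
rewrite /orbI cintegral_dA //.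
have [L' [LK L'K _ L'B]] := signed_perm_inv F (@csgn R F J ch) (cdim ch) (@cidx_inj _ _ _ ch).
rewrite -(@S_linear_iso _ _ _ punif _ haar _ _ L L' _ L'B LK L'K _ (esym (cdim ch)) hfp).
  by congr S; apply/funext => w; rewrite /P (@cphase R F J ch).
by move=> r v; rewrite vle_signed_perm ?(cdim ch) //; exact: cidx_inj.
Qed.

Lemma kloosterman_S a (D : set F) (B : F -> bool) : (forall x, D x <-> B x) ->
  schwartz (klo a (fun x => (B x)%:R)) ->
  kloosterman psi dx D a = S (klo a (fun x => (B x)%:R)).
Proof.
move=> hD hs; rewrite /kloosterman (@cintegral_mkcond R _ (borel (0 : F)) dx D B _ hD).
have eB : (fun X : 'rV[F]_1 => if B (X 0 0) then psi ((X 0 0 + (X 0 0)^-1) / a) else 0) =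
    klo a (fun x => (B x)%:R).
  by apply/funext => X; rewrite /klo; case: (B _); rewrite ?mul1r ?mul0r.
rewrite (@cintegral_schwartz_int _ _ _ punif _ _ dx_sd (fun x => if B x then psi ((x + x^-1) /
  a) else 0)) eB //.
Qed.

(** Spread Phi(a) evenly over a ball around A = 0 of volume [V], so small that psi is 1 on the phase
    for every a in the support of Phi. *)
Lemma orbI_surj (Phi : units F -> C) : test_function Phi ->
  exists2 phi : F * 'rV[F]_(jdim J) -> C, test_function phi &
    forall a : units F, orbI psi dA phi (\val a) = Phi a.
Proof.
move=> tPhi; have [lc _] := tPhi; have [j hj] := test_function_units punif tPhi.
(* Extension of Phi by 0, locally constant at 0 because the support of Phi stays away from 0. *)
pose Pt (a : F) : C := if insub a is Some b then Phi b else 0.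
have PtE (b : units F) : Pt (\val b) = Phi b by rewrite /Pt valK.
have Ptz a : Pt a != 0 -> exists2 b : units F, a = \val b & Phi b != 0.
  rewrite /Pt; case: insubP => [b _ <- h|_]; last by rewrite eqxx.
  by exists b.
have e0' : 0 < `|e|_F by rewrite lfabs_gt0.
(* The phase vanishes at A = 0 and is at most pi^i on the ball, below |e| pi^j; as |a| >= pi^j on
   the support of Phi, its quotient by a is at most |e|. *)
have [i hi] := unifX_small punif (mulr_gt0 e0' (unifX_gt0 punif j)).
pose V := (`|p ^+ i|_F * vol 1) ^+ jdim J.
have pi0 : p ^+ i != 0 by rewrite expf_neq0 // unif_neq0.
have V0 : V != 0.
  by rewrite expf_neq0 // mulf_neq0 ?lfabs_neq0 // gt_eqF // (vol_gt0 punif haar).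
pose phi (z : F * 'rV[F]_(jdim J)) : C := Pt z.1 / V%:C%C * (vle `|p ^+ i|_F z.2)%:R.
have phi_ball a : schwartz (fun A => phi (a, A)).
  have [n hn] := @schwartz_ball _ _ _ punif (jdim J) _ pi0.
  exists n; split=> [x|x t ht]; last by rewrite /phi /= hn.2.
  by rewrite /phi mulf_eq0 negb_or => /andP[_ /hn.1].
have pi1 : `|p ^+ i|_F <= 1.
  by rewrite lfabsX exprn_ile1 ?lfabs_ge0 // ltW // unif_lt1.
exists phi.
  apply: (test_functionI punif (j := j)); last first.
    move=> a A; rewrite /phi /= mulf_eq0 negb_or => /andP[].
    rewrite mulf_eq0 negb_or => /andP[/Ptz[b -> /hj/andP[_ hb]] _].
    case: (boolP (vle _ _)) => [h _|]; last by rewrite eqxx.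
    split=> //; apply: vle_trans h; apply: le_trans pi1 _; exact: unifVX_ge1.
  have lcPt a : exists2 d : R, 0 < d & forall b, `|b - a|_F < d -> Pt b = Pt a.
    have [a0|a0] := eqVneq a 0.
      exists (pi ^+ j) => [|b]; first exact: unifX_gt0.
      rewrite a0 subr0 => hb.
      have z b' : `|b'|_F < pi ^+ j -> Pt b' = 0.
        move=> hb'; apply/eqP/negPn/negP => /Ptz[b'' e1 /hj/andP[h _]].
        by move: hb'; rewrite e1 ltNge h.
      by rewrite !z // lfabs0 unifX_gt0.
    have au : a \in units F by rewrite inE.
    pose u : units F := exist _ a au.
    have /nbhs_units[d d0 hd] := lc u.
    exists (Num.min d `|a|_F); first by rewrite lt_min d0 lfabs_gt0.
    move=> b; rewrite lt_min => /andP[h1 h2].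
    have bu : b \in units F.
      rewrite inE /units /= -lfabs_gt0 -(subrK a b) addrC lfabs_add_eq // lfabs_gt0 //.
    by rewrite -[b]/(\val (exist _ b bu : units F)) -[a]/(\val u) !PtE hd.
  move=> [a A]; have [d d0 hd] := lcPt a.
  apply/nbhs_lfabs_prod; exists (Num.min d `|p ^+ i|_F).
    by rewrite lt_min d0 lfabs_gt0.
  move=> [b B] /=; rewrite lt_min => /andP[h1 _] h2; rewrite /phi /= hd //.
  congr (_ * _%:R); congr nat_of_bool; rewrite -(subrK A B) addrC vle_addr //.
  by apply/vleP => i'; rewrite !mxE; have := h2 i'; rewrite lt_min => /andP[_ /ltW].
move=> a; have ha : \val a != 0 by have := set_valP a.
have -> : orbI psi dA phi (\val a) = cintegral dA setT (fun A => phi (\val a, A)).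
  rewrite /orbI; congr cintegral; apply/funext => A.
  rewrite /phi /= PtE; have [->|/hj/andP[h1 _]] := eqVneq (Phi a) 0.
    by rewrite !mul0r.
  have [hA|_] := boolP (vle _ _); last by rewrite !mulr0 mul0r.
  rewrite psi_triv ?mulr1 // lfabsM lfabsV ler_pdivrMr ?lfabs_gt0 //.
  have := pol_phase (lexx 1) (lfabs_ge0 (p ^+ i)) pi1 (vle0 _ _ ler01) hA.
  rewrite add0r phase0 subr0 expr1n mul1r => -[_ h].
  apply: le_trans h _; rewrite lfabsX; apply: le_trans (ltW hi) _.
  by rewrite ler_pM2l.
rewrite cintegral_dA // /phi /= S_scale //; last exact: schwartz_ball.
by rewrite S_ball // PtE divfK // -(rmorph0 (real_complex R)) (inj_eq (@complexI _)).
Qed.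

Lemma lfabs_sgtu0 : vle 1 s0.
Proof.
rewrite vle_row_mx; apply/andP; split; apply/vleP => i.
  have := @csg_pol _ _ _ ch i 1 0 0 0 (lexx _) (lexx _) ler01 (vle0 _ _ ler01) (vle0 _ _ (lexx _)).
  by rewrite expr1n => -[].
have := @ctu_pol _ _ _ ch i 1 0 0 0 (lexx _) (lexx _) ler01 (vle0 _ _ ler01) (vle0 _ _ (lexx _)).
by rewrite expr1n => -[].
Qed.

Lemma vle_L r (w : 'rV[F]_(1 + ((k + k) + (l + l)))) : vle r (L w) = vle r w.
Proof. by rewrite vle_signed_perm ?(cdim ch) //; exact: cidx_inj. Qed.

Lemma vle_jone : vle 1 (jone J).
Proof. by rewrite -(@cone R F J ch) vle_L vle_pack lfabs1 lexx vle0 // lfabs_sgtu0. Qed.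

(** With |e| = 1 all scales of the reduction can be taken equal to 1, so the formula is exact for
    every |a| < 1 and not only for small a. *)
Lemma orbI_integers a : `|e|_F = 1 -> a != 0 ->
  let phi := fun y => (\1_(Yintegers J) y)%:C%C in
  [/\ 1 < `|a|_F -> orbI psi dA phi a = 0,
      `|a|_F = 1 -> orbI psi dA phi a = 1 &
      `|a|_F < 1 -> orbI psi dA phi a =
        (`|a|_F ^+ (jdim J).-1./2)%:C%C * kloosterman psi dx [set x : F | `|x|_F = 1] a].
Proof.
move=> e1 a0 phi.
have v1 : vol 1 = 1.
  have := sdv; rewrite e1 mul1r -expr2 => /eqP; rewrite sqrf_eq1 => /orP[/eqP//|/eqP h].
  by have := vol_gt0 punif haar (ltr01 : 0 < (1 : R)); rewrite h ltr0N1.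
have phiE A : phi (a, A) = ((`|a|_F <= 1) && vle 1 A)%R%:R.
  rewrite /phi indicE rmorph_nat; congr (_%:R); congr nat_of_bool.
  apply/idP/andP => [|[h1 /vleP h2]]; first by rewrite inE => -[h1 h2]; split=> //; apply/vleP.
  by rewrite inE; split.
have h1n := oner_neq0 F.
have sb m : schwartz (fun x : 'rV[F]_m => (vle 1 x)%:R).
  by have := @schwartz_ball _ _ _ punif m _ h1n; rewrite lfabs1.
have ff : (fun A => phi (a, A)) = fun A => (if `|a|_F <= 1 then (vle 1 A)%:R else 0).
  by apply/funext => A; rewrite phiE; case: (_ <= _).
have hs : schwartz (fun A => phi (a, A)).
  rewrite ff; case: (_ <= _); first exact: sb.
  by exists 0%N; split=> // x; rewrite eqxx.
split.
- move=> a1; rewrite orbI_S //; apply: S_null => // w.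
  by rewrite phiE leNgt a1 mul0r.
- move=> a1; rewrite /orbI.
  have -> : (fun A => phi (a, A) * psi ((jtrace A - jnorm A) / a)) =
     fun A : 'rV[F]_(jdim J) => (vle 1 A)%:R.
    apply/funext => A; rewrite phiE a1 lexx /=.
    have [hA|_] := boolP (vle 1 A); last by rewrite mul0r.
    rewrite mul1r psi_triv // e1 lfabsM lfabsV a1 invr1 mulr1.
    have := pol_phase (lexx 1) (lexx 0) ler01 hA (vle0 _ _ (lexx 0)).
    by rewrite expr1n => -[].
  rewrite cintegral_dA //; have := S_ball punif haar (jdim J) h1n.
  by rewrite lfabs1 => ->; rewrite v1 mul1r expr1n.
move=> a1; rewrite orbI_S //.
have := @S_reduction _ _ _ punif _ psi_char _ haar _ e_neq0 psi_triv psi_nontriv sdv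
  k l sg tu (ci0 ch) (@csg_pol _ _ _ ch) (@ctu_pol _ _ _ ch) (@cquad _ _ _ ch) (@cunit _ _ _ ch)
  a 1 1 1 1 (fun w => phi (a, L w)) a0 h1n h1n.
rewrite lfabs1 e1 !mul1r expr1n !mulr1.
move=> /(_ (lexx _) ltr01 (lexx _) (lexx _) (lexx _) (lexx _) a1 (ltW a1) (ltW a1)) ->; first last.
- by move=> w t ht; rewrite !phiE signed_permD vle_addr ?vle_L.
- by move=> w; rewrite phiE vle_L (ltW a1) /=; case: (vle 1 w); rewrite ?eqxx.
have ksch : schwartz (klo a (fun x => (`|x|_F == 1)%R%:R)).
  apply: (@schwartz_klo _ _ _ punif _ psi_char _ e_neq0 psi_triv a p 1 1) => //; first exact:
    unif_neq0.
    by move=> x; have [->|_] := eqVneq `|x|_F 1; rewrite ?lexx ?eqxx.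
  move=> x t ht; congr (_%:R); congr nat_of_bool.
  have t1 : `|t|_F < 1 by apply: le_lt_trans ht (unif_lt1 punif).
  apply/eqP/eqP => hx; last by rewrite lfabs_add_eq ?hx.
  by rewrite -(addrK t x) lfabs_add_eq ?lfabsN hx.
rewrite (@kloosterman_S a _ (fun x => `|x|_F == 1)) //; last by move=> x; split=> /eqP.
rewrite -S_scale //; congr S; apply/funext => X /=; rewrite /klo; set x := X 0 0.
rewrite phiE vle_L vle_pack (ltW a1) /= vle0 ?ler01 // half_jdim.
(* |x| < 1 is the nonstationary range and |x| > 1 lies outside the support; the units remain. *)
have [x1|x1|x1] := ltgtP `|x|_F 1; rewrite ?mul0r ?mulr0 //.
have -> : vle 1 (x^-1 *: s0).
  by have := vleZ x^-1 lfabs_sgtu0; rewrite lfabsV x1 invr1 mul1r.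
by rewrite !lfabsM lfabsV x1 invr1 mulr1 mul1r -exprD addnC.
Qed.

Lemma congr_ballP c m x : congr_ball p c m x <-> `|x - c|_F <= pi ^+ m.
Proof.
rewrite /congr_ball /=; split=> [[y hy <-]|hx].
  by rewrite addrC addKr lfabsM lfabsX ler_piMr ?unifX_ge0.
exists ((x - c) / p ^+ m); last by rewrite mulrC divfK ?expf_neq0 ?unif_neq0 // addrC subrK.
by rewrite /integers /= lfabsM lfabsV lfabsX ler_pdivrMr ?unifX_gt0 // mul1r.
Qed.

(** * The germ at 0 of the normalized orbital integral *)

Section Asymptotics.
Variable phi : F * 'rV[F]_(jdim J) -> C.
Variable j : nat.
Hypothesis phi_supp : forall a v, phi (a, v) != 0 -> `|a|_F <= pi ^- j /\ vle (pi ^- j) v.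
Hypothesis phi_inv : forall a v b t, `|b|_F <= pi ^+ j -> vle (pi ^+ j) t ->
      phi (a + b, v + t) = phi (a, v).
Let f (a : units F) : C := (`|\val a|_F ^- (jdim J).-1./2)%:C%C * orbI psi dA phi (\val a).

Lemma phi_schwartz a : schwartz (fun A => phi (a, A)).
Proof.
exists j; split=> [x /phi_supp[]//|x t ht].
by rewrite -[RHS](@phi_inv a x 0 t) ?addr0 ?lfabs0 ?unifX_ge0.
Qed.

Lemma orbI_locally_constant : locally_constant f.
Proof.
move=> a; have a0 : \val a != 0 by have := set_valP a.
have a0' : 0 < `|\val a|_F by rewrite lfabs_gt0.
have e0' : 0 < `|e|_F by rewrite lfabs_gt0.
(* The cubic phase is at most pi^(-3j) on the support, so replacing a by b changes its quotient by
   at most pi^(-3j) |b - a| / |a|^2, hence by at most |e|. *)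
pose B := `|e|_F * `|\val a|_F ^+ 2 * pi ^+ (3 * j).
have B0 : 0 < B by rewrite !mulr_gt0 ?exprn_gt0 // unif_gt0.
apply/nbhs_units; exists (Num.min `|\val a|_F (Num.min (pi ^+ j) B)).
  by rewrite !lt_min a0' B0 unifX_gt0.
move=> b; rewrite !lt_min => /and3P[h1 h2 h3].
have hb : `|\val b|_F = `|\val a|_F by rewrite -(subrK (\val a) (\val b)) addrC lfabs_add_eq.
have b0 : \val b != 0 by rewrite -lfabs_gt0 hb.
rewrite /f hb; congr (_ * _); rewrite /orbI; congr cintegral; apply/funext => A.
have -> : phi (\val b, A) = phi (\val a, A).
  rewrite -[RHS](@phi_inv _ _ (\val b - \val a) 0) ?(ltW h2) ?vle0 ?unifX_ge0 //.
  by rewrite addrC subrK addr0.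
have [->|/phi_supp[_ hA]] := eqVneq (phi (\val a, A)) 0; first by rewrite !mul0r.
congr (_ * _); apply: psi_eq => //; apply: psi_triv.
have [hP _] := pol_phase (unifVX_ge1 punif j) (lexx 0) (ltW (unifVX_gt0 punif j)) hA (vle0 _ _
  (lexx 0)).
rewrite -/(P A).
have -> : P A / \val b - P A / \val a = P A * ((\val a - \val b) / (\val a * \val b)).
  by field; rewrite a0 b0.
rewrite lfabsM; apply: le_trans (ler_wpM2r (lfabs_ge0 _) hP) _.
rewrite lfabsM lfabsV lfabsM hb -expr2 lfabsBC mulrA ler_pdivrMr ?exprn_gt0 //.
rewrite exprVn -exprM mulnC ler_pdivrMl ?unifX_gt0 //.
by rewrite [X in _ <= X]mulrC ltW.
Qed.

Lemma orbI_bounded : exists B : R, forall a : units F, f a != 0 -> `|\val a|_F <= B.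
Proof.
exists (pi ^- j) => a; apply: contraNT; rewrite -ltNge => ha.
rewrite /f orbI_S; last exact: phi_schwartz.
rewrite S_null ?mulr0 // => w; have [->|/phi_supp[h _]] := eqVneq (phi (\val a, L w)) 0.
  by rewrite mul0r.
by move: ha; rewrite ltNge h.
Qed.

(** The amplitude left by the reduction: |a / x|^l |x a|^k divided by |a|^(k + l), times phi on the
    critical curve. The cutoff is the nonstationary range for eps = pi^j. *)
Let h (x : F) : C := if `|x|_F < pi ^+ j then 0 else
  (`|x|_F ^+ k / `|x|_F ^+ l)%:C%C * phi (0, L (pack x 0 (x^-1 *: s0))).

Lemma phi_eq a v v' : vle (pi ^+ j) (v' - v) -> phi (a, v') = phi (a, v).
Proof.
move=> hv; rewrite -[RHS](@phi_inv a v 0 (v' - v)) ?lfabs0 ?unifX_ge0 //.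
by rewrite addr0 addrC subrK.
Qed.

Lemma amplitude_supp x : h x != 0 -> pi ^+ j <= `|x|_F <= pi ^- j.
Proof.
rewrite /h; case: ltP => hx; first by rewrite eqxx.
rewrite mulf_eq0 negb_or => /andP[_ /phi_supp[_]].
by rewrite vle_L vle_pack => /and3P[-> _ _].
Qed.

(** For |x| >= pi^j, 1/x moves by |t| / |x|^2, at most pi^j once |t| <= pi^(3j). The extra 1 in the
    exponent makes |t| < pi^j strict even for j = 0, so that |x + t| = |x|. *)
Lemma amplitude_inv x t : `|t|_F <= `|p ^+ (3 * j).+1|_F -> h (x + t) = h x.
Proof.
rewrite lfabsX => ht.
have ht1 : `|t|_F < pi ^+ j.
  apply: le_lt_trans ht _; rewrite -(mul1n j) exprS.
  apply: lt_le_trans (_ : pi ^+ (3 * (1 * j)) <= _).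
    by rewrite gtr_pMl ?unifX_gt0 ?unif_lt1.
  by apply: unifX_le => //; lia.
have [xs|xs] := ltP `|x|_F (pi ^+ j).
  by rewrite /h xs lfabsD_lt.
have x0' : 0 < `|x|_F by apply: lt_le_trans xs; exact: unifX_gt0.
have ext : `|x + t|_F = `|x|_F by apply: lfabs_add_eq; exact: lt_le_trans xs.
have x0 : x != 0 by rewrite -lfabs_gt0.
have xt0 : x + t != 0 by rewrite -lfabs_gt0 ext.
rewrite /h ext; case: ltP => // _; congr (_ * _); apply: phi_eq.
have -> : L (pack (x + t) 0 ((x + t)^-1 *: s0)) - L (pack x 0 (x^-1 *: s0)) =
    L (pack t 0 (((x + t)^-1 - x^-1) *: s0)).
  rewrite -signed_permN -signed_permD; congr (L _).
  have -> : - pack x (0 : 'rV[F]_(k + k)) (x^-1 *: s0) = pack (- x) 0 (- (x^-1 *: s0)).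
    by rewrite /pack !opp_row_mx oppr0; congr row_mx; apply/rowP => i; rewrite !mxE.
  by rewrite packD addr0 (addrC x) addrK scalerBl.
rewrite vle_L vle_pack (ltW ht1) vle0 ?unifX_ge0 //=.
apply: vle_trans (vleZ _ lfabs_sgtu0); rewrite mulr1.
have -> : (x + t)^-1 - x^-1 = - t / (x * (x + t)) by field; rewrite x0 xt0.
rewrite lfabsM lfabsV lfabsM ext lfabsN ler_pdivrMr ?mulr_gt0 //.
apply: le_trans ht _; apply: le_trans (_ : pi ^+ j * (pi ^+ j * pi ^+ j) <= _).
  by rewrite -!exprD; apply: unifX_le => //; lia.
by rewrite ler_wpM2l ?unifX_ge0 // ler_pM ?unifX_ge0.
Qed.

(** The scales are |d| = eps = pi^j and r = pi^-j. Then r^2 |d'| <= eps |d| leads to |d'| = pi^(4j),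
    and |e a| r <= |d'|^2 leads to the exponent 9j. The bound |a| <= pi^j permits replacing phi(a,
    A) by phi(0, A). *)
Lemma orbI_klo a : a != 0 -> `|e|_F * `|a|_F < pi ^+ (9 * j) -> `|a|_F <= pi ^+ j ->
  (`|a|_F ^- (jdim J).-1./2)%:C%C * orbI psi dA phi a = S (klo a h).
Proof.
move=> a0 ea aj; have a0' : 0 < `|a|_F by rewrite lfabs_gt0.
rewrite orbI_S; last exact: phi_schwartz.
have p0 := unif_gt0 punif.
have pn0 i : p ^+ i != 0 by rewrite expf_neq0 // unif_neq0.
have le9 i : (i <= 9 * j)%N -> `|e|_F * `|a|_F < pi ^+ i.
  by move=> hi; apply: lt_le_trans ea _; exact: unifX_le.
have phia A : phi (a, A) = phi (0, A).
  by rewrite -[RHS](@phi_inv 0 A a 0) ?vle0 ?unifX_ge0 // add0r addr0.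
rewrite (@S_reduction _ _ _ punif _ psi_char _ haar _ e_neq0 psi_triv psi_nontriv sdv
  k l sg tu (ci0 ch) (@csg_pol _ _ _ ch) (@ctu_pol _ _ _ ch) (@cquad _ _ _ ch) (@cunit _ _ _ ch)
  a (p ^+ j) (p ^+ (4 * j)) (pi ^- j) (pi ^+ j) (fun w => phi (a, L w))) //.
- have ksch : schwartz (klo a h).
    apply: (@schwartz_klo _ _ _ punif _ psi_char _ e_neq0 psi_triv a (p ^+ (3 * j).+1)
      (pi ^+ j) (pi ^- j)) => //; first exact: unifX_gt0.
    + exact: amplitude_supp.
    exact: amplitude_inv.
  rewrite (_ : (fun X : 'rV[F]_1 => _) = fun X => (`|a|_F ^+ (k + l))%:C%C * klo a h X).
    rewrite S_scale // mulrA -rmorphM half_jdim mulVf ?mul1r //.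
    by rewrite expf_neq0 // gt_eqF.
  apply/funext => X /=; rewrite /klo /h; set x := X 0 0; case: ltP => hx.
    by rewrite mul0r mulr0.
  rewrite phia !mulrA -rmorphM; congr (_%:C%C * _ * _).
  have x0 : `|x|_F != 0 by rewrite gt_eqF // (lt_le_trans _ hx) // unifX_gt0.
  by rewrite !lfabsM lfabsV !exprMn exprVn exprD; ring.
- exact: unifVX_ge1.
- exact: unifX_gt0.
- by rewrite divff // gt_eqF // unifX_gt0.
- by rewrite !lfabsX; apply: unifX_le => //; lia.
- rewrite lfabsX; apply: le_trans (unifVX_ge1 punif j).
  by rewrite exprn_ile1 ?lfabs_ge0 // ltW // unif_lt1.
- rewrite !lfabsX exprVn -exprM ler_pdivrMl ?unifX_gt0 // -!exprD.
  by apply: unifX_le => //; lia.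
- by rewrite lfabsX; apply: le9; lia.
- by rewrite lfabsX -exprM -exprD ltW //; apply: le9; lia.
- rewrite lfabsX -exprM ler_pdivrMr ?unifX_gt0 // -exprD ltW //; apply: le9; lia.
- by move=> w /phi_supp[_]; rewrite vle_L.
move=> w t; rewrite lfabsX => ht; apply: phi_eq.
by rewrite signed_permD addrC addKr vle_L.
Qed.

Lemma L_jone : L (pack 1 0 (1^-1 *: s0)) = jone J.
Proof. by rewrite invr1 scale1r (@cone R F J ch). Qed.

Lemma L_Njone : L (pack (-1) 0 ((-1)^-1 *: s0)) = - jone J.
Proof.
rewrite -(@cone R F J ch) -signed_permN; congr (L _).
rewrite invrN1 scaleN1r /pack !opp_row_mx oppr0; congr row_mx.
by apply/rowP => i; rewrite !mxE.
Qed.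

Lemma orbI_C_OI : C_OI psi p dx (orbIplus phi) (orbIminus phi) f.
Proof.
split; [exact: orbI_locally_constant|exact: orbI_bounded|move=> m m0 hm].
have p0 := unif_gt0 punif.
have e0' : 0 < `|e|_F by rewrite lfabs_gt0.
have d0 : p ^+ (3 * j).+1 != 0 by rewrite expf_neq0 // unif_neq0.
have [eta eta0 heta] := @S_klo_germ _ _ _ punif _ psi_char _ haar _ e_neq0 psi_triv
  psi_nontriv _ _ _ h m d0 (unifX_gt0 punif j) (unifVX_gt0 punif j) m0 hm
  amplitude_supp amplitude_inv.
pose B := Num.min eta (Num.min (pi ^+ (9 * j) / `|e|_F) (pi ^+ j)).
exists [set a : F | `|a|_F < B].
  apply/nbhs_lfabsP; exists B; first by rewrite !lt_min eta0 divr_gt0 ?unifX_gt0.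
  by move=> a; rewrite subr0.
move=> a /=; have a0 : \val a != 0 by have := set_valP a.
rewrite !lt_min => /and3P[h1 h2 h3].
rewrite /f orbI_klo //; last 2 first.
- by rewrite mulrC -ltr_pdivlMr.
- exact: ltW.
have pj1 : pi ^+ j <= 1 by rewrite exprn_ile1 ?lfabs_ge0 // ltW // unif_lt1.
rewrite heta //; congr (_ * _ + _ * _).
- by rewrite /h lfabs1 ltNge pj1 /= L_jone !expr1n divff ?oner_eq0 // mul1r.
- rewrite (@kloosterman_S _ _ (fun x => `|x - 1|_F <= pi ^+ m)) //; first exact: congr_ballP.
  by apply: (@schwartz_klo_ball _ _ _ punif _ psi_char _ e_neq0 psi_triv _ (-1) m) => //;
    rewrite lfabsN lfabs1.
- by rewrite /h lfabsN lfabs1 ltNge pj1 /= L_Njone !expr1n divff ?oner_eq0 // mul1r.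
rewrite (@kloosterman_S _ _ (fun x => `|x + 1|_F <= pi ^+ m)) //.
  by move=> x; rewrite -{2}[1]opprK; exact: congr_ballP.
by apply: (@schwartz_klo_ball _ _ _ punif _ psi_char _ e_neq0 psi_triv _ 1 m) => //; rewrite lfabs1.
Qed.

End Asymptotics.

End OrbitalIntegrals.

Theorem theorem4p2 (R : realType) (F : nonArchLocalFieldType R)
  (varpi : F) (varpi_unif : uniformizer varpi)
  (psi : F -> R[i]) (psi_char : additive_character psi)
  (psi_nontriv : nontrivial_character psi)
  (dx : {measure set (borel (0 : F)) -> \bar R})
  (dx_selfdual : self_dual psi dx)
  (J : cubicJordan F) (J_split : split_cubicJordan J)
  (dA : {measure set (borel (0 : 'rV[F]_(jdim J))) -> \bar R})
  (dA_prod : product_measure_of dx dA) :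
  [/\ forall Phi : units F -> R[i], test_function Phi ->
        exists2 phi : F * 'rV[F]_(jdim J) -> R[i], test_function phi &
          forall a : units F, orbI psi dA phi (\val a) = Phi a,
      unramified varpi psi ->
        let phi := fun y => (\1_(Yintegers J) y)%:C%C in
        [/\ orbIplus phi = 1, orbIminus phi = 1 &
          forall a : units F,
            [/\ 1 < lfabs (\val a) -> orbI psi dA phi (\val a) = 0,
                lfabs (\val a) = 1 -> orbI psi dA phi (\val a) = 1 &
                lfabs (\val a) < 1 -> orbI psi dA phi (\val a) =
                  (lfabs (\val a) ^+ (jdim J).-1./2)%:C%C *
                  kloosterman psi dx [set x : F | lfabs x = 1] (\val a)]]
    & forall phi : F * 'rV[F]_(jdim J) -> R[i], test_function phi ->
        C_OI psi varpi dx (orbIplus phi) (orbIminus phi)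
          (fun a => (lfabs (\val a) ^- (jdim J).-1./2)%:C%C *
                    orbI psi dA phi (\val a))].
Proof.
have [ch] := split_chart J_split; split.
- have [e [e0 et en]] := psi_conductor varpi_unif psi_char psi_nontriv.
  exact: (orbI_surj varpi_unif dx_selfdual e0 et ch dA_prod).
- move=> [psi1 [x x1 px]] phi.
  (* For psi unramified the conductor is O, so e = 1 can be used. *)
  have triv (y : F) : lfabs y <= lfabs (1 : F) -> psi y = 1 by rewrite lfabs1; exact: psi1.
  have nontriv : exists y, lfabs varpi * lfabs y <= lfabs (1 : F) /\ psi y != 1.
    exists (varpi^-1 * x); split=> //.
    by rewrite -lfabsM mulrA mulfV ?(unif_neq0 varpi_unif) // mul1r lfabs1.
  have one1 := vle_jone ch.
  split.
  + rewrite /orbIplus /phi indicE mem_set ?rmorph1 //; split=> [|i] /=.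
      by rewrite /integers /= lfabs0 ler01.
    by move/vleP: one1; exact.
  + rewrite /orbIminus /phi indicE mem_set ?rmorph1 //; split=> [|i] /=.
      by rewrite /integers /= lfabs0 ler01.
    by rewrite /integers /= mxE lfabsN; move/vleP: one1; exact.
  move=> a; have a0 : \val a != 0 by have := set_valP a.
  exact: (orbI_integers varpi_unif psi_char dx_selfdual (oner_neq0 F) triv nontriv
    ch dA_prod (lfabs1 F) a0).
move=> phi /(test_function_uniform varpi_unif)[j [supp inv]].
have [e [e0 et en]] := psi_conductor varpi_unif psi_char psi_nontriv.
exact: (orbI_C_OI varpi_unif psi_char dx_selfdual e0 et en ch dA_prod supp inv).
Qed.
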